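(* Let $\Bbbk$ be a commutative ring and let $\mathcal{H}$ be a Hopf algebra over $\Bbbk$ endowed with a modular pair in involution $(\chi,1)$. Then: a) The canonical algebra structure (concatenation product $\cup$) of the Cobar construction $\Omega\mathcal{H}$, together with its Connes-Moscovici cocyclic structure (through the induced Connes coboundary $B$), defines a Batalin-Vilkovisky algebra structure on $\mathrm{Cotor}^{*}_{\mathcal{H}}(\Bbbk,\Bbbk)=H^*(\Omega\mathcal{H})$. b) The cyclic cohomology of $\mathcal{H}$, denoted $HC^*_{(\chi,1)}(\mathcal{H})$, is a graded Lie algebra of degree $-2$, with the bracket described in the context.
   Context: **Modular pair.** $\mathcal H$ is an (ungraded) Hopf algebra with diagonal $\Delta$, counit $\varepsilon$, unit $1$, antipode $S$. A character is an algebra morphism $\chi:\mathcal H\to\Bbbk$. The twisted antipode is $\widetilde S(h)=\chi(h^{1})S(h^{2})$, where $\Delta h=h^{1}\otimes h^{2}$ (implicit sum). The pair $(\chi,1)$ is a modular pair in involution if $\widetilde S\circ\widetilde S=\mathrm{id}_{\mathcal H}$. **Cobar construction and cocyclic structure.** $\Omega\mathcal H$ is the cochain complex associated with the cosimplicial module $n\mapsto\mathcal H^{\otimes n}$ ($n\ge 0$) with cofaces $\delta_0(h_1\otimes\cdots\otimes h_n)=1\otimes h_1\otimes\cdots\otimes h_n$, $\delta_i(h_1\otimes\cdots\otimes h_n)=h_1\otimes\cdots\otimes\Delta h_i\otimes\cdots\otimes h_n$ for $1\le i\le n$, $\delta_{n+1}(h_1\otimes\cdots\otimes h_n)=h_1\otimes\cdots\otimes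 h_n\otimes 1$, and codegeneracies $\sigma_{i-1}(h_1\otimes\cdots\otimes h_n)=\varepsilon(h_i)\,h_1\otimes\cdots\otimes h_{i-1}\otimes h_{i+1}\otimes\cdots\otimes h_n$ for $1\le i\le n$. The differential is $d=\sum_{i=0}^{n+1}(-1)^i\delta_i$ on $\mathcal H^{\otimes n}$. The product on $\Omega\mathcal H$ is $f\cup g=f\otimes g$. The Connes-Moscovici cocyclic operators are $$\tau_n(h_1\otimes\cdots\otimes h_n)=\big(\Delta^{n-1}\widetilde S(h_1)\big)\cdot(h_2\otimes\cdots\otimes h_n\otimes 1),\quad n\ge1,$$ where $\Delta^{n-1}:\mathcal H\to\mathcal H^{\otimes n}$ is the iterated diagonal and $\cdot$ is the product of $\mathcal H^{\otimes n}$; $\tau_0=\mathrm{id}_{\Bbbk}$. **Connes coboundary.** Let $\overline{\mathcal C}^n=\{f\in\mathcal H^{\otimes n}:\sigma_jf=0,\ 0\le j\le n-1\}$ be the normalized complex; its inclusion in $\Omega\mathcal H$ is a cochain homotopy equivalence. For $n\geq 1$, set $\sigma_n:=\sigma_{n-1}\tau_n:\mathcal H^{\otimes n}\to\mathcal H^{\otimes (n-1)}$ and $B:=\sum_{i=0}^{n-1}(-1)^{i(n-1)}\tau_{n-1}^i\,\sigma_n:\overline{\mathcal C}^n\to\overline{\mathcal C}^{n-1}$, with $B=0$ on $\overline{\mathcal C}^0$. Also write $B$ for the induced map on $H^*(\Omega\mathcal H)$. **Gerstenhaber and Batalin-Vilkovisky algebras.** A Gerstenhaber algebra is a graded module $G=\{G^i\}_{i\in\mathbb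 Z}$ with a graded commutative algebra structure $\cup:G^i\otimes G^j\to G^{i+j}$ and a linear map $\{-,-\}:G^i\otimes G^j\to G^{i+j-1}$ such that $\{a,b\}=-(-1)^{(|a|-1)(|b|-1)}\{b,a\}$, $\{a,\{b,c\}\}=\{\{a,b\},c\}+(-1)^{(|a|-1)(|b|-1)}\{b,\{a,c\}\}$ and $\{a,bc\}=\{a,b\}c+(-1)^{|b|(|a|-1)}b\{a,c\}$. A Batalin-Vilkovisky algebra is a Gerstenhaber algebra $G$ with a linear map $B:G^i\to G^{i-1}$ such that $B\circ B=0$ and $$\{a,b\}=(-1)^{|a|}\big(B(a\cup b)-(Ba)\cup b-(-1)^{|a|}a\cup(Bb)\big).$$ In particular the bracket is determined by $\cup$ and $B$. **Cyclic cohomology.** $HC^*_{(\chi,1)}(\mathcal H)$ is the cyclic cohomology of the cocyclic module $\Omega\mathcal H$, taken in the following sense: it is the cohomology of the complex $\mathrm{Tot}^n=\bigoplus_{k\ge0}\overline{\mathcal C}^{\,n+2k}$ ($n\in\mathbb Z$, with $\overline{\mathcal C}^{i}=0$ for $i<0$) with differential $(c_0,c_1,\dots)\mapsto(dc_0+Bc_1,\,dc_1+Bc_2,\dots)$. (This is the homology of the complex $M_n\oplus M_{n-2}\oplus\cdots$ of the mixed complex $M_n:=\overline{\mathcal C}^{-n}$.) There are maps $I:H^n(\Omega\mathcal H)\to HC^n$, $[c]\mapsto[(c,0,0,\dots)]$, and $\partial:HC^n\to H^{n-1}(\Omega\mathcal H)$, $[(c_0,c_1,\dots)]\mapsto[Bc_0]$.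 The bracket is $[a,b]:=(-1)^{|a|}I(\partial a\cup\partial b)$. **Graded Lie algebra of degree $-2$.** A graded module $L$ with a linear map $[-,-]:L^i\otimes L^j\to L^{i+j-2}$ satisfying $[a,b]=-(-1)^{|a||b|}[b,a]$ and $[a,[b,c]]=[[a,b],c]+(-1)^{|a||b|}[b,[a,c]]$. *)

(* Defs.v *)
From HB Require Import structures.
From mathcomp Require Import all_boot all_order all_algebra.
From mathcomp Require Import ring_quotient.
From mathcomp Require Import boolp.

Set Implicit Arguments.
Unset Strict Implicit.
Unset Printing Implicit Defensive.

Import GRing.Theory.
Local Open Scope ring_scope.
Local Open Scope quotient_scope.

Definition mk_bilinear (k : nzRingType) (M N P : lmodType k) (f : M -> N -> P)
    (fB : bilinear_for *:%R *:%R f) : {bilinear M -> N -> P} :=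
  HB.pack f (bilinear_isBilinear.Build k M N P *:%R *:%R f fB).

Section TensorRel.
Variables (k : comNzRingType) (M N : lmodType k).

(* A sequence of pairs stands for the formal sum of its tensors [m (x) n].   *)
Inductive tens_rel : seq (M * N) -> seq (M * N) -> Prop :=
| tens_refl s : tens_rel s s
| tens_sym s t : tens_rel s t -> tens_rel t s
| tens_trans s t u : tens_rel s t -> tens_rel t u -> tens_rel s u
| tens_cat s s' t t' :
    tens_rel s s' -> tens_rel t t' -> tens_rel (s ++ t) (s' ++ t')
| tens_catC s t : tens_rel (s ++ t) (t ++ s)
| tens_0l n : tens_rel [:: (0, n)] [::]
| tens_Dl m m' n : tens_rel [:: (m + m', n)] [:: (m, n); (m', n)]
| tens_Dr m n n' : tens_rel [:: (m, n + n')] [:: (m, n); (m, n')]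
| tens_Z a m n : tens_rel [:: (a *: m, n)] [:: (m, a *: n)].

Definition tens_eq : rel (seq (M * N)) := fun s t => `[< tens_rel s t >].

Lemma tens_eq_equiv : equiv_class_of tens_eq.
Proof.
split=> [s|s t|t s u]; first by apply/asboolP; exact: tens_refl.
  by apply/asboolP/asboolP => ?; exact: tens_sym.
by move=> /asboolP st /asboolP tu; apply/asboolP; exact: tens_trans st tu.
Qed.

Canonical tens_equiv := EquivRelPack tens_eq_equiv.
Canonical tens_enc := defaultEncModRel tens_eq.

Definition tens := {eq_quot tens_eq}.
HB.instance Definition _ := EqQuotient.on tens.
HB.instance Definition _ := Choice.on tens.

Definition tens_pi (s : seq (M * N)) : tens := \pi s.

Lemma tens_piP s t : tens_rel s t <-> tens_pi s = tens_pi t.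
Proof.
by split=> [st|/eqmodP/asboolP //]; apply/eqmodP/asboolP.
Qed.

Lemma tens_repr s : tens_rel (repr (tens_pi s)) s.
Proof. by apply/tens_piP; rewrite /tens_pi reprK. Qed.

Let scale1 (a : k) (s : seq (M * N)) := [seq (a *: p.1, p.2) | p <- s].

Lemma scale1_rel a s t : tens_rel s t -> tens_rel (scale1 a s) (scale1 a t).
Proof.
rewrite /scale1; elim=> {s t}.
- by move=> s; exact: tens_refl.
- by move=> s t _; exact: tens_sym.
- by move=> s t u _ st _ tu; exact: tens_trans st tu.
- by move=> s s' t t' _ ss' _ tt'; rewrite !map_cat; exact: tens_cat.
- by move=> s t; rewrite !map_cat; exact: tens_catC.
- by move=> n; rewrite /= scaler0; exact: tens_0l.
- by move=> m m' n; rewrite /= scalerDr; exact: tens_Dl.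
- by move=> m n n'; exact: tens_Dr.
- move=> b m n; rewrite /= scalerA mulrC -scalerA; exact: tens_Z.
Qed.

Definition tens_zero : tens := tens_pi [::].
Definition tens_add (x y : tens) : tens := tens_pi (repr x ++ repr y).
Definition tens_scale (a : k) (x : tens) : tens := tens_pi (scale1 a (repr x)).
Definition tens_opp (x : tens) : tens := tens_scale (-1) x.

Lemma tens_addE s t : tens_add (tens_pi s) (tens_pi t) = tens_pi (s ++ t).
Proof. by apply/tens_piP; apply: tens_cat; exact: tens_repr. Qed.

Lemma tens_scaleE a s : tens_scale a (tens_pi s) = tens_pi (scale1 a s).
Proof. by apply/tens_piP; apply: scale1_rel; exact: tens_repr. Qed.

Lemma tens_piK (x : tens) : tens_pi (repr x) = x.
Proof. exact: reprK. Qed.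

Lemma tens_addA : associative tens_add.
Proof.
move=> x y z; rewrite -[x]tens_piK -[y]tens_piK -[z]tens_piK.
by rewrite !tens_addE catA.
Qed.

Lemma tens_addC : commutative tens_add.
Proof.
move=> x y; rewrite -[x]tens_piK -[y]tens_piK !tens_addE.
by apply/tens_piP; exact: tens_catC.
Qed.

Lemma tens_add0 : left_id tens_zero tens_add.
Proof. by move=> x; rewrite -[x]tens_piK tens_addE. Qed.

Lemma tens_scaleA a b x : tens_scale a (tens_scale b x) = tens_scale (a * b) x.
Proof.
rewrite -[x]tens_piK !tens_scaleE /scale1 -map_comp; congr tens_pi.
by apply: eq_map => p /=; rewrite scalerA.
Qed.

Lemma tens_scale0 x : tens_scale 0 x = tens_zero.
Proof.
rewrite -[x]tens_piK tens_scaleE; apply/tens_piP.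
elim: (repr x) => [|[m n] s IH] /=; first exact: tens_refl.
rewrite scale0r -cat1s -[[::]]cats0; apply: tens_cat => //; exact: tens_0l.
Qed.

Lemma tens_scale1 : left_id 1 tens_scale.
Proof.
move=> x; rewrite -[RHS]tens_piK -[in LHS](tens_piK x) tens_scaleE.
by congr tens_pi; rewrite -[RHS]map_id; apply: eq_map => -[m n] /=; rewrite scale1r.
Qed.

Lemma tens_scaleDr : right_distributive tens_scale tens_add.
Proof.
move=> a x y; rewrite -[x]tens_piK -[y]tens_piK.
by rewrite !(tens_addE, tens_scaleE) /scale1 map_cat.
Qed.

Lemma tens_scaleDl x : {morph tens_scale^~ x : a b / a + b >-> tens_add a b}.
Proof.
move=> a b; rewrite -[x]tens_piK !tens_scaleE tens_addE; apply/tens_piP.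
elim: (repr x) => [|[m n] s IH] /=; first exact: tens_refl.
rewrite scalerDl -cat1s.
apply: tens_trans (tens_cat (tens_Dl _ _ _) IH) _.
rewrite /= -cat1s -[in X in tens_rel _ X]cat1s; apply: tens_cat; first exact: tens_refl.
rewrite -cat1s -[in X in tens_rel _ X]cat1s !catA; apply: tens_cat; last exact: tens_refl.
exact: tens_catC.
Qed.

Lemma tens_addN : left_inverse tens_zero tens_opp tens_add.
Proof.
move=> x; rewrite -[X in tens_add _ X]tens_scale1 /tens_opp -tens_scaleDl.
by rewrite addNr tens_scale0.
Qed.

HB.instance Definition _ :=
  GRing.isZmodule.Build tens tens_addA tens_addC tens_add0 tens_addN.
HB.instance Definition _ := GRing.Zmodule_isLmodule.Build k tens
  tens_scaleA tens_scale1 tens_scaleDr tens_scaleDl.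

Definition tpure (m : M) (n : N) : tens := tens_pi [:: (m, n)].

Lemma tpure_linearl n : linear (tpure ^~ n).
Proof.
move=> a m m'; apply: esym; rewrite [LHS]/GRing.add /= [X in tens_add X _]/GRing.scale /=.
rewrite tens_scaleE tens_addE; apply/tens_piP/tens_sym; exact: tens_Dl.
Qed.

Lemma tpure_linearr m : linear (tpure m).
Proof.
move=> a n n'; apply: esym; rewrite [LHS]/GRing.add /= [X in tens_add X _]/GRing.scale /=.
rewrite tens_scaleE tens_addE; apply/tens_piP/tens_sym.
apply: tens_trans (tens_Dr _ _ _) _; rewrite -cat1s -[in X in tens_rel _ X]cat1s.
by apply: tens_cat; [apply/tens_sym; exact: tens_Z | exact: tens_refl].
Qed.

HB.instance Definition _ :=
  bilinear_isBilinear.Build k M N tens *:%R *:%R tpure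
    (tpure_linearl, tpure_linearr).

Lemma tens_sum (x : tens) : x = \sum_(p <- repr x) tpure p.1 p.2.
Proof.
rewrite -[LHS]tens_piK; elim: (repr x) => [|[m n] s IH]; first by rewrite big_nil.
by rewrite big_cons -IH [RHS]/GRing.add /= tens_addE.
Qed.

End TensorRel.

Notation "M ⊗ N" := (tens M N) (at level 40, left associativity) : type_scope.
Notation "m ⊗t n" := (tpure m n) (at level 40, left associativity) : ring_scope.

Section TensorLift.
Variables (k : comNzRingType) (M N P : lmodType k).

(* Defined for every [f], but only meaningful for bilinear [f], when it is   *)
(* the linear map with [m ⊗t n |-> f m n].                                   *)
Definition tlift (f : M -> N -> P) (x : M ⊗ N) : P :=
  \sum_(p <- repr x) f p.1 p.2.

Lemma tlift_rel (f : {bilinear M -> N -> P}) s t : tens_rel s t ->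
  \sum_(p <- s) f p.1 p.2 = \sum_(p <- t) f p.1 p.2.
Proof.
elim=> {s t} //=.
- by move=> s t u _ -> _ ->.
- by move=> s s' t t' _ ss' _ tt'; rewrite !big_cat /= ss' tt'.
- by move=> s t; rewrite !big_cat /= addrC.
- by move=> n; rewrite big_seq1 big_nil /= linear0l.
- by move=> m m' n; rewrite !big_cons !big_nil !addr0 /= linearDl.
- by move=> m n n'; rewrite !big_cons !big_nil !addr0 /= linearDr.
- by move=> a m n; rewrite !big_seq1 /= linearZl_LR linearZr_LR.
Qed.

Lemma tlift_pi (f : {bilinear M -> N -> P}) s :
  tlift f (tens_pi s) = \sum_(p <- s) f p.1 p.2.
Proof. exact/tlift_rel/tens_repr. Qed.

Lemma tlift_pure (f : {bilinear M -> N -> P}) m n : tlift f (m ⊗t n) = f m n.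
Proof. by rewrite /tpure tlift_pi big_seq1. Qed.

Lemma tlift_linear (f : {bilinear M -> N -> P}) : linear (tlift f).
Proof.
move=> a x y; rewrite -[x]tens_piK -[y]tens_piK.
rewrite [X in tlift f X]/GRing.add /= [X in tens_add X _]/GRing.scale /=.
rewrite tens_scaleE tens_addE !tlift_pi big_cat big_map /=; congr (_ + _).
by rewrite scaler_sumr; apply: eq_bigr => -[m n] _ /=; rewrite linearZl_LR.
Qed.

HB.instance Definition _ (f : {bilinear M -> N -> P}) :=
  GRing.isLinear.Build k (M ⊗ N) P *:%R (tlift f) (@tlift_linear f).

Lemma tlift_param (f g h : M -> N -> P) a x :
  (forall m n, h m n = a *: f m n + g m n) ->
  tlift h x = a *: tlift f x + tlift g x.
Proof.
move=> hE; rewrite /tlift scaler_sumr -big_split /=.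
by apply: eq_bigr => p _; exact: hE.
Qed.

End TensorLift.

Section TensorMaps.
Variable k : comNzRingType.

Section Map.
Variables (M N M' N' : lmodType k).
Variables (f : {linear M -> M'}) (g : {linear N -> N'}).

Let tmap_fun m n := f m ⊗t g n.
Let tmap_ll n : linear (tmap_fun ^~ n).
Proof. by move=> a m m'; rewrite /tmap_fun linearP tpure_linearl. Qed.
Let tmap_lr m : linear (tmap_fun m).
Proof. by move=> a n n'; rewrite /tmap_fun linearP tpure_linearr. Qed.
Definition tmap : {linear M ⊗ N -> M' ⊗ N'} := tlift (mk_bilinear (tmap_ll, tmap_lr)).

Lemma tmapE m n : tmap (m ⊗t n) = f m ⊗t g n.
Proof. exact: tlift_pure. Qed.
End Map.

Section Assoc.
Variables (M N P : lmodType k).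

Let ta2 (p : P) (m : M) (n : N) := m ⊗t (n ⊗t p).
Let ta2_ll p n : linear (ta2 p ^~ n).
Proof. by move=> a m m'; rewrite /ta2 tpure_linearl. Qed.
Let ta2_lr p m : linear (ta2 p m).
Proof. by move=> a n n'; rewrite /ta2 tpure_linearl tpure_linearr. Qed.
Let ta1 (x : M ⊗ N) (p : P) := tlift (mk_bilinear (ta2_ll p, ta2_lr p)) x.
Let ta1_ll p : linear (ta1 ^~ p).
Proof. by move=> a x y; rewrite /ta1 linearP. Qed.
Let ta1_lr x : linear (ta1 x).
Proof.
move=> a p q; rewrite /ta1; apply: tlift_param => m n /=.
by rewrite /ta2 !tpure_linearr.
Qed.
Definition tassoc : {linear (M ⊗ N) ⊗ P -> M ⊗ (N ⊗ P)} :=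
  tlift (mk_bilinear (ta1_ll, ta1_lr)).

Lemma tassocE m n p : tassoc ((m ⊗t n) ⊗t p) = m ⊗t (n ⊗t p).
Proof.
transitivity (ta1 (m ⊗t n) p); first exact: tlift_pure.
exact: tlift_pure.
Qed.
End Assoc.

Section Middle.
Variables (A B C D : lmodType k).

Let tm2 (a : A) (b : B) (c : C) (d : D) := (a ⊗t c) ⊗t (b ⊗t d).
Let tm2_ll a b d : linear (tm2 a b ^~ d).
Proof. by move=> l x y; rewrite /tm2 tpure_linearr tpure_linearl. Qed.
Let tm2_lr a b c : linear (tm2 a b c).
Proof. by move=> l x y; rewrite /tm2 !tpure_linearr. Qed.
Let tm1 (y : C ⊗ D) (a : A) (b : B) := tlift (mk_bilinear (tm2_ll a b, tm2_lr a b)) y.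
Let tm1_ll y b : linear (tm1 y ^~ b).
Proof.
move=> l a a'; rewrite /tm1; apply: tlift_param => c d /=.
by rewrite /tm2 !tpure_linearl.
Qed.
Let tm1_lr y a : linear (tm1 y a).
Proof.
move=> l b b'; rewrite /tm1; apply: tlift_param => c d /=.
by rewrite /tm2 tpure_linearl tpure_linearr.
Qed.
Let tm0 (x : A ⊗ B) (y : C ⊗ D) := tlift (mk_bilinear (tm1_ll y, tm1_lr y)) x.
Let tm0_ll y : linear (tm0 ^~ y).
Proof. by move=> l x x'; rewrite /tm0 linearP. Qed.
Let tm0_lr x : linear (tm0 x).
Proof.
move=> l y y'; rewrite /tm0; apply: tlift_param => a b /=.
by rewrite /tm1 linearP.
Qed.
Definition tmiddle : {linear (A ⊗ B) ⊗ (C ⊗ D) -> (A ⊗ C) ⊗ (B ⊗ D)} :=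
  tlift (mk_bilinear (tm0_ll, tm0_lr)).

Lemma tmiddleE a b c d :
  tmiddle ((a ⊗t b) ⊗t (c ⊗t d)) = (a ⊗t c) ⊗t (b ⊗t d).
Proof.
transitivity (tm0 (a ⊗t b) (c ⊗t d)); first exact: tlift_pure.
transitivity (tm1 (c ⊗t d) a b); first exact: tlift_pure.
exact: tlift_pure.
Qed.
End Middle.

Section Unit.
Variable M : lmodType k.

Let ul (a : k^o) (m : M) := (a : k) *: m.
Let ul_l m : linear (ul ^~ m).
Proof. by move=> a b c; rewrite /ul scalerDl scalerA. Qed.
Let ul_r a : linear (ul a).
Proof. by move=> b m n; rewrite /ul scalerDr !scalerA mulrC. Qed.
Definition tunitl : {linear k^o ⊗ M -> M} := tlift (mk_bilinear (ul_l, ul_r)).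
Definition tunitr : {linear M ⊗ k^o -> M} :=
  tlift (@mk_bilinear k M k^o M (fun m a => ul a m) (ul_r, ul_l)).

Lemma tunitlE (a : k) (m : M) : tunitl ((a : k^o) ⊗t m) = a *: m.
Proof. exact: tlift_pure. Qed.
Lemma tunitrE (a : k) (m : M) : tunitr (m ⊗t (a : k^o)) = a *: m.
Proof. exact: tlift_pure. Qed.
End Unit.

Section Mul.
Variable A : algType k.

Let mulb_l y : linear (fun x : A => x * y).
Proof. by move=> a x x'; rewrite mulrDl scalerAl. Qed.
Let mulb_r x : linear (fun y : A => x * y).
Proof. by move=> a y y'; rewrite mulrDr scalerAr. Qed.
Definition amul : {linear A ⊗ A -> A} := tlift (mk_bilinear (mulb_l, mulb_r)).

Lemma amulE x y : amul (x ⊗t y) = x * y.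
Proof. exact: tlift_pure. Qed.
End Mul.

Section Fix.
Variables (M N : lmodType k).

Definition tleft (m : M) (n : N) : M ⊗ N := m ⊗t n.
Definition tright (n : N) (m : M) : M ⊗ N := m ⊗t n.
HB.instance Definition _ m :=
  GRing.isLinear.Build k N (M ⊗ N) *:%R (tleft m) (@tpure_linearr k M N m).
HB.instance Definition _ n :=
  GRing.isLinear.Build k M (M ⊗ N) *:%R (tright n) (@tpure_linearl k M N n).
End Fix.

End TensorMaps.

Arguments tmap : simpl never.
Arguments tassoc {k M N P} : simpl never.
Arguments tmiddle {k A B C D} : simpl never.
Arguments tunitl {k M} : simpl never.
Arguments tunitr {k M} : simpl never.
Arguments amul {k A} : simpl never.

Section HopfAlgebra.
Variable k : comNzRingType.

(* The product of the algebra [A (x) B]: (a (x) b)(a' (x) b') = aa' (x) bb'. *)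
Definition tens_mul (A B : algType k) :
    {linear (A ⊗ B) ⊗ (A ⊗ B) -> A ⊗ B} :=
  tmap amul amul \o tmiddle.
Arguments tens_mul {A B}.

Record hopfAlgType := HopfAlg {
  hopf_alg :> algType k;
  coprod : {linear hopf_alg -> hopf_alg ⊗ hopf_alg};
  counit : {lrmorphism hopf_alg -> k^o};
  antipode : {linear hopf_alg -> hopf_alg};
  coprodA : forall h,
    tassoc (tmap coprod idfun (coprod h)) = tmap idfun coprod (coprod h);
  counitl : forall h, tunitl (tmap counit idfun (coprod h)) = h;
  counitr : forall h, tunitr (tmap idfun counit (coprod h)) = h;
  coprod1 : coprod 1 = 1 ⊗t 1;
  coprodM : forall g h, coprod (g * h) = tens_mul (coprod g ⊗t coprod h);
  antipodel : forall h, amul (tmap antipode idfun (coprod h)) = (counit h : k)%:A;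
  antipoder : forall h, amul (tmap idfun antipode (coprod h)) = (counit h : k)%:A
}.

Arguments coprod : clear implicits.
Arguments counit : clear implicits.
Arguments antipode : clear implicits.

Variables (H : hopfAlgType) (chi : {lrmorphism H -> k^o}).

Definition twisted_antipode : {linear H -> H} :=
  tunitl \o tmap chi (antipode H) \o coprod H.

Definition modular_pair_in_involution : Prop :=
  forall h, twisted_antipode (twisted_antipode h) = h.

End HopfAlgebra.

Arguments coprod {k} _.
Arguments counit {k} _.
Arguments antipode {k} _.

Section Cobar.
Variables (k : comNzRingType) (H : hopfAlgType k).

(* [tpow n] is the n-th tensor power of [H], parenthesized to the right and  *)
(* ending in [k]: the tensor h_1 (x) ... (x) h_n is                          *)
(* [h_1 ⊗t (h_2 ⊗t ... (h_n ⊗t 1))].                                         *)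
Fixpoint tpow (n : nat) : lmodType k :=
  if n is n'.+1 then (H ⊗ tpow n')%type else k^o.

Definition tpow1 : {linear H -> tpow 1} := @tright k H k^o 1.

Fixpoint tcat_map m n : {linear tpow m ⊗ tpow n -> tpow (m + n)} :=
  match m with
  | 0 => tunitl
  | m'.+1 => tmap idfun (tcat_map m' n) \o tassoc
  end.

Definition tcat m n (x : tpow m) (y : tpow n) : tpow (m + n) :=
  tcat_map m n (x ⊗t y).

Fixpoint tpow_mul n : {linear tpow n ⊗ tpow n -> tpow n} :=
  match n with
  | 0 => tunitl
  | n'.+1 => tmap amul (tpow_mul n') \o tmiddle
  end.

(* [iter_diag n : H -> tpow n.+1] is the n-fold iterated diagonal.           *)
Fixpoint iter_diag n : {linear H -> tpow n.+1} :=
  match n with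
  | 0 => tpow1
  | n'.+1 => tmap idfun (iter_diag n') \o coprod H
  end.

Definition lcons1 n : {linear tpow n -> tpow n.+1} := @tleft k H (tpow n) 1.

Fixpoint rcons1 n : {linear tpow n -> tpow n.+1} :=
  match n with
  | 0 => lcons1 0
  | n'.+1 => tmap idfun (rcons1 n')
  end.

(* [diag_at n j] applies the diagonal to the factor h_(j+1); the value 0 for *)
(* [n <= j] is never used.                                                   *)
Fixpoint diag_at n j : {linear tpow n -> tpow n.+1} :=
  match n, j with
  | 0, _ => \0
  | n'.+1, 0 => tassoc \o tmap (coprod H) idfun
  | n'.+1, j'.+1 => tmap idfun (diag_at n' j')
  end.

Definition coface n i : {linear tpow n -> tpow n.+1} :=
  if i is j.+1 then if j == n then rcons1 n else diag_at n j else lcons1 n.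

(* [codeg n j] applies the counit to the factor h_(j+1); the value 0 for     *)
(* [n < j] is never used.                                                    *)
Fixpoint codeg n j : {linear tpow n.+1 -> tpow n} :=
  match n, j with
  | n, 0 => tunitl \o tmap (counit H) idfun
  | 0, _.+1 => \0
  | n'.+1, j'.+1 => tmap idfun (codeg n' j')
  end.

Definition cobar_diff n (x : tpow n) : tpow n.+1 :=
  \sum_(i < n.+2) (-1) ^+ i *: coface n i x.

Definition normalized n : tpow n -> Prop :=
  match n with
  | 0 => fun=> True
  | n'.+1 => fun x => forall j, (j <= n')%N -> codeg n' j x = 0
  end.

Section Cyclic.
Variable chi : {lrmorphism H -> k^o}.

Definition cyclic_op n : {linear tpow n -> tpow n} :=
  match n with
  | 0 => idfun
  | n'.+1 => tpow_mul n'.+1 \o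
      tmap (iter_diag n' \o twisted_antipode chi) (rcons1 n')
  end.

(* The additional codegeneracy sigma_(n+1) = sigma_n tau_(n+1).              *)
Definition extra_codeg n : {linear tpow n.+1 -> tpow n} :=
  codeg n n \o cyclic_op n.+1.

Definition connesB n (x : tpow n.+1) : tpow n :=
  \sum_(i < n.+1) (-1) ^+ (i * n) *: iter i (cyclic_op n) (extra_codeg n x).

End Cyclic.

Lemma cobar_diff_linear n : linear (@cobar_diff n).
Proof.
move=> a x y; rewrite /cobar_diff scaler_sumr -big_split /=.
by apply: eq_bigr => i _; rewrite linearP scalerDr !scalerA mulrC.
Qed.
HB.instance Definition _ n :=
  GRing.isLinear.Build k (tpow n) (tpow n.+1) *:%R (@cobar_diff n)
    (@cobar_diff_linear n).

Lemma connesB_linear chi n : linear (@connesB chi n).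
Proof.
move=> a x y; rewrite /connesB scaler_sumr -big_split; apply: eq_bigr => i _.
rewrite linearP; move: (extra_codeg chi n x) (extra_codeg chi n y) => u v.
suff -> : iter i (cyclic_op chi n) (a *: u + v) =
    a *: iter i (cyclic_op chi n) u + iter i (cyclic_op chi n) v.
  by rewrite scalerDr !scalerA mulrC.
by elim: (i : nat) => // m IHm; rewrite !iterS IHm linearP.
Qed.
HB.instance Definition _ chi n :=
  GRing.isLinear.Build k (tpow n.+1) (tpow n) *:%R (@connesB chi n)
    (@connesB_linear chi n).

End Cobar.

Section Graded.
Variable k : comNzRingType.

Definition gmod := int -> lmodType k.

(* Transport along an equality of degrees.                                   *)
Definition gcast (G : gmod) (i j : int) (e : i = j) (x : G i) : G j :=
  ecast l (G l) e x.

Lemma gcast_linear (G : gmod) i j (e : i = j) : linear (@gcast G i j e).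
Proof. by case: j / e. Qed.
HB.instance Definition _ (G : gmod) i j (e : i = j) :=
  GRing.isLinear.Build k (G i) (G j) *:%R (@gcast G i j e) (gcast_linear e).

Definition gsign (i : int) : k := (-1) ^+ `|i|%N.

(* In the axioms below the equalities [e], [e1], [e2] always hold; they only *)
(* identify the degrees of the two sides.                                    *)
Record gerstenhaber (G : gmod) := Gerstenhaber {
  gcup : forall i j, {bilinear G i -> G j -> G (i + j)%R};
  gone : G 0;
  gbr : forall i j, {bilinear G i -> G j -> G (i + j - 1)%R};
  gcupA : forall i j l (a : G i) (b : G j) (c : G l) (e : i + (j + l) = i + j + l),
    gcast e (gcup _ _ a (gcup _ _ b c)) = gcup _ _ (gcup _ _ a b) c;
  gcup1l : forall i (a : G i) (e : 0 + i = i), gcast e (gcup _ _ gone a) = a;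
  gcup1r : forall i (a : G i) (e : i + 0 = i), gcast e (gcup _ _ a gone) = a;
  gcupC : forall i j (a : G i) (b : G j) (e : j + i = i + j),
    gcup _ _ a b = gsign (i * j) *: gcast e (gcup _ _ b a);
  gbrC : forall i j (a : G i) (b : G j) (e : j + i - 1 = i + j - 1),
    gbr _ _ a b = - (gsign ((i - 1) * (j - 1)) *: gcast e (gbr _ _ b a));
  gbr_jacobi : forall i j l (a : G i) (b : G j) (c : G l)
      (e1 : (i + j - 1) + l - 1 = i + (j + l - 1) - 1)
      (e2 : j + (i + l - 1) - 1 = i + (j + l - 1) - 1),
    gbr _ _ a (gbr _ _ b c) =
      gcast e1 (gbr _ _ (gbr _ _ a b) c)
      + gsign ((i - 1) * (j - 1)) *: gcast e2 (gbr _ _ b (gbr _ _ a c));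
  gbr_poisson : forall i j l (a : G i) (b : G j) (c : G l)
      (e1 : (i + j - 1) + l = i + (j + l) - 1)
      (e2 : j + (i + l - 1) = i + (j + l) - 1),
    gbr _ _ a (gcup _ _ b c) =
      gcast e1 (gcup _ _ (gbr _ _ a b) c)
      + gsign (j * (i - 1)) *: gcast e2 (gcup _ _ b (gbr _ _ a c))
}.

Record batalin_vilkovisky (G : gmod) := BatalinVilkovisky {
  bv_gerstenhaber :> gerstenhaber G;
  bvB : forall i, {linear G i -> G (i - 1)};
  bvBB : forall i (a : G i), bvB _ (bvB _ a) = 0;
  bv_br : forall i j (a : G i) (b : G j)
      (e1 : (i - 1) + j = i + j - 1) (e2 : i + (j - 1) = i + j - 1),
    gbr bv_gerstenhaber i j a b = gsign i *:
      (bvB _ (gcup bv_gerstenhaber i j a b)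
       - gcast e1 (gcup bv_gerstenhaber _ _ (bvB _ a) b)
       - gsign i *: gcast e2 (gcup bv_gerstenhaber _ _ a (bvB _ b)))
}.

Record lie2 (L : gmod) := Lie2 {
  lbr : forall i j, {bilinear L i -> L j -> L (i + j - 2)%R};
  lbrC : forall i j (a : L i) (b : L j) (e : j + i - 2 = i + j - 2),
    lbr _ _ a b = - (gsign (i * j) *: gcast e (lbr _ _ b a));
  lbr_jacobi : forall i j l (a : L i) (b : L j) (c : L l)
      (e1 : (i + j - 2) + l - 2 = i + (j + l - 2) - 2)
      (e2 : j + (i + l - 2) - 2 = i + (j + l - 2) - 2),
    lbr _ _ a (lbr _ _ b c) =
      gcast e1 (lbr _ _ (lbr _ _ a b) c)
      + gsign (i * j) *: gcast e2 (lbr _ _ b (lbr _ _ a c))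
}.

End Graded.

Record submodule (k : comNzRingType) (M : lmodType k) := Submodule {
  in_submod :> M -> Prop;
  in_submod0 : in_submod 0;
  in_submodP : forall a x y, in_submod x -> in_submod y -> in_submod (a *: x + y)
}.

Section SubmodulePred.
Variables (k : comNzRingType) (M : lmodType k) (S : submodule M).

Definition smem : {pred M} := fun x => `[< S x >].

Lemma smem_closed : submod_closed smem.
Proof.
split=> [|a x y]; first by apply/asboolP; exact: in_submod0.
by move=> /asboolP xS /asboolP yS; apply/asboolP; exact: in_submodP.
Qed.
HB.instance Definition _ :=
  GRing.isZmodClosed.Build M smem (GRing.submod_closedB smem_closed).
HB.instance Definition _ := GRing.isSubmodClosed.Build k M smem smem_closed.

Definition submod := {x : M | x \in smem}.
HB.instance Definition _ := SubChoice.on submod.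
HB.instance Definition _ := [SubChoice_isSubLmodule of submod by <:].

Definition quotmod := Quotient.quot smem.
HB.instance Definition _ := GRing.Zmodule.on quotmod.
HB.instance Definition _ := EqQuotient.on quotmod.

Definition quotmod_scale (a : k) (x : quotmod) : quotmod :=
  \pi_quotmod (a *: repr x).

Lemma quotmod_piD (x y : M) :
  \pi_quotmod x + \pi_quotmod y = \pi_quotmod (x + y) :> quotmod.
Proof. by apply: esym; exact: Quotient.pi_add. Qed.

Lemma quotmod_scaleE a (x : M) :
  quotmod_scale a (\pi_quotmod x) = \pi_quotmod (a *: x).
Proof.
apply/eqP; rewrite -Quotient.idealrBE -scalerBr rpredZ //.
by rewrite Quotient.idealrBE reprK.
Qed.

Lemma quotmod_scaleA a b x :
  quotmod_scale a (quotmod_scale b x) = quotmod_scale (a * b) x.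
Proof.
elim/quotW: x => x.
by rewrite [quotmod_scale b _]quotmod_scaleE !quotmod_scaleE scalerA.
Qed.
Lemma quotmod_scale1 : left_id 1 quotmod_scale.
Proof. by elim/quotW=> x; rewrite quotmod_scaleE scale1r. Qed.
Lemma quotmod_scaleDr : right_distributive quotmod_scale +%R.
Proof.
move=> a; elim/quotW=> x; elim/quotW=> y.
by rewrite quotmod_piD !quotmod_scaleE quotmod_piD scalerDr.
Qed.
Lemma quotmod_scaleDl x : {morph quotmod_scale^~ x : a b / a + b}.
Proof.
by elim/quotW: x => x a b; rewrite !quotmod_scaleE quotmod_piD scalerDl.
Qed.

HB.instance Definition _ := GRing.Zmodule_isLmodule.Build k quotmod
  quotmod_scaleA quotmod_scale1 quotmod_scaleDr quotmod_scaleDl.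

End SubmodulePred.

Section Subquotient.
Variables (k : comNzRingType) (M : lmodType k) (Z B : submodule M).

Let pull (z : submod Z) : Prop := B (val z).
Let pull0 : pull 0.
Proof. exact: in_submod0. Qed.
Let pullP a x y : pull x -> pull y -> pull (a *: x + y).
Proof. exact: in_submodP. Qed.
Definition submod_pull : submodule (submod Z) := Submodule pull0 pullP.

(* [Z / (Z /\ B)]; in the uses below [B] is contained in [Z] because the     *)
(* differential squares to zero, but this is not needed to form the quotient.*)
Definition subquot : lmodType k := quotmod submod_pull.

(* [a] is an element of [Z] and [x] is its class.                            *)
Definition is_class (x : subquot) (a : M) : Prop :=
  exists2 z : submod Z, val z = a & x = \pi_(quotmod submod_pull) z.

End Subquotient.

Section Families.
Variables (k : comNzRingType) (M : nat -> lmodType k).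

Definition family := forall l : nat, M l.
HB.instance Definition _ := Choice.on family.

Implicit Types c : family.

Definition family_add c c' : family := fun l => c l + c' l.
Definition family_opp c : family := fun l => - c l.
Definition family_zero : family := fun l => 0.
Definition family_scale (a : k) c : family := fun l => a *: c l.

Lemma family_addA : associative family_add.
Proof. by move=> x y z; apply: functional_extensionality_dep => l; exact: addrA. Qed.
Lemma family_addC : commutative family_add.
Proof. by move=> x y; apply: functional_extensionality_dep => l; exact: addrC. Qed.
Lemma family_add0 : left_id family_zero family_add.
Proof. by move=> x; apply: functional_extensionality_dep => l; exact: add0r. Qed.
Lemma family_addN : left_inverse family_zero family_opp family_add.
Proof. by move=> x; apply: functional_extensionality_dep => l; exact: addNr. Qed.
HB.instance Definition _ :=
  GRing.isZmodule.Build family family_addA family_addC family_add0 family_addN.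

Lemma family_scaleA a b c :
  family_scale a (family_scale b c) = family_scale (a * b) c.
Proof. by apply: functional_extensionality_dep => l; exact: scalerA. Qed.
Lemma family_scale1 : left_id 1 family_scale.
Proof. by move=> c; apply: functional_extensionality_dep => l; exact: scale1r. Qed.
Lemma family_scaleDr : right_distributive family_scale +%R.
Proof. by move=> a c c'; apply: functional_extensionality_dep => l; exact: scalerDr. Qed.
Lemma family_scaleDl c : {morph family_scale^~ c : a b / a + b}.
Proof. by move=> a b; apply: functional_extensionality_dep => l; exact: scalerDl. Qed.
HB.instance Definition _ := GRing.Zmodule_isLmodule.Build k family
  family_scaleA family_scale1 family_scaleDr family_scaleDl.

Definition finite_support c : Prop :=
  exists N, forall l, (N <= l)%N -> c l = 0.

End Families.

Section Cohomology.
Variables (k : comNzRingType) (H : hopfAlgType k).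

(* The cobar construction in all integral degrees; it is zero in negative    *)
(* degrees.                                                                  *)
Definition cobar : gmod k := fun i =>
  match i with Posz n => tpow H n | Negz _ => 'rV[k]_0 end.

Lemma posz_succ (n : nat) : n.+1%:Z = n%:Z + 1.
Proof. by rewrite -addn1 PoszD. Qed.

Lemma posz_pred (n : nat) : n%:Z = n.+1%:Z - 1.
Proof. by rewrite posz_succ addrK. Qed.

Definition cobar_d (i : int) : cobar i -> cobar (i + 1) :=
  match i with
  | Posz n => fun x => gcast (G := cobar) (posz_succ n) (cobar_diff x)
  | Negz _ => fun=> 0
  end.

Definition cobar_cup (i j : int) : cobar i -> cobar j -> cobar (i + j) :=
  match i, j with
  | Posz m, Posz n => fun x y => tcat x y
  | _, _ => fun _ _ => 0
  end.

Definition cobar_one : cobar 0 := (1 : k^o).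

Definition cobar_normalized (i : int) : cobar i -> Prop :=
  match i with
  | Posz n => @normalized k H n
  | Negz _ => fun=> True
  end.

Lemma cobar_d_linear i : linear (@cobar_d i).
Proof.
case: i => n a x y /=; last by rewrite scaler0 addr0.
by rewrite linearP (linearP (gcast (G := cobar) (posz_succ n))).
Qed.
HB.instance Definition _ i :=
  GRing.isLinear.Build k (cobar i) (cobar (i + 1)) *:%R (@cobar_d i)
    (@cobar_d_linear i).

Lemma normalized_linear n a (x y : tpow H n) :
  normalized x -> normalized y -> normalized (a *: x + y).
Proof.
case: n x y => // n x y xN yN j jn.
by rewrite linearP (xN j jn) (yN j jn) scaler0 addr0.
Qed.

Lemma cobar_normalized0 i : cobar_normalized (0 : cobar i).
Proof. by case: i => [[|n]|n] //= j _; rewrite linear0. Qed.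

Lemma cobar_normalizedP i a (x y : cobar i) :
  cobar_normalized x -> cobar_normalized y -> cobar_normalized (a *: x + y).
Proof. by case: i x y => // n x y; exact: normalized_linear. Qed.

Lemma cocycle0 i : cobar_d (0 : cobar i) = 0.
Proof. exact: linear0. Qed.
Lemma cocycleP i a (x y : cobar i) :
  cobar_d x = 0 -> cobar_d y = 0 -> cobar_d (a *: x + y) = 0.
Proof. by move=> x0 y0; rewrite cobar_d_linear x0 y0 scaler0 addr0. Qed.
Definition cocycles i : submodule (cobar i) :=
  @Submodule k (cobar i) (fun x => cobar_d x = 0) (@cocycle0 i) (@cocycleP i).

Definition is_coboundary i (x : cobar i) : Prop :=
  exists y : cobar (i - 1), x = gcast (subrK 1 i) (cobar_d y).
Lemma coboundary0 i : is_coboundary (0 : cobar i).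
Proof. by exists 0; rewrite !linear0. Qed.
Lemma coboundaryP i a (x y : cobar i) :
  is_coboundary x -> is_coboundary y -> is_coboundary (a *: x + y).
Proof. by move=> [x' ->] [y' ->]; exists (a *: x' + y'); rewrite !linearP. Qed.
Definition coboundaries i : submodule (cobar i) :=
  @Submodule k (cobar i) (@is_coboundary i) (@coboundary0 i) (@coboundaryP i).

Definition cotor : gmod k := fun i => subquot (cocycles i) (coboundaries i).

Definition cotor_class i (x : cotor i) (c : cobar i) : Prop := is_class x c.

Section Cyclic.
Variable chi : {lrmorphism H -> k^o}.

Definition cobarB (i : int) : cobar i -> cobar (i - 1) :=
  match i with
  | Posz n.+1 => fun x => gcast (G := cobar) (posz_pred n) (connesB chi x)
  | _ => fun=> 0
  end.

Lemma cobarB_linear i : linear (@cobarB i).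
Proof.
case: i => [[|n]|n] a x y /=; rewrite ?scaler0 ?addr0 //.
by rewrite linearP (linearP (gcast (G := cobar) (posz_pred n))).
Qed.
HB.instance Definition _ i :=
  GRing.isLinear.Build k (cobar i) (cobar (i - 1)) *:%R (@cobarB i)
    (@cobarB_linear i).

Definition tot_family (n : int) : lmodType k :=
  family (fun l : nat => cobar (n + l.*2%:Z)).

Definition is_tot n (c : tot_family n) : Prop :=
  finite_support c /\ forall l, cobar_normalized (c l).

Lemma tot_d_deg (n : int) (l : nat) : n + l.*2%:Z + 1 = n + 1 + l.*2%:Z.
Proof. by rewrite addrAC. Qed.
Lemma tot_B_deg (n : int) (l : nat) : n + l.+1.*2%:Z - 1 = n + 1 + l.*2%:Z.
Proof. by rewrite doubleS !posz_succ !addrA addrK addrAC. Qed.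

Definition tot_D n (c : tot_family n) : tot_family (n + 1) := fun l =>
  gcast (tot_d_deg n l) (cobar_d (c l)) + gcast (tot_B_deg n l) (cobarB (c l.+1)).

Lemma tot_D_linear n : linear (@tot_D n).
Proof.
move=> a c c'; apply: functional_extensionality_dep => l.
rewrite /tot_D [(a *: c + c') l]/(a *: c l + c' l).
rewrite [(a *: c + c') l.+1]/(a *: c l.+1 + c' l.+1) !linearP.
by rewrite addrACA -scalerDr.
Qed.
HB.instance Definition _ n :=
  GRing.isLinear.Build k (tot_family n) (tot_family (n + 1)) *:%R (@tot_D n)
    (@tot_D_linear n).

Lemma is_tot0 n : is_tot (0 : tot_family n).
Proof. by split=> [|l]; [exists 0%N | exact: cobar_normalized0]. Qed.
Lemma is_totP n a (c c' : tot_family n) :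
  is_tot c -> is_tot c' -> is_tot (a *: c + c').
Proof.
move=> [[N cN] cn] [[N' cN'] cn']; split=> [|l].
  exists (maxn N N') => l; rewrite geq_max => /andP[Nl N'l].
  rewrite [(a *: c + c') l]/(a *: c l + c' l).
  by rewrite (cN l Nl) (cN' l N'l) scaler0; exact: addr0.
exact: cobar_normalizedP.
Qed.

Definition is_tot_cocycle n (c : tot_family n) : Prop :=
  is_tot c /\ tot_D c = 0.
Lemma tot_cocycle0 n : is_tot_cocycle (0 : tot_family n).
Proof. by split; [exact: is_tot0 | exact: linear0]. Qed.
Lemma tot_cocycleP n a (c c' : tot_family n) :
  is_tot_cocycle c -> is_tot_cocycle c' -> is_tot_cocycle (a *: c + c').
Proof.
move=> [ct c0] [c't c'0]; split; first exact: is_totP.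
by rewrite tot_D_linear c0 c'0 scaler0 addr0.
Qed.
Definition tot_cocycles n : submodule (tot_family n) :=
  @Submodule k (tot_family n) (@is_tot_cocycle n) (@tot_cocycle0 n)
    (@tot_cocycleP n).

Definition is_tot_coboundary n (c : tot_family n) : Prop :=
  exists2 c' : tot_family (n - 1),
    is_tot c' & c = gcast (G := tot_family) (subrK 1 n) (tot_D c').
Lemma tot_coboundary0 n : is_tot_coboundary (0 : tot_family n).
Proof.
exists 0; first exact: is_tot0.
by rewrite linear0 (linear0 (gcast (G := tot_family) (subrK 1 n))).
Qed.
Lemma tot_coboundaryP n a (c c' : tot_family n) :
  is_tot_coboundary c -> is_tot_coboundary c' -> is_tot_coboundary (a *: c + c').
Proof.
move=> [b bt ->] [b' b't ->]; exists (a *: b + b'); first exact: is_totP.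
by rewrite linearP (linearP (gcast (G := tot_family) (subrK 1 n))).
Qed.
Definition tot_coboundaries n : submodule (tot_family n) :=
  @Submodule k (tot_family n) (@is_tot_coboundary n) (@tot_coboundary0 n)
    (@tot_coboundaryP n).

Definition cyclic_coh : gmod k :=
  fun n => subquot (tot_cocycles n) (tot_coboundaries n).

Definition cyclic_class n (x : cyclic_coh n) (c : tot_family n) : Prop :=
  is_class x c.

Lemma tot_deg0 (n : int) : n = n + 0%N.*2%:Z.
Proof. exact: esym (addr0 n). Qed.

Definition tot_head n (c : cobar n) : tot_family n := fun l =>
  match l with 0%N => gcast (tot_deg0 n) c | _.+1 => 0 end.

Definition tot_fst n (c : tot_family n) : cobar n :=
  gcast (esym (tot_deg0 n)) (c 0%N).

Definition induced_by_cup
    (cup : forall i j, {bilinear cotor i -> cotor j -> cotor (i + j)%R}) : Prop :=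
  forall i j (x : cotor i) (y : cotor j) (a : cobar i) (b : cobar j),
    cotor_class x a -> cotor_class y b ->
    cotor_class (cup i j x y) (cobar_cup a b).

(* The map [B] on the cohomology of the normalized complex, transported      *)
(* along the isomorphism induced by the inclusion: the graph of the map is   *)
(* the set of pairs ([c], [B c]) for [c] a normalized cocycle.               *)
Definition induced_by_connesB
    (B : forall i, {linear cotor i -> cotor (i - 1)}) : Prop :=
  forall i (x : cotor i) (y : cotor (i - 1)),
    y = B i x <-> exists c : cobar i,
      [/\ cobar_normalized c, cotor_class x c & cotor_class y (cobarB c)].

Definition induced_by_tot_head
    (I : forall n, {linear cotor n -> cyclic_coh n}) : Prop :=
  forall n (x : cotor n) (y : cyclic_coh n),
    y = I n x <-> exists c : cobar n,
      [/\ cobar_normalized c, cotor_class x c & cyclic_class y (tot_head c)].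

Definition induced_by_boundary
    (bd : forall n, {linear cyclic_coh n -> cotor (n - 1)}) : Prop :=
  forall n (x : cyclic_coh n) (c : tot_family n),
    cyclic_class x c -> cotor_class (bd n x) (cobarB (tot_fst c)).

End Cyclic.
End Cohomology.

(* Main.v *)
From HB Require Import structures.
From mathcomp Require Import all_boot all_order all_algebra.
From mathcomp Require Import boolp zify.
Require Import Defs.

Set Implicit Arguments.
Unset Strict Implicit.
Unset Printing Implicit Defensive.

Import GRing.Theory.
Local Open Scope ring_scope.

(** All cochains live in one algebra [talg H], the product of the tensor powers
    of [H] with concatenation as multiplication.  A tensor is a sum of words in
    the degree-one elements [letter x], so an operator is described by its effect
    on [letter x * c], and identities between operators are proved by induction
    on the degree (lemma [homog_ind]).

    The diagonal action [act] of [H] gives the projection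
    [coinv (letter x * c) = act (St x) c], with [St] the twisted antipode, of
    the (n+1)-st tensor power onto its [chi]-twisted coinvariants, which are
    the n-th tensor power.  Through [coinv] the cyclic operator becomes the
    rotation [letter x * c |-> c * letter x] (lemma [tau_coinv], which rests on
    the hypothesis of involution) and the additional codegeneracy becomes [coinv]
    itself.  Hence [conB], the coboundary of Connes, is [coinv] of a signed sum
    of rotations.  For a product [f g], the rotations of the letters of [f] and
    those of the letters of [g] give [B (f g) = zcyc f g +- zcyc g f] (lemma
    [conB_mul]), with [zcyc f g] the part of the sum that rotates [f] only.

    - The differential of [zcyc f g] is [f g -+ g f] for cocycles (lemma
      [cdiff_zcyc]): the product is graded commutative in cohomology.  For
      [g = 1] the same formula is [d B = - B d].
    - Let [der g] be the derivation with value [act x g] on [letter x].  For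
      cocycles [f], [u], [g], an explicit homotopy [ins] (lemma
      [cdiff_coinv_ins], the heart of the computation) yields
      [zcyc f (u g) ~ zcyc f u * g +- u * der g f], where [~] is equality up
      to boundaries.  With [u = 1] it says [zcyc f g ~ B f * g +- der g f], so
      that the failure of [B] to be a derivation is a sum of insertions,
      [{f, g} ~ +- der g f +- der f g].  This expression has the required
      symmetry.  It is a derivation in [g]: one summand because of the general
      form of the homotopy, the other one because [der f] is a derivation.
      This is the Poisson identity [bnd_poisson].
    - The Jacobi identity is then formal.  When [B] squares to zero, the Jacobi
      expression of the failure of [B] to be a derivation is a combination of
      the Poisson defects (lemma [bv_jacobi_identity]).  On the cobar complex
      [B] only squares to zero on normalized cochains (lemma [conB_conB]), so
      normalized representatives are needed; they come from an algebra
      endomorphism [nproj], homotopic to the identity.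

    For the cyclic cohomology the maps [I] and [bd] satisfy [bd I = B],
    [B bd = 0] and [I B = 0].  Antisymmetry of [+- I (bd a * bd b)] is the
    graded commutativity of the product.  For the Jacobi identity, put
    [x = bd a], [y = bd b], [z = bd c]; as [B] vanishes on the three of them, the
    Poisson identity expresses [x * B (y z)] by [B (x y) * z], [y * B (x z)]
    and [B (x y z)], and [I] kills the last term.

    The signs are written [(-1) ^+ b] with a boolean [b], the parity of the
    exponent, so that every sign identity is settled by a case analysis on
    parities followed by linear algebra over the integers. *)

(** * Linear identities in abelian groups *)

Inductive abel_exp :=
  | AVar of nat | AZero | AAdd of abel_exp & abel_exp | AOpp of abel_exp.

Fixpoint abel_eval (V : zmodType) (env : seq V) e : V :=
  match e with
  | AVar i => nth 0 env i
  | AZero => 0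
  | AAdd a b => abel_eval env a + abel_eval env b
  | AOpp a => - abel_eval env a
  end.

Fixpoint abel_coef (i : nat) e : int :=
  match e with
  | AVar j => (i == j)%:R
  | AZero => 0
  | AAdd a b => abel_coef i a + abel_coef i b
  | AOpp a => - abel_coef i a
  end.

Lemma abel_evalE (V : zmodType) (env : seq V) e :
  abel_eval env e = \sum_(i < size env) nth 0 env i *~ abel_coef i e.
Proof.
elim: e => [j||a IHa b IHb|a IHa] /=.
- have [lt_j|le_j] := ltnP j (size env); last first.
    rewrite nth_default // big1 // => i _.
    by rewrite (negbTE _ : (i == j :> nat) = false) // neq_ltn (leq_trans _ le_j).
  rewrite (bigD1 (Ordinal lt_j)) //= eqxx big1 ?addr0 // => i ne_ij.
  by rewrite -val_eqE /= in ne_ij; rewrite (negbTE ne_ij).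
- by rewrite big1.
- by rewrite IHa IHb -big_split; apply: eq_bigr => i _; rewrite mulrzDr.
- by rewrite IHa -sumrN; apply: eq_bigr => i _; rewrite mulrNz.
Qed.

Lemma abel_correct (V : zmodType) (env : seq V) e1 e2 :
  all (fun i => abel_coef i e1 == abel_coef i e2) (iota 0 (size env)) ->
  abel_eval env e1 = abel_eval env e2.
Proof.
move=> /allP eq_e; rewrite !abel_evalE; apply: eq_bigr => i _.
by rewrite (eqP (eq_e i _)) // mem_iota /=.
Qed.

(** Atoms are compared by unification, not syntactically: the same element of
    the tensor algebra occurs under several convertible structures. *)
Ltac abel_find x env :=
  lazymatch env with
  | nil => constr:(0%N)
  | ?y :: ?s =>
    match goal with
    | _ => let _ := match goal with _ => unify x y end in constr:(0%N)
    | _ => let n := abel_find x s in constr:(n.+1)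
    end
  end.

Ltac abel_mem x env :=
  lazymatch env with
  | nil => constr:(false)
  | ?y :: ?s =>
    match goal with
    | _ => let _ := match goal with _ => unify x y end in constr:(true)
    | _ => abel_mem x s
    end
  end.

Ltac abel_env t env :=
  lazymatch t with
  | ?a + ?b => let env' := abel_env a env in abel_env b env'
  | - ?a => abel_env a env
  | 0 => env
  | _ => lazymatch abel_mem t env with true => env | false => constr:(t :: env) end
  end.

Ltac abel_quote t env :=
  lazymatch t with
  | ?a + ?b => let x := abel_quote a env in let y := abel_quote b env in
               constr:(AAdd x y)
  | - ?a => let x := abel_quote a env in constr:(AOpp x)
  | 0 => constr:(AZero)
  | _ => let n := abel_find t env in constr:(AVar n)
  end.

(** Decides an equation between sums of atoms and their opposites by comparing
    the integral coefficients of each atom. *)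
Ltac abel :=
  lazymatch goal with
  | |- @eq ?V ?l ?r =>
    let env := abel_env l (@nil V) in
    let env := abel_env r env in
    let a := abel_quote l env in
    let b := abel_quote r env in
    refine (@abel_correct _ env a b _); vm_compute; reflexivity
  end.

(** * The algebra of cochains of all degrees *)

Definition mk_linear (k : nzRingType) (M N : lmodType k) (f : M -> N)
    (fL : linear f) : {linear M -> N} :=
  HB.pack f (GRing.isLinear.Build k M N *:%R f fL).

Section TensorInduction.
Variables (k : comNzRingType) (M N : lmodType k).

Lemma tens_ind (P : M ⊗ N -> Prop) :
  P 0 -> (forall x y, P x -> P y -> P (x + y)) ->
  (forall m n, P (m ⊗t n)) -> forall x, P x.
Proof. by move=> P0 PD Pp x; rewrite [x]tens_sum; apply: big_ind. Qed.

End TensorInduction.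

Section TensorAlgebra.
Variables (k : comNzRingType) (H : hopfAlgType k).

(** The product, not the direct sum, of the tensor powers: it needs no finiteness
    condition, and concatenation still makes sense as each component of a
    product is a finite sum. *)
Definition talg := family (tpow H).
HB.instance Definition _ := GRing.Lmodule.on talg.

Local Notation T := [the lmodType k of talg].
Implicit Types c : T.

Definition tcomp n : {linear T -> tpow H n} :=
  @mk_linear k T (tpow H n) (fun c => c n) (fun a c c' => erefl).

Lemma talgP c c' : (forall n, tcomp n c = tcomp n c') -> c = c'.
Proof. by move=> cc'; apply: functional_extensionality_dep. Qed.

Definition tin_fun n (f : tpow H n) : T := fun m =>
  match n =P m with ReflectT e => ecast i (tpow H i) e f | ReflectF _ => 0 end.

Lemma tin_fun_linear n : linear (@tin_fun n).
Proof.
move=> a x y; apply: talgP => m; rewrite linearP /tin_fun /tcomp /=.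
by case: eqP => [e|_]; [case: m / e | rewrite scaler0 addr0].
Qed.

Definition tin n : {linear tpow H n -> T} := mk_linear (@tin_fun_linear n).

Lemma tcomp_in n (f : tpow H n) : tcomp n (tin n f) = f.
Proof.
by rewrite /tcomp /tin /= /tin_fun; case: eqP => [e|/(_ erefl)] //; rewrite eq_axiomK.
Qed.

Lemma tcomp_in_ne n m (f : tpow H n) : n != m -> tcomp m (tin n f) = 0.
Proof. by rewrite /tcomp /tin /= /tin_fun; case: eqP. Qed.

Lemma tin_inj n : injective (tin n).
Proof. exact: can_inj (@tcomp_in n). Qed.

Definition tcons_fun (y : H ⊗ T) : T := fun n =>
  if n is n'.+1 then tmap idfun (tcomp n') y else 0.
Lemma tcons_fun_linear : linear tcons_fun.
Proof.
move=> a x y; apply: talgP => -[|n]; last exact: linearP.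
by rewrite linearP [RHS](_ : _ = a *: (0 : tpow H 0) + 0) // scaler0 addr0.
Qed.
Definition tcons : {linear H ⊗ T -> T} := mk_linear tcons_fun_linear.

(** Concatenation of a tensor with an element of all degrees at once, which
    avoids the transports between [tpow (m + n)] and the degree of a product. *)
Fixpoint tact n : {linear tpow H n ⊗ T -> T} :=
  match n with
  | 0 => tunitl
  | n'.+1 => tcons \o tmap idfun (tact n') \o tassoc
  end.

Definition talg_mul c c' : T := fun n =>
  \sum_(i < n.+1) tcomp n (tact i (tcomp i c ⊗t c')).

Lemma talg_mulE n c c' :
  tcomp n (talg_mul c c') = \sum_(i < n.+1) tcomp n (tact i (tcomp i c ⊗t c')).
Proof. by []. Qed.

Definition talg_one : T := tin 0 (1 : k^o).

Lemma tcons0 (y : H ⊗ T) : tcomp 0 (tcons y) = 0.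
Proof. by []. Qed.

Lemma tconsS n x c : tcomp n.+1 (tcons (x ⊗t c)) = x ⊗t tcomp n c.
Proof. exact: tmapE. Qed.

Lemma tactS n (x : H) (f : tpow H n) c :
  tact n.+1 ((x ⊗t f) ⊗t c) = tcons (x ⊗t tact n (f ⊗t c)).
Proof.
rewrite [LHS](_ : _ = tcons (tmap idfun (tact n) (tassoc (x ⊗t f ⊗t c)))) //.
by rewrite tassocE tmapE.
Qed.

Lemma tact0 (a : k) c : tact 0 ((a : k^o) ⊗t c) = a *: c.
Proof. exact: tunitlE. Qed.

Opaque tcomp tin tcons tact.

(** What makes the sums over the degree of the left factor in [talg_mulA]
    independent of the degree of the result. *)
Lemma tact_low n m (y : tpow H n ⊗ T) : (m < n)%N -> tcomp m (tact n y) = 0.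
Proof.
elim: n m y => // n IHn m y mn.
elim/tens_ind: y => [|x y Hx Hy|f c]; first by rewrite !linear0.
  by rewrite !linearD Hx Hy addr0.
elim/tens_ind: f => [|f g Hf Hg|x f]; first by rewrite linear0l !linear0.
  by rewrite linearDl !linearD Hf Hg addr0.
case: m mn => [|m] mn; rewrite tactS // tconsS IHn ?linear0r //.
Qed.

Lemma tact1 n (f : tpow H n) : tact n (f ⊗t talg_one) = tin _ f.
Proof.
elim: n f => [a|n IHn f].
  by rewrite tact0 /talg_one -linearZ /= [a *: _]mulr1.
elim/tens_ind: f => [|f g Hf Hg|x f]; first by rewrite linear0l !linear0.
  by rewrite linearDl !linearD Hf Hg.
rewrite tactS IHn; apply: talgP => -[|m]; first by rewrite tcomp_in_ne.
rewrite tconsS; have [<-|nm] := eqVneq n m; first by rewrite !tcomp_in.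
by rewrite !tcomp_in_ne ?eqSS // linear0r.
Qed.

Lemma talg_mul_in n (f : tpow H n) c : talg_mul (tin _ f) c = tact n (f ⊗t c).
Proof.
apply: talgP => m; rewrite talg_mulE.
have [nm|mn] := leqP n m; last first.
  rewrite big1 => [|i _]; first by rewrite tact_low.
  rewrite tcomp_in_ne ?linear0l ?linear0 //.
  by rewrite gtn_eqF // (leq_trans (ltn_ord i)).
rewrite (bigD1 (Ordinal (nm : n < m.+1)%N)) //= big1 ?addr0 => [|i ni].
  by rewrite tcomp_in.
rewrite tcomp_in_ne ?linear0l ?linear0 //.
by rewrite eq_sym; apply: contra ni => /eqP e; apply/eqP/val_inj.
Qed.

Lemma talg_mulDl : left_distributive talg_mul +%R.
Proof.
move=> x y z; apply: talgP => n; rewrite linearD !talg_mulE.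
by rewrite -big_split; apply: eq_bigr => i _; rewrite (linearD (tcomp i)) linearDl !linearD.
Qed.

Lemma talg_mulDr : right_distributive talg_mul +%R.
Proof.
move=> x y z; apply: talgP => n; rewrite linearD !talg_mulE.
by rewrite -big_split; apply: eq_bigr => i _; rewrite linearDr !linearD.
Qed.

Lemma talg_scaleAl a x y : a *: talg_mul x y = talg_mul (a *: x) y.
Proof.
apply: talgP => n; rewrite linearZ /= !talg_mulE scaler_sumr.
by apply: eq_bigr => i _; rewrite (linearZ_LR (tcomp i)) linearZl_LR !linearZ_LR.
Qed.

Lemma talg_scaleAr a x y : a *: talg_mul x y = talg_mul x (a *: y).
Proof.
apply: talgP => n; rewrite linearZ /= !talg_mulE scaler_sumr.
by apply: eq_bigr => i _; rewrite linearZr_LR !linearZ_LR.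
Qed.

Lemma talg_mul1 : left_id talg_one talg_mul.
Proof. by move=> c; rewrite talg_mul_in tact0 scale1r. Qed.

Lemma talg_mulr1 : right_id talg_one talg_mul.
Proof.
move=> c; apply: talgP => n; rewrite talg_mulE.
rewrite (bigD1 ord_max) //= big1 ?addr0 => [|i ni].
  by rewrite tact1 tcomp_in.
by rewrite tact1 tcomp_in_ne //; apply: contra ni => /eqP e; apply/eqP/val_inj.
Qed.

Lemma tcons_mul x c c' :
  talg_mul (tcons (x ⊗t c)) c' = tcons (x ⊗t talg_mul c c').
Proof.
apply: talgP => -[|n].
  by rewrite tcons0 talg_mulE big_ord1 tcons0 linear0l !linear0.
rewrite tconsS talg_mulE big_ord_recl tcons0 linear0l !linear0 add0r.
rewrite linear_sumr; apply: eq_bigr => i _.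
by rewrite tconsS tactS tconsS.
Qed.

Lemma tact_mul n (f : tpow H n) c c' :
  talg_mul (tact n (f ⊗t c)) c' = tact n (f ⊗t talg_mul c c').
Proof.
elim: n f => [a|n IHn f]; first by rewrite !tact0 talg_scaleAl.
elim/tens_ind: f => [|f g Hf Hg|x f].
- rewrite !linear0l !linear0; apply: talgP => n0; rewrite talg_mulE big1 ?linear0 // => i _.
  by rewrite linear0 linear0l !linear0.
- by rewrite !linearDl !linearD talg_mulDl Hf Hg.
- by rewrite !tactS tcons_mul IHn.
Qed.

Lemma talg_mulA : associative talg_mul.
Proof.
move=> x y z; apply: talgP => n; rewrite !talg_mulE.
under eq_bigr => i _ do rewrite -tact_mul talg_mulE.
rewrite exchange_big; apply: eq_bigr => j _; rewrite talg_mulE.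
rewrite linear_sumlz !linear_sum /= [RHS](big_ord_widen n.+1
  (fun i => tcomp n (tact j (tcomp j (tact i (tcomp i x ⊗t y)) ⊗t z)))) ?ltnS ?leq_ord //.
rewrite [RHS]big_mkcond; apply: eq_bigr => i _; case: ltnP => // ij.
by rewrite (tact_low _ ij) linear0l !linear0.
Qed.

Lemma talg_oner_neq0 : talg_one != 0.
Proof.
apply/eqP => /(congr1 (tcomp 0)); rewrite tcomp_in linear0 => /eqP.
by rewrite (oner_eq0 k).
Qed.

HB.instance Definition _ := GRing.Zmodule_isNzRing.Build talg
  talg_mulA talg_mul1 talg_mulr1 talg_mulDl talg_mulDr talg_oner_neq0.
HB.instance Definition _ :=
  GRing.Lmodule_isLalgebra.Build k talg talg_scaleAl.
HB.instance Definition _ :=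
  GRing.Lalgebra_isAlgebra.Build k talg talg_scaleAr.

End TensorAlgebra.
#[global] Opaque tcomp tin tcons tact.

Section Homogeneous.
Variables (k : comNzRingType) (H : hopfAlgType k).
Local Notation T := (talg H).
Implicit Types c : T.

Lemma mul_tin n (f : tpow H n) c : tin H n f * c = tact H n (f ⊗t c).
Proof. exact: talg_mul_in. Qed.

Definition letter : {linear H -> T} := tin H 1 \o tpow1 H.

Lemma letter_mul x c : letter x * c = tcons H (x ⊗t c).
Proof.
rewrite [letter x](_ : _ = tin H 1 (x ⊗t (1 : k^o))) // mul_tin tactS.
by rewrite tact0 scale1r.
Qed.

Lemma tin_tens n x (f : tpow H n) : tin H n.+1 (x ⊗t f) = letter x * tin H n f.
Proof.
rewrite letter_mul; apply: talgP => -[|m]; first by rewrite tcomp_in_ne.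
rewrite tconsS; have [<-|nm] := eqVneq n m; first by rewrite !tcomp_in.
by rewrite !tcomp_in_ne ?eqSS // linear0r.
Qed.

Lemma tin0 (a : k) : tin H 0 (a : k^o) = a%:A.
Proof.
rewrite [RHS](_ : _ = a *: tin H 0 (1 : k^o)) // -linearZ /=.
by rewrite [a *: _]mulr1.
Qed.

(** Degrees enter the signs, and induction over words is available degree by degree
    only, since an element of a product is not a finite sum of words. *)
Definition homog n c := c = tin H n (tcomp H n c).

Lemma homog_in n f : homog n (tin H n f).
Proof. by rewrite /homog tcomp_in. Qed.

Lemma homogE n m c : homog n c -> n != m -> tcomp H m c = 0.
Proof. by move=> -> nm; rewrite tcomp_in_ne. Qed.

Lemma homog0 n : homog n 0. Proof. by rewrite /homog !linear0. Qed.
Lemma homogD n a b : homog n a -> homog n b -> homog n (a + b).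
Proof. by move=> -> ->; rewrite -linearD; apply: homog_in. Qed.
Lemma homogN n a : homog n a -> homog n (- a).
Proof. by move=> ->; rewrite -linearN; apply: homog_in. Qed.
Lemma homogZ n x a : homog n a -> homog n (x *: a).
Proof. by move=> ->; rewrite -linearZ; apply: homog_in. Qed.
Lemma homog1 : homog 0 1. Proof. exact: homog_in. Qed.
Lemma homog_letter x : homog 1 (letter x). Proof. exact: homog_in. Qed.

Lemma homog0P c : homog 0 c -> exists a : k, c = a%:A.
Proof. by move=> ->; exists (tcomp H 0 c : k); rewrite -tin0. Qed.

Lemma homog_ind n (P : T -> Prop) :
    P 0 -> (forall a b, P a -> P b -> P (a + b)) ->
    (forall x c, homog n c -> P (letter x * c)) ->
  forall c, homog n.+1 c -> P c.
Proof.
move=> P0 PD Pl c ->; elim/tens_ind: (tcomp H n.+1 c) => [|a b Pa Pb|x f].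
- by rewrite linear0.
- by rewrite linearD; apply: PD.
- by rewrite tin_tens; apply/Pl/homog_in.
Qed.

Lemma homogSM n x c : homog n c -> homog n.+1 (letter x * c).
Proof. by move=> ->; rewrite -tin_tens; apply: homog_in. Qed.

Lemma homogM m n a b : homog m a -> homog n b -> homog (m + n) (a * b).
Proof.
move=> ha hb; elim: m a ha => [|m IHm] a ha.
  by have [x ->] := homog0P ha; rewrite -scalerAl mul1r; apply: homogZ.
elim/homog_ind: ha => [|a1 a2 h1 h2|x c hc].
- by rewrite mul0r; apply: homog0.
- by rewrite mulrDl; apply: homogD.
- by rewrite -mulrA; apply/homogSM/IHm.
Qed.

(** Extension of linear maps from the tensor powers to the product.  The sum that
    gives a component is cut off, which loses nothing as long as degrees are
    lowered by at most one. *)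
Section Glue.
Variable phi : forall n, {linear tpow H n -> T}.

Definition glue_fun c : T := fun m =>
  \sum_(n < m.+2) tcomp H m (phi n (tcomp H n c)).

Lemma glueE m c :
  tcomp H m (glue_fun c) = \sum_(n < m.+2) tcomp H m (phi n (tcomp H n c)).
Proof. by []. Qed.

Lemma glue_linear : linear glue_fun.
Proof.
move=> a x y; apply: talgP => m; rewrite linearP /= !glueE scaler_sumr -big_split.
by apply: eq_bigr => n _; rewrite (linearP (tcomp H n)) !linearP.
Qed.
Definition glue : {linear T -> T} := mk_linear glue_linear.

Lemma glue_in n l f :
  homog l (phi n f) -> (n <= l.+1)%N -> glue (tin H n f) = phi n f.
Proof.
move=> hf nl; apply: talgP => m; rewrite [LHS]glueE.
have [lm|lm] := eqVneq l m; last first.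
  rewrite (homogE hf lm) big1 // => i _.
  have [e|ni] := eqVneq n i; last by rewrite tcomp_in_ne // !linear0.
  by rewrite -e tcomp_in (homogE hf lm).
rewrite -lm; rewrite -ltnS in nl; rewrite (bigD1 (Ordinal nl)) //= tcomp_in.
rewrite big1 ?addr0 // => i ni; rewrite tcomp_in_ne ?linear0 //.
by rewrite eq_sym; apply: contra ni => /eqP e; apply/eqP/val_inj.
Qed.
End Glue.

End Homogeneous.
Arguments letter {k H}.
#[global] Opaque letter glue.

(** * Sweedler calculus *)

(** As a proposition on bare functions, so that it can be established for the
    summands of Sweedler sums on the fly. *)
Definition bilin (k : comNzRingType) (M N P : lmodType k) (F : M -> N -> P) :=
  (forall a x x' y, F (a *: x + x') y = a *: F x y + F x' y) /\
  (forall a x y y', F x (a *: y + y') = a *: F x y + F x y').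

Section LinearLift.
Variables (k : comNzRingType) (M N P : lmodType k) (F : M -> N -> P).
Hypothesis bF : bilin F.

Let bF' : bilinear_for *:%R *:%R F.
Proof. by split=> [y a x x'|x a y y']; [apply: bF.1 | apply: bF.2]. Qed.

Definition tlin : {linear M ⊗ N -> P} := tlift (mk_bilinear bF').

Lemma tlinE m n : tlin (m ⊗t n) = F m n.
Proof. exact: tlift_pure. Qed.

Lemma tlin_repr x : tlin x = \sum_(p <- repr x) F p.1 p.2.
Proof. by []. Qed.
End LinearLift.

Lemma tens_mulE (k : comNzRingType) (A B : algType k) (a c : A) (b d : B) :
  tens_mul A B ((a ⊗t b) ⊗t (c ⊗t d)) = (a * c) ⊗t (b * d).
Proof.
rewrite [LHS](_ : _ = tmap amul amul (tmiddle ((a ⊗t b) ⊗t (c ⊗t d)))) //.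
by rewrite tmiddleE tmapE !amulE.
Qed.

Opaque tlin tens_mul tmap tmiddle tassoc amul tunitl tunitr.

Section BilinearTheory.
Variables (k : comNzRingType) (M N P : lmodType k) (F : M -> N -> P).
Hypothesis bF : bilin F.

Lemma bilinDl x x' y : F (x + x') y = F x y + F x' y.
Proof. by rewrite -[x]scale1r bF.1 !scale1r. Qed.
Lemma bilinDr x y y' : F x (y + y') = F x y + F x y'.
Proof. by rewrite -[y]scale1r bF.2 !scale1r. Qed.
Lemma bilin0l y : F 0 y = 0.
Proof. by apply: (addrI (F 0 y)); rewrite -bilinDl !addr0. Qed.
Lemma bilin0r x : F x 0 = 0.
Proof. by apply: (addrI (F x 0)); rewrite -bilinDr !addr0. Qed.
Lemma bilinZl a x y : F (a *: x) y = a *: F x y.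
Proof. by rewrite -[a *: x]addr0 bF.1 bilin0l addr0. Qed.
Lemma bilinZr a x y : F x (a *: y) = a *: F x y.
Proof. by rewrite -[a *: y]addr0 bF.2 bilin0r addr0. Qed.
Lemma bilin_suml I (r : seq I) (G : I -> M) y :
  F (\sum_(i <- r) G i) y = \sum_(i <- r) F (G i) y.
Proof.
elim: r => [|i r IHr]; first by rewrite !big_nil bilin0l.
by rewrite !big_cons bilinDl IHr.
Qed.
Lemma bilin_sumr I (r : seq I) (G : I -> N) x :
  F x (\sum_(i <- r) G i) = \sum_(i <- r) F x (G i).
Proof.
elim: r => [|i r IHr]; first by rewrite !big_nil bilin0r.
by rewrite !big_cons bilinDr IHr.
Qed.

End BilinearTheory.

(** Proves linearity and bilinearity of expressions built from linear maps,
    products and sums. *)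
Ltac lin_scale :=
  rewrite ?(linearZ_LR, linearZl_LR, linearZr_LR) /=;
  rewrite -?scalerAl; rewrite -?scalerAr.
Ltac lin_simp :=
  rewrite ?(linearD, linearDl, linearDr, mulrDl, mulrDr) /=;
  do 3 lin_scale;
  repeat match goal with
  | bF : bilin ?F |- _ => progress rewrite ?(bilinDl bF, bilinDr bF, bilinZl bF, bilinZr bF)
  end;
  rewrite ?(scalerDr, scalerDl) ?scalerA.

Ltac lin :=
  repeat split; repeat intro;
  repeat (rewrite scaler_sumr -big_split /=; apply: eq_bigr => ? _);
  lin_simp; try by [].

Section Sweedler.
Variables (k : comNzRingType) (H : hopfAlgType k).

(** One list of pairs whose tensors add up to the diagonal of [x].  Sums over it
    play the role of the Sweedler notation; they do not depend on the choice of
    the list when the summand is bilinear ([swE]), which explains the side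
    conditions of the lemmas of this section. *)
Definition sw (x : H) : seq (H * H) := repr (coprod H x).

Lemma coprod_sw (x : H) : coprod H x = \sum_(p <- sw x) p.1 ⊗t p.2.
Proof. exact: tens_sum. Qed.

Section Bilinear.
Variables (P : lmodType k) (F : H -> H -> P).
Hypothesis bF : bilin F.

Lemma swE x : \sum_(p <- sw x) F p.1 p.2 = tlin bF (coprod H x).
Proof. by rewrite tlin_repr. Qed.

Lemma sw_linear : linear (fun x => \sum_(p <- sw x) F p.1 p.2).
Proof. by move=> a x y; rewrite !swE !linearP. Qed.

Lemma sw1 : \sum_(p <- sw 1) F p.1 p.2 = F 1 1.
Proof. by rewrite swE coprod1 tlinE. Qed.

Lemma swM x y :
  \sum_(p <- sw (x * y)) F p.1 p.2 =
  \sum_(p <- sw x) \sum_(q <- sw y) F (p.1 * q.1) (p.2 * q.2).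
Proof.
rewrite swE coprodM coprod_sw [in X in _ ⊗t X]coprod_sw.
rewrite linear_sumlz (linear_sum (tens_mul H H)) (linear_sum (tlin bF)).
apply: eq_bigr => p _.
rewrite linear_sumr (linear_sum (tens_mul H H)) (linear_sum (tlin bF)).
apply: eq_bigr => q _.
by rewrite tens_mulE tlinE.
Qed.
End Bilinear.

Lemma swA (P : lmodType k) (F : H -> H -> H -> P) x :
    (forall z, bilin (fun x y => F x y z)) -> (forall x, bilin (F x)) ->
  \sum_(p <- sw x) \sum_(q <- sw p.1) F q.1 q.2 p.2 =
  \sum_(p <- sw x) \sum_(q <- sw p.2) F p.1 q.1 q.2.
Proof.
move=> F12 F23.
have b3 : bilin (fun x => tlin (F23 x)).
  split=> [a x1 x2 y|a u y y']; last exact: linearP.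
  by rewrite !tlin_repr; apply: tlift_param => m n; apply: (F12 n).1.
pose L := tlin b3.
have LE u v w : L (u ⊗t (v ⊗t w)) = F u v w by rewrite /L !tlinE.
have /(congr1 L) := coprodA x; rewrite coprod_sw 2!(linear_sum (tmap _ _)) /=.
rewrite (linear_sum tassoc) 2!(linear_sum L) => eLx.
transitivity (\sum_(p <- sw x) L (tassoc (tmap (coprod H) idfun (p.1 ⊗t p.2)))).
  apply: eq_bigr => p _; rewrite tmapE [coprod H p.1]coprod_sw linear_sumlz.
  rewrite (linear_sum tassoc) (linear_sum L).
  by apply: eq_bigr => q _; rewrite tassocE LE.
rewrite eLx; apply: eq_bigr => p _; rewrite tmapE [coprod H p.2]coprod_sw.
by rewrite linear_sumr (linear_sum L); apply: eq_bigr => q _; rewrite LE.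
Qed.

Lemma sw_counitl (P : lmodType k) (L : H -> P) (hL : linear L) x :
  \sum_(p <- sw x) (counit H p.1 : k) *: L p.2 = L x.
Proof.
rewrite -[RHS]/(mk_linear hL x) -[in RHS](counitl x) coprod_sw.
rewrite (linear_sum (tmap _ _)) (linear_sum tunitl) linear_sum.
apply: eq_bigr => p _.
by rewrite tmapE tunitlE linearZ.
Qed.

Lemma sw_counitr (P : lmodType k) (L : H -> P) (hL : linear L) x :
  \sum_(p <- sw x) (counit H p.2 : k) *: L p.1 = L x.
Proof.
rewrite -[RHS]/(mk_linear hL x) -[in RHS](counitr x) coprod_sw.
rewrite (linear_sum (tmap _ _)) (linear_sum tunitr) linear_sum.
apply: eq_bigr => p _.
by rewrite tmapE tunitrE linearZ.
Qed.

Lemma sw_antipodel x : \sum_(p <- sw x) antipode H p.1 * p.2 = (counit H x : k)%:A.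
Proof.
rewrite -antipodel coprod_sw (linear_sum (tmap _ _)) (linear_sum amul).
apply: eq_bigr => p _.
by rewrite tmapE amulE.
Qed.

Lemma sw_antipoder x : \sum_(p <- sw x) p.1 * antipode H p.2 = (counit H x : k)%:A.
Proof.
rewrite -antipoder coprod_sw (linear_sum (tmap _ _)) (linear_sum amul).
apply: eq_bigr => p _.
by rewrite tmapE amulE.
Qed.

Local Notation S := (antipode H).
Local Notation eps := (counit H).

(** Both sides are convolution inverses of the multiplication of [H].  The proof
    evaluates [S (x1 y1) x2 y2 S y3 S x3] in two ways. *)
Lemma antipodeM x y : S (x * y) = S y * S x.
Proof.
pose F x1 x2 x3 := \sum_(q <- sw y) \sum_(q' <- sw q.2)
  S (x1 * q.1) * (x2 * q'.1 * S q'.2 * S x3).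
have F12 z : bilin (fun a b => F a b z) by rewrite /F; lin.
have F23 z : bilin (F z) by rewrite /F; lin.
transitivity (\sum_(p <- sw x) \sum_(p' <- sw p.2) F p.1 p'.1 p'.2).
  have e x1 x2 y1 : \sum_(p' <- sw x2) \sum_(q' <- sw y1)
     S x1 * (p'.1 * q'.1 * S q'.2 * S p'.2) = (eps y1 : k) *: ((eps x2 : k) *: S x1).
    rewrite -[in RHS](mulr1 (S x1)) scalerAr -[_ *: 1 in RHS]sw_antipoder mulr_sumr.
    rewrite scaler_sumr; apply: eq_bigr => p _.
    rewrite scalerAr scalerAl -[p.1 in RHS]mulr1 scalerAr -sw_antipoder.
    by rewrite !mulr_sumr mulr_suml mulr_sumr; apply: eq_bigr => q _; rewrite !mulrA.
  transitivity (\sum_(p <- sw x) \sum_(q <- sw y)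
      (eps q.2 : k) *: ((eps p.2 : k) *: S (p.1 * q.1))).
    rewrite -[LHS](sw_counitr (L := fun z => S (z * y))) //; last by lin.
    apply: eq_bigr => p _.
    rewrite -[S (p.1 * y)](sw_counitr (L := fun z => S (p.1 * z))) //; last by lin.
    by rewrite scaler_sumr; apply: eq_bigr => q _; rewrite !scalerA mulrC.
  apply: eq_bigr => p _; rewrite exchange_big /=; apply: eq_bigr => q _.
  by rewrite e.
rewrite -swA //.
transitivity (\sum_(p <- sw x) \sum_(q <- sw y)
    \sum_(p' <- sw p.1) \sum_(q' <- sw q.1)
      S (p'.1 * q'.1) * ((p'.2 * q'.2) * (S q.2 * S p.2))).
  apply: eq_bigr => p _; rewrite [RHS]exchange_big; apply: eq_bigr => p' _ /=.
  rewrite (swA (F := fun q1 q2 q3 => S (p'.1 * q1) * ((p'.2 * q2) * (S q3 * S p.2)))).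
  - by apply: eq_bigr => q _; apply: eq_bigr => q' _; rewrite !mulrA.
  - by lin.
  - by lin.
transitivity (\sum_(p <- sw x) \sum_(q <- sw y)
    (eps p.1 : k) *: ((eps q.1 : k) *: (S q.2 * S p.2))).
  apply: eq_bigr => p _; apply: eq_bigr => q _.
  rewrite -(swM (F := fun a b => S a * (b * (S q.2 * S p.2)))); last by lin.
  under eq_bigr => r _ do rewrite mulrA.
  by rewrite -mulr_suml sw_antipodel rmorphM /= -scalerAl mul1r scalerA.
transitivity (\sum_(p <- sw x) (eps p.1 : k) *: (S y * S p.2)).
  apply: eq_bigr => p _; rewrite -scaler_sumr.
  by rewrite (sw_counitl (L := fun z => S z * S p.2)) //; lin.
by rewrite (sw_counitl (L := fun z => S y * S z)) //; lin.
Qed.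

Definition swl (P : lmodType k) (F : H -> H -> P) (bF : bilin F) :
  {linear H -> P} := mk_linear (sw_linear bF).

Lemma swlE (P : lmodType k) (F : H -> H -> P) (bF : bilin F) x :
  swl bF x = \sum_(p <- sw x) F p.1 p.2.
Proof. by []. Qed.

(** The flip of [S (x) S], composed with the diagonal, is a right convolution
    inverse of the diagonal. *)
Lemma sw_mul_antipode (P : lmodType k) (F : H -> H -> P) (bF : bilin F) z :
  \sum_(r <- sw z) \sum_(a <- sw r.1) \sum_(b <- sw r.2)
     F (a.1 * S b.2) (a.2 * S b.1) = (eps z : k) *: F 1 1.
Proof.
have bG a1 a2 : bilin (fun b1 b2 => F (a1 * S b2) (a2 * S b1)) by lin.
rewrite (swA (F := fun a1 a2 r2 => \sum_(b <- sw r2) F (a1 * S b.2) (a2 * S b.1))).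
- transitivity (\sum_(r <- sw z) F (r.1 * S r.2) 1); last first.
    by rewrite -(bilin_suml bF) sw_antipoder (bilinZl bF).
  apply: eq_bigr => r _.
  rewrite -(swA (F := fun b1 b2 b3 => F (r.1 * S b3) (b1 * S b2))); try by lin.
  transitivity (\sum_(p <- sw r.2) (eps p.1 : k) *: F (r.1 * S p.2) 1).
    apply: eq_bigr => p _; rewrite -(bilin_sumr bF) sw_antipoder.
    by rewrite (bilinZr bF).
  by rewrite (sw_counitl (L := fun t => F (r.1 * S t) 1)) //; lin.
- by lin.
- move=> a1; split=> [a a2 a2' r2|a a2 r2 r2']; first by lin.
  by rewrite -!(swlE (bG a1 a2)) linearP.
Qed.

(** The diagonal of the antipode is a left convolution inverse of the diagonal,
    hence agrees with the right inverse of [sw_mul_antipode]. *)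
Lemma sw_antipode (P : lmodType k) (F : H -> H -> P) (bF : bilin F) x :
  \sum_(q <- sw (S x)) F q.1 q.2 = \sum_(p <- sw x) F (S p.2) (S p.1).
Proof.
have bG a1 a2 : bilin (fun b1 b2 => F (a1 * S b2) (a2 * S b1)) by lin.
have bG' b1 b2 : bilin (fun a1 a2 => F (a1 * S b2) (a2 * S b1)) by lin.
have bG'' : bilin (fun a1 a2 => F (S a2) (S a1)) by lin.
have bq q1 q2 : bilin (fun u v => F (q1 * u) (q2 * v)) by lin.
have bq' u v : bilin (fun q1 q2 => F (q1 * u) (q2 * v)) by lin.
transitivity (\sum_(p <- sw x) \sum_(r <- sw p.2) \sum_(a <- sw r.1)
  \sum_(b <- sw r.2) \sum_(q <- sw (S p.1))
    F (q.1 * (a.1 * S b.2)) (q.2 * (a.2 * S b.1))).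
  rewrite -(sw_counitr (L := fun x => \sum_(q <- sw (S x)) F q.1 q.2)); last first.
    by move=> a u v; rewrite -!(swlE bF) !linearP.
  apply: eq_bigr => p _; rewrite scaler_sumr.
  transitivity (\sum_(q <- sw (S p.1)) \sum_(r <- sw p.2) \sum_(a <- sw r.1)
     \sum_(b <- sw r.2) F (q.1 * (a.1 * S b.2)) (q.2 * (a.2 * S b.1))).
    by apply: eq_bigr => q _; rewrite (sw_mul_antipode (bq q.1 q.2)) !mulr1.
  rewrite exchange_big; apply: eq_bigr => r _ /=.
  rewrite exchange_big; apply: eq_bigr => a _ /=.
  by rewrite exchange_big.
have b1 r2 p1 : bilin (fun a1 a2 => \sum_(b <- sw r2) \sum_(q <- sw (S p1))
  F (q.1 * (a1 * S b.2)) (q.2 * (a2 * S b.1))) by lin.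
have b2 a1 a2 p1 : bilin (fun b1 b2 => \sum_(q <- sw (S p1))
  F (q.1 * (a1 * S b2)) (q.2 * (a2 * S b1))) by lin.
have b12 p1 : bilin (fun r1 r2 => \sum_(a <- sw r1) \sum_(b <- sw r2)
    \sum_(q <- sw (S p1)) F (q.1 * (a.1 * S b.2)) (q.2 * (a.2 * S b.1))).
  split=> [a u u' v|a u v v']; first by rewrite -!(swlE (b1 v p1)) linearP.
  rewrite scaler_sumr -big_split; apply: eq_bigr => p _ /=.
  by rewrite -!(swlE (b2 p.1 p.2 p1)) linearP.
have b01 r2 : bilin (fun p1 r1 => \sum_(a <- sw r1) \sum_(b <- sw r2)
    \sum_(q <- sw (S p1)) F (q.1 * (a.1 * S b.2)) (q.2 * (a.2 * S b.1))).
  split=> [a u u' v|a u v v']; last by apply: (b12 u).1.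
  do 2 (rewrite scaler_sumr -big_split; apply: eq_bigr => ? _ /=).
  by rewrite -!(swlE (bq' _ _)) !linearP.
rewrite -(swA x b01 b12).
rewrite -(sw_counitl (L := fun z => \sum_(p <- sw z) F (S p.2) (S p.1))); last first.
  by move=> a u v; rewrite -!(swlE bG'') linearP.
apply: eq_bigr => p _.
transitivity (\sum_(b <- sw p.2) \sum_(r <- sw p.1)
  \sum_(c <- sw (S r.1 * r.2)) F (c.1 * S b.2) (c.2 * S b.1)).
  rewrite [RHS]exchange_big; apply: eq_bigr => r _ /=.
  rewrite exchange_big; apply: eq_bigr => b _ /=.
  rewrite (swM (bG' b.1 b.2)) exchange_big /=; apply: eq_bigr => q _.
  by apply: eq_bigr => a _; rewrite !mulrA.
rewrite scaler_sumr; apply: eq_bigr => b _.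
under eq_bigr => r _ do rewrite -(swlE (bG' b.1 b.2)).
rewrite -linear_sum sw_antipodel linearZ /= (sw1 (bG' _ _)).
by rewrite !mul1r.
Qed.
End Sweedler.
#[global] Opaque tlin tens_mul tmap tmiddle tassoc amul tunitl tunitr swl.

(** * The twisted antipode *)

Section TwistedAntipode.
Variables (k : comNzRingType) (H : hopfAlgType k) (chi : {lrmorphism H -> k^o}).
Local Notation S := (antipode H).
Local Notation eps := (counit H).
Local Notation St := (twisted_antipode chi).

Lemma bilin_char (P : lmodType k) (L : H -> P) (u : {lrmorphism H -> k^o}) :
  linear L -> bilin (fun x y => (u x : k) *: L y).
Proof.
move=> hL; split=> [a x x' y|a x y y'].
  by rewrite linearP scalerDl [a *: u x]/(a * u x) -scalerA.
by rewrite hL scalerDr !scalerA mulrC.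
Qed.

Lemma twistedE x : St x = \sum_(p <- sw x) (chi p.1 : k) *: S p.2.
Proof.
rewrite [St x](_ : _ = tunitl (tmap chi S (coprod H x))) // coprod_sw.
rewrite (linear_sum (tmap _ _)) (linear_sum tunitl).
by apply: eq_bigr => p _; rewrite tmapE tunitlE.
Qed.

Opaque twisted_antipode.

Lemma antipode1 : S 1 = 1.
Proof.
have := sw_antipodel (1 : H); rewrite (sw1 (F := fun x y => S x * y)); last by lin.
by rewrite mulr1 rmorph1 scale1r.
Qed.

Lemma twisted1 : St 1 = 1.
Proof.
rewrite twistedE (sw1 (bilin_char chi (linearP S))).
by rewrite rmorph1 scale1r antipode1.
Qed.

Lemma twistedM x y : St (x * y) = St y * St x.
Proof.
rewrite !twistedE (swM (bilin_char chi (linearP S))) mulr_suml exchange_big /=.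
apply: eq_bigr => q _; rewrite mulr_sumr; apply: eq_bigr => p _.
by rewrite rmorphM antipodeM -scalerAl -scalerAr scalerA mulrC.
Qed.

Lemma char_scale a : chi (a%:A) = a.
Proof. by rewrite linearZ rmorph1 [LHS]mulr1. Qed.

(** [chi (x1) chi (S x2)] is [chi (x1 S x2)]. *)
Lemma char_twisted x : chi (St x) = counit H x :> k.
Proof.
rewrite twistedE linear_sum -[RHS](char_scale (counit H x)) -sw_antipoder linear_sum.
by apply: eq_bigr => p _; rewrite linearZ rmorphM.
Qed.

Lemma sw_twisted (P : lmodType k) (F : H -> H -> P) (bF : bilin F) x :
  \sum_(q <- sw (St x)) F q.1 q.2 = \sum_(p <- sw x) F (S p.2) (St p.1).
Proof.
rewrite twistedE -(swlE bF) linear_sum.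
under eq_bigr => p _ do rewrite linearZ_LR swlE (sw_antipode bF) scaler_sumr.
rewrite -(swA (F := fun x1 x2 x3 => (chi x1 : k) *: F (S x3) (S x2))).
- apply: eq_bigr => p _; rewrite twistedE (bilin_sumr bF).
  by apply: eq_bigr => q _; rewrite (bilinZr bF).
- move=> z; apply: (bilin_char chi (L := fun y => F (S z) (S y))).
  by move=> a u v; rewrite linearP bF.2.
- by move=> z; split=> *; rewrite linearP ?bF.1 ?bF.2 scalerDr !scalerA mulrC.
Qed.

Lemma sw_twistedl x : \sum_(p <- sw x) St p.1 * p.2 = (chi x : k)%:A.
Proof.
transitivity (\sum_(p <- sw x) \sum_(q <- sw p.1) (chi q.1 : k) *: (S q.2 * p.2)).
  apply: eq_bigr => p _; rewrite twistedE mulr_suml.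
  by apply: eq_bigr => q _; rewrite scalerAl.
rewrite (swA (F := fun x1 x2 x3 => (chi x1 : k) *: (S x2 * x3))).
- under eq_bigr => p _ do rewrite -scaler_sumr sw_antipodel scalerA.
  rewrite -scaler_suml; congr (_ *: _).
  rewrite -[RHS](sw_counitr (L := fun x => chi x)); last exact: linearP.
  by apply: eq_bigr => p _; rewrite mulrC.
- move=> z; apply: (bilin_char chi (L := fun y => S y * z)).
  by move=> a u v; rewrite linearP mulrDl scalerAl.
- move=> z; split=> *; rewrite ?linearP ?mulrDr ?mulrDl -?scalerAl -?scalerAr.
    by rewrite scalerDr !scalerA mulrC.
  by rewrite scalerDr !scalerA mulrC.
Qed.

Hypothesis chi_invol : modular_pair_in_involution chi.

(** The image of [sw_twistedl] under the twisted antipode, which reverses products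
    and, by the hypothesis on [chi], is an involution. *)
Lemma sw_twistedr x : \sum_(p <- sw x) St p.2 * p.1 = (chi x : k)%:A.
Proof.
transitivity (St (\sum_(p <- sw x) St p.1 * p.2)).
  rewrite linear_sum; apply: eq_bigr => p _ /=.
  by rewrite twistedM chi_invol.
by rewrite sw_twistedl linearZ /= twisted1.
Qed.

Lemma sw_twisted_antipode x : \sum_(p <- sw x) St (S p.2) * St p.1 = (eps x : k)%:A.
Proof.
transitivity (St (\sum_(p <- sw x) p.1 * S p.2)).
  by rewrite linear_sum; apply: eq_bigr => p _; rewrite /= twistedM.
by rewrite sw_antipoder linearZ /= twisted1.
Qed.

End TwistedAntipode.
#[global] Opaque twisted_antipode.

(** * Operators on cochains and the diagonal action *)

Section Operators.
Variables (k : comNzRingType) (H : hopfAlgType k).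
Local Notation T := (talg H).
Local Notation eps := (counit H).
Implicit Types (c : T) (x : H).

Section Uncons.
Variables (F : H -> T -> T) (bF : bilin F).

Let bFn n : bilin (fun x (f : tpow H n) => F x (tin H n f)).
Proof. by split=> *; rewrite ?linearP ?bF.1 ?bF.2. Qed.

Let un n : {linear tpow H n -> T} :=
  match n with 0 => \0 | n'.+1 => tlin (bFn n') end.

(** The projection to coinvariants, the rotation and several homotopies are operators
    prescribed on the first letter in this way. *)
Definition uncons : {linear T -> T} := glue un.

Lemma unconsE s n x c :
    (forall n x c, homog n c -> homog (n + s) (F x c)) ->
  homog n c -> uncons (letter x * c) = F x c.
Proof.
move=> hF hc; rewrite {1}hc -tin_tens /uncons (glue_in (l := n + s)) //=.
- by rewrite tlinE -hc.
- by rewrite tlinE -hc; apply: hF.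
- by rewrite leq_addr.
Qed.

Lemma uncons0 c : homog 0 c -> uncons c = 0.
Proof. by move=> ->; rewrite /uncons (glue_in (l := 0)) //=; apply: homog0. Qed.

End Uncons.

Section Degreewise.
Variables (t : nat -> nat) (phi : forall n, {linear tpow H n -> tpow H (t n)}).
Hypothesis t_ge : forall n, (n <= (t n).+1)%N.

Definition degreewise : {linear T -> T} := glue (fun n => tin H (t n) \o phi n).

Lemma degreewiseE n f : degreewise (tin H n f) = tin H (t n) (phi n f).
Proof. by apply: (glue_in (l := t n)) => //; apply: homog_in. Qed.

Lemma homog_degreewise n c : homog n c -> homog (t n) (degreewise c).
Proof. by move=> ->; rewrite degreewiseE; apply: homog_in. Qed.
End Degreewise.

(** The diagonal action of [H], by the counit on the ground ring. *)
Fixpoint actn n : {linear H ⊗ tpow H n -> tpow H n} :=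
  match n with
  | 0 => tunitl \o tmap eps idfun
  | n'.+1 => tmap amul (actn n') \o tmiddle \o tmap (coprod H) idfun
  end.

Lemma actn0 x : actn 0 (x ⊗t (1 : k^o)) = eps x.
Proof.
rewrite [LHS](_ : _ = tunitl (tmap eps idfun (x ⊗t (1 : k^o)))) //.
by rewrite tmapE tunitlE [LHS]mulr1.
Qed.

Lemma actnS n h x (f : tpow H n) :
  actn n.+1 (h ⊗t (x ⊗t f)) = \sum_(p <- sw h) (p.1 * x) ⊗t actn n (p.2 ⊗t f).
Proof.
rewrite [LHS](_ : _ = tmap amul (actn n) (tmiddle
  (tmap (coprod H) idfun (h ⊗t (x ⊗t f))))) //.
rewrite tmapE coprod_sw linear_sumlz (linear_sum tmiddle) (linear_sum (tmap _ _)).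
by apply: eq_bigr => p _; rewrite tmiddleE tmapE amulE.
Qed.

Definition act_fun x c : T := fun n => actn n (x ⊗t tcomp H n c).

Lemma act_funE n x c : tcomp H n (act_fun x c) = actn n (x ⊗t tcomp H n c).
Proof. by []. Qed.

Lemma act_fun_bilinear : bilinear_for *:%R *:%R act_fun.
Proof.
split=> [c a x y|x a c c']; apply: talgP => n.
  by rewrite linearP !act_funE linearPl linearP.
by rewrite linearP !act_funE (linearP (tcomp H n)) linearPr linearP.
Qed.
Definition act : {bilinear H -> T -> T} := mk_bilinear act_fun_bilinear.

Lemma actE n x c : tcomp H n (act x c) = actn n (x ⊗t tcomp H n c).
Proof. by []. Qed.

Opaque act actn.

Lemma homog_act n x c : homog n c -> homog n (act x c).
Proof.
move=> hc; rewrite /homog; apply: talgP => m; have [<-|nm] := eqVneq n m.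
  by rewrite tcomp_in.
by rewrite tcomp_in_ne // actE (homogE hc nm) linear0r linear0.
Qed.

Lemma act1 x : act x 1 = (eps x : k)%:A.
Proof.
apply: talgP => -[|n]; last first.
  rewrite (homogE (homog_act x (homog1 H))) // linearZ /=.
  by rewrite (homogE (homog1 H)) // scaler0.
rewrite actE linearZ /= [1]/(tin H 0 (1 : k^o)) !tcomp_in.
by rewrite actn0 [RHS]mulr1.
Qed.

Lemma tcomp_letter n x c : tcomp H n.+1 (letter x * c) = x ⊗t tcomp H n c.
Proof. by rewrite letter_mul tconsS. Qed.

Lemma tcomp_letter0 x c : tcomp H 0 (letter x * c) = 0.
Proof. by rewrite letter_mul tcons0. Qed.

Lemma act_letter h x c :
  act h (letter x * c) = \sum_(p <- sw h) letter (p.1 * x) * act p.2 c.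
Proof.
apply: talgP => -[|n]; rewrite actE linear_sum /=.
  rewrite tcomp_letter0 linear0r linear0 big1 // => p _.
  by rewrite tcomp_letter0.
rewrite tcomp_letter actnS; apply: eq_bigr => p _.
by rewrite tcomp_letter actE.
Qed.

Lemma bilin_letter_act x c : bilin (fun p q : H => letter (p * x) * act q c).
Proof. by lin. Qed.

Lemma act_1 n c : homog n c -> act 1 c = c.
Proof.
elim: n c => [|n IHn] c.
  by move=> /homog0P[a ->]; rewrite linearZ /= act1 rmorph1 scale1r.
elim/homog_ind => [|a b ea eb|x f hf]; first by rewrite linear0r.
  by rewrite linearDr ea eb.
by rewrite act_letter (sw1 (bilin_letter_act x f)) mul1r IHn.
Qed.

Lemma actM n x y c : homog n c -> act (x * y) c = act x (act y c).
Proof.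
elim: n c x y => [|n IHn] c x y.
  move=> /homog0P[a ->]; rewrite !linearZr_LR /= !act1 linearZr_LR act1.
  by rewrite rmorphM /= !scalerA -mulrA [eps y * _]mulrC.
elim/homog_ind => [|a b ea eb|z f hf]; first by rewrite !linear0r.
  by rewrite !linearDr ea eb.
rewrite !act_letter (swM (bilin_letter_act z f)) linear_sumr exchange_big /=.
apply: eq_bigr => q _; rewrite act_letter; apply: eq_bigr => p _.
by rewrite mulrA IHn.
Qed.

Lemma act_mul n h c c' : homog n c ->
  act h (c * c') = \sum_(p <- sw h) act p.1 c * act p.2 c'.
Proof.
elim: n c h => [|n IHn] c h.
  move=> /homog0P[a ->]; rewrite -scalerAl mul1r linearZr_LR /=.
  rewrite -(sw_counitl (L := fun h => act h c')); last by move=> ? ? ? /=; rewrite linearPl.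
  rewrite scaler_sumr; apply: eq_bigr => p _.
  by rewrite linearZr_LR act1 /= -!scalerAl mul1r.
elim/homog_ind => [|a b ea eb|z f hf].
- by rewrite mul0r linear0r big1 // => p _; rewrite linear0r mul0r.
- rewrite mulrDl linearDr ea eb -big_split; apply: eq_bigr => p _ /=.
  by rewrite linearDr mulrDl.
rewrite -mulrA act_letter.
transitivity (\sum_(p <- sw h) \sum_(q <- sw p.2)
    letter (p.1 * z) * (act q.1 f * act q.2 c')).
  by apply: eq_bigr => p _; rewrite IHn // mulr_sumr.
rewrite -(swA (F := fun p q r => letter (p * z) * (act q f * act r c'))); try by lin.
apply: eq_bigr => p _; rewrite act_letter mulr_suml.
by apply: eq_bigr => q _; rewrite mulrA.
Qed.

End Operators.
Arguments act {k H}.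

#[global] Opaque act actn uncons degreewise.

(** * The cobar differential *)

Section Differential.
Variables (k : comNzRingType) (H : hopfAlgType k).
Local Notation T := (talg H).
Implicit Types (c : T) (x : H).

(** The part of the differential coming from the inner cofaces, up to sign.  It is
    a derivation ([bar_mul]) and commutes with the action ([bar_act]); the two
    outer cofaces are products with [letter 1] ([cdiffE]). *)
Definition bar_fun n (f : tpow H n) : tpow H n.+1 :=
  \sum_(j < n) (-1) ^+ j *: diag_at H n j f.

Lemma bar_fun_linear n : linear (@bar_fun n).
Proof.
move=> a x y; rewrite /bar_fun scaler_sumr -big_split; apply: eq_bigr => j _ /=.
by rewrite linearP scalerDr !scalerA mulrC.
Qed.

Definition barn n : {linear tpow H n -> tpow H n.+1} := mk_linear (@bar_fun_linear n).

Lemma barnE n f : barn n f = \sum_(j < n) (-1) ^+ j *: diag_at H n j f.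
Proof. by []. Qed.

Opaque barn.

Lemma barnS n x (f : tpow H n) :
  barn n.+1 (x ⊗t f) = \sum_(p <- sw x) p.1 ⊗t (p.2 ⊗t f) - x ⊗t barn n f.
Proof.
rewrite !barnE big_ord_recl expr0 scale1r; congr (_ + _).
  rewrite [LHS](_ : _ = tassoc (tmap (coprod H) idfun (x ⊗t f))) //.
  rewrite tmapE coprod_sw linear_sumlz (linear_sum tassoc).
  by apply: eq_bigr => p _; rewrite tassocE.
rewrite linear_sumr -sumrN; apply: eq_bigr => j _.
rewrite [diag_at H n.+1 _ _](_ : _ = tmap idfun (diag_at H n j) (x ⊗t f)) //.
by rewrite tmapE exprS mulN1r scaleNr linearZr_LR.
Qed.

Definition bar : {linear T -> T} := degreewise barn.
Definition cdiff : {linear T -> T} := degreewise (fun n => @cobar_diff k H n).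

Let leSS n : (n <= n.+2)%N. Proof. by rewrite ltnW. Qed.

Lemma bar_tin n f : bar (tin H n f) = tin H n.+1 (barn n f).
Proof. exact: degreewiseE. Qed.
Lemma cdiff_tin n f : cdiff (tin H n f) = tin H n.+1 (cobar_diff f).
Proof. exact: (degreewiseE (fun n => @cobar_diff k H n)). Qed.
Lemma homog_bar n c : homog n c -> homog n.+1 (bar c).
Proof. exact: homog_degreewise. Qed.
Lemma homog_cdiff n c : homog n c -> homog n.+1 (cdiff c).
Proof. exact: (homog_degreewise (fun n => @cobar_diff k H n)). Qed.

Lemma bar1 : bar 1 = 0.
Proof. by rewrite [1]/(tin H 0 (1 : k^o)) bar_tin barnE big_ord0 linear0. Qed.

Lemma bar_letter n x c : homog n c ->
  bar (letter x * c) = \sum_(p <- sw x) letter p.1 * letter p.2 * c - letter x * bar c.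
Proof.
move=> ->; rewrite -tin_tens !bar_tin barnS linearB linear_sum /=.
congr (_ - _); last by rewrite tin_tens.
by apply: eq_bigr => p _; rewrite !tin_tens mulrA.
Qed.

Lemma bar_mul n c c' m : homog n c -> homog m c' ->
  bar (c * c') = bar c * c' + (-1) ^+ n *: (c * bar c').
Proof.
move=> hc hc'; elim: n c hc => [|n IHn] c.
  move=> /homog0P[a ->]; rewrite -!scalerAl !mul1r expr0 scale1r !(linearZ_LR bar).
  by rewrite bar1 scaler0 mul0r add0r.
elim/homog_ind => [|a b ea eb|x f hf].
- by rewrite !(mul0r, linear0) addr0.
- by rewrite !(mulrDl, linearD) ea eb ?scalerDr addrACA.
rewrite -mulrA (bar_letter _ (homogM hf hc')) (bar_letter _ hf) IHn //.
rewrite mulrBl -addrA; congr (_ + _).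
  by rewrite mulr_suml; apply: eq_bigr => p _; rewrite !mulrA.
by rewrite mulrDr opprD -scalerAr exprS mulN1r scaleNr !mulrA.
Qed.

Local Notation e := (letter (1 : H)).

Lemma tin_rcons n f : tin H n.+1 (rcons1 H n f) = tin H n f * e.
Proof.
elim: n f => [|n IHn] f.
  rewrite [rcons1 H 0 f](_ : _ = (1 : H) ⊗t f) // tin_tens.
  by rewrite (tin0 _ (f : k)) -scalerAl -scalerAr mul1r mulr1.
elim/tens_ind: f => [|a b ea eb|x f]; first by rewrite !linear0 mul0r.
  by rewrite !linearD mulrDl ea eb.
rewrite [rcons1 H n.+1 _](_ : _ = tmap idfun (rcons1 H n) (x ⊗t f)) //.
by rewrite tmapE !tin_tens IHn mulrA.
Qed.

Lemma tin_lcons n (f : tpow H n) : tin H n.+1 (lcons1 H n f) = e * tin H n f.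
Proof. by rewrite [lcons1 H n f](_ : _ = 1 ⊗t f) // tin_tens. Qed.

Lemma cdiffE n c : homog n c -> cdiff c = e * c - (-1) ^+ n *: (c * e) - bar c.
Proof.
move=> ->; move: (tcomp H n c) => f; rewrite cdiff_tin bar_tin -tin_lcons -tin_rcons.
rewrite -linearZ -!linearB /=; congr (tin H n.+1 _); rewrite /cobar_diff.
rewrite big_ord_recl big_ord_recr /= expr0 scale1r -addrA; congr (_ + _).
rewrite eqxx addrC exprS mulN1r scaleNr; congr (_ + _).
rewrite barnE -sumrN; apply: eq_bigr => j _.
by rewrite /= add0n ltn_eqF // /bump add1n exprS mulN1r scaleNr.
Qed.

Lemma cdiff1 : cdiff 1 = 0.
Proof. by rewrite (cdiffE (homog1 H)) bar1 mul1r mulr1 scale1r subrr subr0. Qed.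

Lemma cdiff_mul n c c' m : homog n c -> homog m c' ->
  cdiff (c * c') = cdiff c * c' + (-1) ^+ n *: (c * cdiff c').
Proof.
move=> hc hc'; rewrite (cdiffE (homogM hc hc')) (cdiffE hc) (cdiffE hc').
rewrite (bar_mul hc hc') !(mulrDl, mulrDr, mulNr, mulrN, scalerDr, scalerN, scalerDl).
rewrite -!scalerAl -!scalerAr !scalerA -exprD !mulrA.
abel.
Qed.

Lemma act_e x : act x e = letter x.
Proof.
rewrite -[e]mulr1 act_letter -[RHS](sw_counitr (L := letter)); last exact: linearP.
by apply: eq_bigr => p _; rewrite act1 mulr1 -scalerAr mulr1.
Qed.

Lemma act_emul x c : act x (e * c) = \sum_(p <- sw x) letter p.1 * act p.2 c.
Proof. by rewrite act_letter; apply: eq_bigr => p _; rewrite mulr1. Qed.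

Lemma act_mule x n c : homog n c ->
  act x (c * e) = \sum_(p <- sw x) act p.1 c * letter p.2.
Proof. by move=> hc; rewrite (act_mul _ _ hc); apply: eq_bigr => p _; rewrite act_e. Qed.

Lemma bar_act n x c : homog n c -> bar (act x c) = act x (bar c).
Proof.
elim: n c x => [|n IHn] c x.
  move=> /homog0P[a ->]; rewrite linearZr_LR /= act1 !(linearZ_LR bar).
  by rewrite bar1 !scaler0 linear0r.
elim/homog_ind => [|a b ea eb|y f hf].
- by rewrite !(linear0r, linear0).
- by rewrite !(linearDr, linearD) ea eb.
rewrite act_letter linear_sum (bar_letter _ hf) linearBr linear_sumr.
transitivity (\sum_(p <- sw x) (\sum_(q <- sw p.1) \sum_(r <- sw y)
   letter (q.1 * r.1) * (letter (q.2 * r.2) * act p.2 f)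
    - letter (p.1 * y) * act p.2 (bar f))).
  apply: eq_bigr => p _; rewrite (bar_letter _ (homog_act _ hf)) IHn //.
  congr (_ - _); rewrite -(swM (F := fun a b => letter a * (letter b * act p.2 f))); last by lin.
  by apply: eq_bigr => q _; rewrite mulrA.
rewrite sumrB; congr (_ - _); last by rewrite act_letter.
rewrite (swA (F := fun x1 x2 x3 => \sum_(r <- sw y)
   letter (x1 * r.1) * (letter (x2 * r.2) * act x3 f))); try by lin.
transitivity (\sum_(p <- sw x) \sum_(r <- sw y)
   letter (p.1 * r.1) * act p.2 (letter r.2 * f)).
  apply: eq_bigr => p _; rewrite exchange_big; apply: eq_bigr => r _ /=.
  by rewrite act_letter mulr_sumr.
rewrite exchange_big; apply: eq_bigr => r _ /=.
by rewrite -mulrA act_letter.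
Qed.

End Differential.

#[global] Opaque bar cdiff.

(** * Twisted coinvariants and the cyclic operator *)

Section Cyclic.
Variables (k : comNzRingType) (H : hopfAlgType k) (chi : {lrmorphism H -> k^o}).
Hypothesis chi_invol : modular_pair_in_involution chi.
Local Notation T := (talg H).
Local Notation S := (antipode H).
Local Notation St := (twisted_antipode chi).
Local Notation e := (letter (1 : H)).
Implicit Types (c : T) (x : H).

Lemma bilin_coinv : bilin (fun x c => act (St x) c). Proof. by lin. Qed.
(** The projection of the (n+1)-st tensor power onto its twisted coinvariants
    ([coinv_act]), identified with the n-th tensor power: the action of
    [St x] removes the first letter [x]. *)
Definition coinv : {linear T -> T} := uncons bilin_coinv.

Lemma coinvE n x c : homog n c -> coinv (letter x * c) = act (St x) c.
Proof.
apply: (@unconsE _ _ _ bilin_coinv 0) => m y d hd.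
by rewrite addn0; apply: homog_act.
Qed.

Lemma bilin_rot : bilin (fun x c => c * letter x). Proof. by lin. Qed.
Definition rotate : {linear T -> T} := uncons bilin_rot.

Lemma rotE n x c : homog n c -> rotate (letter x * c) = c * letter x.
Proof.
apply: (@unconsE _ _ _ bilin_rot 1) => m y d hd.
exact: homogM hd (homog_letter _).
Qed.

Opaque coinv rotate.

Lemma homog_lin1 (L : {linear T -> T}) n m :
    (forall x c, homog n c -> homog m (L (letter x * c))) ->
  forall c, homog n.+1 c -> homog m (L c).
Proof.
move=> hL; apply: homog_ind => // [|a b ha hb]; first by rewrite linear0; apply: homog0.
by rewrite linearD; apply: homogD.
Qed.

Lemma homog_coinv n c : homog n.+1 c -> homog n (coinv c).
Proof.
by apply: homog_lin1 => x d hd; rewrite (coinvE _ hd); apply: homog_act.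
Qed.

Lemma homog_rot n c : homog n.+1 c -> homog n.+1 (rotate c).
Proof.
apply: homog_lin1 => x d hd; rewrite (rotE _ hd) -addn1.
exact: homogM hd (homog_letter _).
Qed.

Lemma act_twisted_letter x y n w : homog n w ->
  act (St x) (letter y * w) = \sum_(p <- sw x) letter (S p.2 * y) * act (St p.1) w.
Proof.
move=> hw; rewrite act_letter.
by rewrite (sw_twisted chi (F := fun a b => letter (a * y) * act b w)) //; lin.
Qed.

Lemma coinv_coface0 n x w : homog n w ->
  \sum_(p <- sw x) coinv (letter p.1 * letter p.2 * w) = e * act (St x) w.
Proof.
move=> hw; transitivity (\sum_(p <- sw x) \sum_(q <- sw p.1)
    letter (S q.2 * p.2) * act (St q.1) w).
  apply: eq_bigr => p _; rewrite -mulrA (coinvE _ (homogSM _ hw)).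
  by rewrite (act_twisted_letter _ _ hw).
rewrite (swA (F := fun x1 x2 x3 => letter (S x2 * x3) * act (St x1) w)); try by lin.
rewrite -(sw_counitr (L := fun x => e * act (St x) w)); last by lin.
apply: eq_bigr => p _; rewrite -mulr_suml -linear_sum sw_antipodel linearZ_LR.
by rewrite -scalerAl.
Qed.

(** For [g = letter 1] this computes the last coface of [act (St x) w].  It rests on
    [St x2 * x1 = chi x], hence on the involution, and the general form serves
    the homotopies with a cocycle [g] inserted. *)
Lemma coinv_coface_last m n x w g : homog m w -> homog n g ->
  \sum_(p <- sw x) coinv (letter p.2 * (w * act p.1 g)) = act (St x) w * g.
Proof.
move=> hw hg; transitivity (\sum_(p <- sw x) \sum_(q <- sw p.2)
    act (S q.2) w * act (St q.1 * p.1) g).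
  apply: eq_bigr => p _; rewrite (coinvE _ (homogM hw (homog_act _ hg))).
  rewrite (act_mul _ _ hw).
  rewrite (sw_twisted chi (F := fun a b => act a w * act b (act p.1 g))); last by lin.
  by apply: eq_bigr => q _; rewrite (actM _ _ hg).
rewrite -(swA (F := fun x1 x2 x3 => act (S x3) w * act (St x2 * x1) g)); try by lin.
rewrite twistedE linear_sumlz mulr_suml; apply: eq_bigr => p _.
rewrite -mulr_sumr -linear_sumlz (sw_twistedr chi_invol) !linearZl_LR /=.
by rewrite (act_1 hg) -scalerAl -scalerAr.
Qed.

Definition tau : {linear T -> T} := degreewise (cyclic_op chi).

Lemma tau_tin n f : tau (tin H n f) = tin H n (cyclic_op chi n f).
Proof. by apply: degreewiseE. Qed.

(** Multiplication by an iterated diagonal is the diagonal action; this brings the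
    Connes-Moscovici operator into the form [tauE]. *)
Lemma tpow_mul_iter_diag n h (f : tpow H n.+1) :
  tpow_mul H n.+1 (iter_diag H n h ⊗t f) = actn H n.+1 (h ⊗t f).
Proof.
elim: n h f => [|n IHn] h f.
  elim/tens_ind: f => [|a b ea eb|x f]; first by rewrite !linear0r !linear0.
    by rewrite !linearDr !linearD ea eb.
  rewrite [LHS](_ : _ = tmap amul tunitl (tmiddle ((h ⊗t (1 : k^o)) ⊗t (x ⊗t f)))) //.
  rewrite tmiddleE tmapE amulE tunitlE scale1r actnS.
  rewrite -[in LHS](sw_counitr (L := id) _ h) // mulr_suml linear_sumlz.
  apply: eq_bigr => p _; rewrite -scalerAl linearZl_LR /=.
  rewrite -[f in RHS]mulr1 -[f * 1]/((f : k) *: (1 : k^o)) linearZr_LR linearZ_LR actn0.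
  rewrite -linearZr_LR; congr (_ ⊗t _); rewrite [LHS]mulrC //.
elim/tens_ind: f => [|a b ea eb|x f]; first by rewrite !linear0r !linear0.
  by rewrite !linearDr !linearD ea eb.
rewrite [LHS](_ : _ = tmap amul (tpow_mul H n.+1) (tmiddle
  (tmap idfun (iter_diag H n) (coprod H h) ⊗t (x ⊗t f)))) //.
rewrite actnS coprod_sw (linear_sum (tmap idfun _)) /=.
rewrite linear_sumlz (linear_sum tmiddle) (linear_sum (tmap amul _)).
by apply: eq_bigr => p _; rewrite tmapE tmiddleE tmapE amulE IHn.
Qed.

Lemma act_tin n h f : act h (tin H n f) = tin H n (actn H n (h ⊗t f)).
Proof.
apply: talgP => m; rewrite actE; have [<-|nm] := eqVneq n m.
  by rewrite !tcomp_in.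
by rewrite !tcomp_in_ne // linear0r linear0.
Qed.

Lemma tauE n x w : homog n w -> tau (letter x * w) = act (St x) (w * e).
Proof.
move=> ->; move: (tcomp H n w) => f; rewrite -tin_tens tau_tin -tin_rcons act_tin.
congr (tin H n.+1 _); rewrite -tpow_mul_iter_diag.
rewrite [LHS](_ : _ = tpow_mul H n.+1
  (tmap (iter_diag H n \o St) (rcons1 H n) (x ⊗t f))) //.
by rewrite tmapE.
Qed.

(** The cyclic operator is a rotation of the letters in one more variable.  Both
    sides apply [St] twice to a letter [x]; the convolution identity
    [sw_twisted_antipode] cancels what is left of [x] in front. *)
Lemma tau_coinv n c : homog n.+2 c -> tau (coinv c) = coinv (rotate c).
Proof.
elim/homog_ind => [|a b ea eb|x c0 hc0]; first by rewrite !linear0.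
  by rewrite !linearD ea eb.
elim/homog_ind: hc0 => [|a b ea eb|y w hw]; first by rewrite mulr0 !linear0.
  by rewrite mulrDr !linearD ea eb.
rewrite (coinvE _ (homogSM _ hw)) (rotE _ (homogSM _ hw)) -mulrA.
rewrite (coinvE _ (homogM hw (homog_letter x))) (act_twisted_letter _ _ hw).
have hwe := homogM hw (homog_letter (1 : H)).
transitivity (\sum_(p <- sw x) \sum_(q <- sw p.1)
   act (St y) (act (St (S p.2) * St q.2) (w * letter q.1))).
  rewrite linear_sum; apply: eq_bigr => p _.
  rewrite (tauE _ (homog_act _ hw)) twistedM.
  rewrite -(coinv_coface_last p.1 hw (homog_letter 1)) linear_sumr.
  apply: eq_bigr => q _; rewrite act_e.
  have hwl := homogM hw (homog_letter q.1).
  by rewrite (coinvE _ hwl) -!(actM _ _ hwl) mulrA.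
rewrite (swA (F := fun x1 x2 x3 =>
  act (St y) (act (St (S x3) * St x2) (w * letter x1)))); try by lin.
rewrite -(sw_counitr (L := fun x => act (St y) (w * letter x))); last by lin.
apply: eq_bigr => p _; rewrite -linear_sumr -linear_sumlz.
rewrite (sw_twisted_antipode chi) linearZl_LR linearZr_LR /=.
by rewrite (act_1 (homogM hw (homog_letter _))).
Qed.

Lemma coinv_act n z c : homog n.+1 c -> coinv (act z c) = (chi z : k) *: coinv c.
Proof.
elim/homog_ind => [|a b ea eb|x w hw]; first by rewrite linear0r !linear0.
  by rewrite linearDr !linearD ea eb.
rewrite act_letter linear_sum (coinvE _ hw).
transitivity (\sum_(p <- sw z) act (St x) (act (St p.1 * p.2) w)).
  apply: eq_bigr => p _; rewrite (coinvE _ (homog_act _ hw)) twistedM.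
  by rewrite -!(actM _ _ hw) mulrA.
rewrite -linear_sumr -linear_sumlz sw_twistedl linearZl_LR linearZr_LR /=.
by rewrite (act_1 hw).
Qed.

End Cyclic.

#[global] Opaque coinv rotate tau.

(** * Codegeneracies and the Connes coboundary *)

Section ConnesB.
Variables (k : comNzRingType) (H : hopfAlgType k) (chi : {lrmorphism H -> k^o}).
Hypothesis chi_invol : modular_pair_in_involution chi.
Local Notation T := (talg H).
Local Notation eps := (counit H).
Local Notation e := (letter (1 : H)).
Implicit Types (c : T) (x : H).
Local Notation coinv := (coinv chi).
Local Notation rotate := (rotate H).
Local Notation tau := (tau chi).

Definition codn j n : {linear tpow H n -> tpow H n.-1} :=
  match n with 0 => \0 | n'.+1 => codeg H n' j end.

Definition cod j : {linear T -> T} := degreewise (codn j).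

Let leqSpred n : (n <= n.-1.+1)%N. Proof. by case: n. Qed.

Lemma cod_tin j n f : cod j (tin H n.+1 f) = tin H n (codeg H n j f).
Proof. exact: (degreewiseE (codn j) leqSpred). Qed.

Lemma homog_cod j n c : homog n.+1 c -> homog n (cod j c).
Proof. exact: (homog_degreewise (codn j) leqSpred). Qed.

Lemma cod1 j : cod j 1 = 0.
Proof.
rewrite [1]/(tin H 0 (1 : k^o)) [LHS](degreewiseE (codn j) leqSpred (n := 0)).
exact: linear0.
Qed.

Lemma cod0_letter n x c : homog n c -> cod 0 (letter x * c) = (eps x : k) *: c.
Proof.
move=> ->; rewrite -tin_tens cod_tin -linearZ /=; congr (tin H n _).
rewrite [LHS](_ : _ = tunitl (tmap eps idfun (x ⊗t tcomp H n c))); last by case: n.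
by rewrite tmapE tunitlE.
Qed.

Lemma codS_letter j n x c :
  homog n c -> cod j.+1 (letter x * c) = letter x * cod j c.
Proof.
case: n => [/homog0P[a ->]|n ->].
  rewrite -scalerAr !(linearZ_LR (cod _)) cod1 scaler0 mulr0.
  rewrite [1]/(tin H 0 (1 : k^o)) -tin_tens cod_tin.
  rewrite [codeg H 0 j.+1 _](_ : _ = 0) //.
  by rewrite linear0 scaler0.
rewrite -tin_tens !cod_tin -tin_tens; congr (tin H n.+1 _).
by rewrite [LHS](_ : _ = tmap idfun (codeg H n j) (x ⊗t tcomp H n.+1 c)) // tmapE.
Qed.

Opaque cod.

Lemma cod_act j n h c : homog n c -> cod j (act h c) = act h (cod j c).
Proof.
elim: n h c j => [|n IHn] h c j.
  move=> /homog0P[a ->]; rewrite linearZr_LR /= act1 !(linearZ_LR (cod j)) cod1.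
  by rewrite !scaler0 linear0r.
elim/homog_ind => [|a b ea eb|x w hw]; first by rewrite !(linear0r, linear0).
  by rewrite !(linearDr, linearD) ea eb.
rewrite act_letter linear_sum; case: j => [|j].
  rewrite (cod0_letter _ hw) linearZr_LR /=.
  rewrite -(sw_counitl (L := fun h => act h w)); last by lin.
  rewrite scaler_sumr; apply: eq_bigr => p _.
  by rewrite (cod0_letter _ (homog_act _ hw)) rmorphM scalerA mulrC.
rewrite (codS_letter _ _ hw) act_letter; apply: eq_bigr => p _.
by rewrite (codS_letter _ _ (homog_act _ hw)) IHn.
Qed.

Lemma cod_coinv j n c : homog n.+1 c -> cod j (coinv c) = coinv (cod j.+1 c).
Proof.
elim/homog_ind => [|a b ea eb|x w hw]; first by rewrite !linear0.
  by rewrite !linearD ea eb.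
rewrite (coinvE _ _ hw) (cod_act _ _ hw) (codS_letter _ _ hw).
case: n hw => [|n] hw; last by rewrite (coinvE _ _ (homog_cod j hw)).
have [a ->] := homog0P hw; rewrite (linearZ_LR (cod j)) cod1 scaler0.
by rewrite !(mulr0, linear0r, linear0).
Qed.

(** The second projection acts on [act (St x) w] by the character, and
    [chi (St x)] is the counit of [x].  This is the origin of [B B = 0] on
    normalized cochains. *)
Lemma coinv_coinv n c : homog n.+2 c -> coinv (coinv c) = coinv (cod 0 c).
Proof.
elim/homog_ind => [|a b ea eb|x w hw]; first by rewrite !linear0.
  by rewrite !linearD ea eb.
rewrite (coinvE _ _ hw) (coinv_act chi _ hw) char_twisted (cod0_letter _ hw).
by rewrite linearZ.
Qed.

Lemma cod_last n w : homog n w -> cod n (w * e) = w.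
Proof.
elim: n w => [|n IHn] w.
  move=> /homog0P[a ->]; rewrite -scalerAl mul1r linearZ_LR -[e]mulr1 /=.
  by rewrite (cod0_letter _ (homog1 H)) rmorph1 scale1r.
elim/homog_ind => [|a b ea eb|x f hf]; first by rewrite mul0r linear0.
  by rewrite mulrDl linearD ea eb.
by rewrite -mulrA (codS_letter _ _ (homogM hf (homog_letter 1))) IHn.
Qed.

Lemma cod_tau n c : homog n.+1 c -> cod n (tau c) = coinv c.
Proof.
elim/homog_ind => [|a b ea eb|x w hw]; first by rewrite !linear0.
  by rewrite !linearD ea eb.
rewrite (tauE _ _ hw) (coinvE _ _ hw) (cod_act _ _ (homogM hw (homog_letter 1))).
by rewrite cod_last.
Qed.

(** A recursion that takes off one letter at a time, like the inductions below;
    [cyc_sum] is the closed form. *)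
Fixpoint cyc_fun n (s : bool) c : T :=
  if n is n'.+1 then c + (-1) ^+ s *: cyc_fun n' s (rotate c) else 0.

Lemma cyc_fun_linear n s : linear (cyc_fun n s).
Proof.
elim: n => [|n IHn] a x y /=; first by rewrite scaler0 addr0.
by rewrite linearP IHn !scalerDr !scalerA [a * _]mulrC addrACA.
Qed.
(** Locked, since simplification would otherwise unfold it at a successor; likewise
    for [ins] below. *)
Definition cyc n s : {linear T -> T} := locked (mk_linear (cyc_fun_linear n s)).

Lemma cyc0 s c : cyc 0 s c = 0. Proof. by rewrite /cyc; unlock. Qed.
Lemma cycS n s c : cyc n.+1 s c = c + (-1) ^+ s *: cyc n s (rotate c).
Proof. by rewrite /cyc; unlock. Qed.

Lemma homog_cyc m n s c : homog m.+1 c -> homog m.+1 (cyc n s c).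
Proof.
elim: n c => [|n IHn] c hc; first by rewrite cyc0; apply: homog0.
by rewrite cycS; apply: homogD => //; apply: homogZ; apply/IHn/homog_rot.
Qed.

Lemma cyc_sum n s c :
  cyc n s c = \sum_(i < n) ((-1) ^+ s) ^+ i *: iter i rotate c.
Proof.
elim: n c => [|n IHn] c; first by rewrite cyc0 big_ord0.
rewrite cycS big_ord_recl expr0 scale1r; congr (_ + _).
rewrite IHn scaler_sumr; apply: eq_bigr => i _.
by rewrite scalerA -exprS iterSr.
Qed.

Definition conBn n : {linear tpow H n -> tpow H n.-1} :=
  match n with 0 => \0 | n'.+1 => @connesB k H chi n' end.

Definition conB : {linear T -> T} := degreewise conBn.

Lemma conB_tin n f : conB (tin H n.+1 f) = tin H n (connesB chi f).
Proof. exact: (degreewiseE conBn leqSpred). Qed.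

Lemma homog_conB n c : homog n c -> homog n.-1 (conB c).
Proof. exact: (homog_degreewise conBn leqSpred). Qed.

Lemma conB0 c : homog 0 c -> conB c = 0.
Proof.
by move=> ->; rewrite [LHS](degreewiseE conBn leqSpred (n := 0)) linear0.
Qed.

Lemma iter_tau_coinv i n c : homog n.+2 c ->
  iter i tau (coinv c) = coinv (iter i rotate c).
Proof.
move=> hc; have hi j : homog n.+2 (iter j rotate c).
  by elim: j => //= j; apply: homog_rot.
elim: i => //= i ->; exact: (tau_coinv chi_invol (hi i)).
Qed.

(** The additional codegeneracy is [coinv] ([cod_tau]), and [tau_coinv] moves the
    powers of the cyclic operator inside as rotations. *)
Lemma conBE n c : homog n.+1 c -> conB c = coinv (cyc n.+1 (odd n) c).
Proof.
move=> hc; rewrite {1}hc conB_tin /connesB linear_sum cyc_sum linear_sum.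
apply: eq_bigr => i _; rewrite !linearZ_LR; congr (_ *: _).
  by rewrite signr_odd -exprM mulnC.
have iterE j f : tin H n (iter j (cyclic_op chi n) f) = iter j tau (tin H n f).
  by elim: j => //= j IHj; rewrite -tau_tin IHj.
rewrite iterE [extra_codeg _ _ _](_ : _ = codeg H n n (cyclic_op chi n.+1 (tcomp H n.+1 c))) //.
rewrite -cod_tin -tau_tin -hc (cod_tau hc).
case: n hc i iterE => [|n] hc i iterE; last by rewrite (iter_tau_coinv _ hc).
by case: i => [[]].
Qed.

Opaque conB.
End ConnesB.

#[global] Opaque cod conB.

(** * Differentials of cyclic sums *)

Ltac by_signs :=
  rewrite /= ?(expr0, expr1, scale1r, scaleN1r) /=;
  rewrite ?(opprK, opprD, mulrDr, mulrDl, mulrN, mulNr, linearD, linearN) /=.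

Section Homotopy.
Variables (k : comNzRingType) (H : hopfAlgType k) (chi : {lrmorphism H -> k^o}).
Hypothesis chi_invol : modular_pair_in_involution chi.
Local Notation T := (talg H).
Local Notation e := (letter (1 : H)).
Implicit Types (c f u w : T) (x : H).
Local Notation coinv := (coinv chi).
Local Notation rotate := (rotate H).
Local Notation cyc := (cyc H).
Local Notation bar := (bar H).
Local Notation cdiff := (cdiff H).

Lemma cdiff_coinv n x w : homog n w ->
  cdiff (coinv (letter x * w)) =
    \sum_(p <- sw x) coinv (letter p.1 * letter p.2 * w) - coinv (letter x * bar w)
    - (-1) ^+ n *: \sum_(p <- sw x) coinv (letter p.2 * (w * letter p.1)).
Proof.
move=> hw; rewrite (coinvE _ _ hw) (cdiffE (homog_act _ hw)) (coinv_coface0 _ _ hw).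
rewrite (coinvE _ _ (homog_bar hw)) (bar_act _ hw).
rewrite -(coinv_coface_last chi_invol x hw (homog_letter 1)) addrAC.
by under [in LHS]eq_bigr => p _ do rewrite act_e.
Qed.

Lemma bar_mul_letter q u x : homog q u ->
  bar (u * letter x) =
    bar u * letter x + (-1) ^+ q *: \sum_(p <- sw x) u * letter p.1 * letter p.2.
Proof.
move=> hu; rewrite (bar_mul hu (homog_letter x)); congr (_ + _ *: _).
rewrite -[letter x]mulr1 (bar_letter _ (homog1 H)) bar1 mulr0 subr0 mulr_sumr.
by apply: eq_bigr => p _; rewrite mulr1 mulrA.
Qed.

Lemma cycM n s x w m : homog m w ->
  cyc n.+1 s (letter x * w) = letter x * w + (-1) ^+ s *: cyc n s (w * letter x).
Proof. by move=> hw; rewrite cycS (rotE _ hw). Qed.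

(** In [cdiff_coinv] the last coface yields words in which a split letter lies on
    both sides of the cut.  These are the rotations missing from the other terms,
    so that all terms together are the cyclic sums of [bar f * u] and
    [f * bar u].  The sign [s] is the cyclic sign in degree [n + q]; the one in
    the next degree is its negation. *)
Lemma cdiff_coinv_cyc n q s f u : homog n f -> homog q u -> s = ~~ odd (n + q) ->
  cdiff (coinv (cyc n s (f * u))) =
    coinv (cyc n.+1 (~~ s) (bar f * u))
    + (-1) ^+ odd n *: coinv (cyc n (~~ s) (f * bar u)).
Proof.
elim: n q s f u => [|n IHn] q s f u.
  move=> /homog0P[a ->] _ _; rewrite !cyc0 (linearZ_LR bar) bar1 scaler0 mul0r !linear0.
  by rewrite addr0.
elim/homog_ind => [|a b ea eb|x f0 hf0] hu hs.
- by rewrite linear0 !mul0r !linear0 addr0.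
- by rewrite !(mulrDl, linearD) /= ea // eb // ?scalerDr addrACA.
have hfu := homogM hf0 hu; have hul := homogM hu (homog_letter x).
rewrite -mulrA (cycM _ _ _ hfu) !linearD linearZ_LR [cdiff (_ *: _)]linearZ_LR.
rewrite (cdiff_coinv _ hfu) -(mulrA f0) (IHn _ _ _ _ hf0 hul); last first.
  by rewrite hs addn1 addnS.
rewrite (bar_letter _ hf0) (bar_mul_letter _ hu) mulrBl mulr_suml !linearB.
(* The letter [x] is split in front of the word (A), across the cut (B), or at
   the end of the word (C). *)
set A := \sum_(p <- sw x) _; set B := \sum_(p <- sw x) _.
pose C := \sum_(p <- sw x) coinv (cyc n (~~ s) (f0 * (u * letter p.1 * letter p.2))).
have -> : coinv (cyc n.+2 (~~ s) (\sum_(p <- sw x) letter p.1 * letter p.2 * f0 * u))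
    = \sum_(p <- sw x) (coinv (letter p.1 * letter p.2 * (f0 * u))
      + (-1) ^+ (~~ s) *: coinv (letter p.2 * (f0 * u * letter p.1))
      + coinv (cyc n (~~ s) (f0 * (u * letter p.1 * letter p.2)))).
  rewrite !linear_sum; apply: eq_bigr => p _ /=.
  rewrite -!mulrA (cycM _ _ _ (homogSM _ hfu)) -!mulrA.
  have hfu1 := homogM hfu (homog_letter p.1); rewrite -mulrA in hfu1.
  rewrite (cycM _ _ _ hfu1) -!mulrA.
  by case: (s); by_signs; abel.
have hbfu := homogM (homog_bar hf0) hu; have hfbu := homogM hf0 (homog_bar hu).
rewrite !big_split -scaler_sumr -/A -/B -/C -!mulrA (cycM _ _ _ hbfu) (cycM _ _ _ hfbu).
rewrite [in LHS]mulrDr -scalerAr mulr_sumr.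
rewrite (bar_mul hf0 hu).
rewrite -[(-1) ^+ n]signr_odd -[(-1) ^+ (n + q)]signr_odd -[(-1) ^+ q]signr_odd.
have CE : coinv (cyc n (~~ s) (\sum_(i <- sw x) f0 * (u * letter i.1 * letter i.2)))
  = C by rewrite !linear_sum.
rewrite -[bar f0 * u * letter x]mulrA -[f0 * bar u * letter x]mulrA.
clearbody A B C; move: CE; rewrite hs !oddD /=.
by case: (odd n); case: (odd q) => /= CE; by_signs; rewrite CE; abel.
Qed.

Section Insertion.
Variables (p : nat) (g : T).
Hypothesis hg : homog p g.

Lemma bilin_graft : bilin (fun x c => c * act x g). Proof. by lin. Qed.
Definition graft : {linear T -> T} := uncons bilin_graft.

Lemma graftE n x c : homog n c -> graft (letter x * c) = c * act x g.
Proof.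
apply: (@unconsE _ _ _ bilin_graft p) => m y d hd.
exact: homogM hd (homog_act _ hg).
Qed.

(** On [f * u], with [f] the word [x_1 ... x_n], the signed sum over [i] of the first
    [n - i] rotations, starting with the trivial one, of
    [x_(i+1) ... x_n * u * x_1 ... x_(i-1) * act x_i g]. *)
Fixpoint ins_fun n (s : bool) c : T :=
  if n is n'.+1 then
    (-1) ^+ (s && odd p) *: cyc n' (s (+) ~~ odd p) (graft c)
    + (-1) ^+ s *: ins_fun n' s (rotate c)
  else 0.

Lemma ins_fun_linear n s : linear (ins_fun n s).
Proof.
elim: n => [|n IHn] a x y /=; first by rewrite scaler0 addr0.
rewrite (linearP graft) (linearP (cyc _ _)) (linearP rotate) IHn !scalerDr !scalerA.
by rewrite ![a * _]mulrC addrACA.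
Qed.
Definition ins n s : {linear T -> T} := locked (mk_linear (ins_fun_linear n s)).

Lemma ins0 s c : ins 0 s c = 0. Proof. by rewrite /ins; unlock. Qed.
Lemma insS n s c : ins n.+1 s c =
  (-1) ^+ (s && odd p) *: cyc n (s (+) ~~ odd p) (graft c)
  + (-1) ^+ s *: ins n s (rotate c).
Proof. by rewrite /ins; unlock. Qed.

Lemma insM n s x w m : homog m w ->
  ins n.+1 s (letter x * w) =
    (-1) ^+ (s && odd p) *: cyc n (s (+) ~~ odd p) (w * act x g)
    + (-1) ^+ s *: ins n s (w * letter x).
Proof. by move=> hw; rewrite insS (graftE _ hw) (rotE _ hw). Qed.

Hypothesis dg : cdiff g = 0.

(** For a cocycle the inner cofaces amount to the outer ones. *)
Lemma act_bar_cocycle x : act x (bar g) =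
  \sum_(r <- sw x) letter r.1 * act r.2 g
  - (-1) ^+ p *: \sum_(r <- sw x) act r.1 g * letter r.2.
Proof.
have -> : bar g = e * g - (-1) ^+ p *: (g * e).
  by apply/eqP; rewrite eq_sym -subr_eq0 -(cdiffE hg) dg.
by rewrite linearBr linearZr_LR /= act_emul (act_mule _ hg).
Qed.

(** The same mechanism as in [cdiff_coinv_cyc].  The last term is new: there the cut
    passes through the split of the letter that carries [g], and
    [coinv_coface_last] moves [g] out of the projection. *)
Lemma cdiff_coinv_ins n q s f u : homog n f -> homog q u -> s = ~~ odd (n + q) ->
  cdiff (coinv (ins n s (f * u))) =
    (-1) ^+ (~~ odd p) *: (coinv (ins n.+1 (~~ s) (bar f * u))
      + (-1) ^+ odd n *: coinv (ins n (~~ s) (f * bar u)))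
    + (-1) ^+ (s && odd p) *: (coinv (cyc n s (f * u)) * g).
Proof.
elim: n q s f u => [|n IHn] q s f u.
  move=> /homog0P[a ->] _ _; rewrite !ins0 !cyc0 (linearZ_LR bar) bar1 scaler0 mul0r !linear0.
  by rewrite mul0r !(addr0, scaler0).
elim/homog_ind => [|a b ea eb|x f0 hf0] hu hs.
- by rewrite linear0 !mul0r !linear0 mul0r !(addr0, scaler0).
- rewrite !(mulrDl, linearD) /= ea // eb //.
  by rewrite !(mulrDl, scalerDr); abel.
have hfu := homogM hf0 hu; have hul := homogM hu (homog_letter x).
have hg' r := homog_act r hg.
have hug := homogM hu (hg' x).
rewrite -mulrA (insM _ _ _ hfu) (cycM _ _ _ hfu).
rewrite !linearD !(linearZ_LR coinv) !(linearZ_LR cdiff) -!(mulrA f0).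
rewrite (IHn _ _ _ _ hf0 hul); last by rewrite hs addn1 addnS.
rewrite (cdiff_coinv_cyc hf0 hug); last first.
  by rewrite hs !oddD /=; case: (odd n); case: (odd q); case: (odd p).
rewrite (bar_mul hu (hg' x)) (bar_act _ hg) act_bar_cocycle.
rewrite (bar_letter _ hf0) (bar_mul_letter _ hu) mulrBl mulr_suml !linearB.
have -> : coinv (ins n.+2 (~~ s) (\sum_(r <- sw x) letter r.1 * letter r.2 * f0 * u))
  = \sum_(r <- sw x) ((-1) ^+ (~~ s && odd p) *:
      (coinv (letter r.2 * (f0 * u * act r.1 g)) + (-1) ^+ (~~ s (+) ~~ odd p) *:
        coinv (cyc n (~~ s (+) ~~ odd p) (f0 * (u * (act r.1 g * letter r.2))))) +
      (-1) ^+ (~~ s) *: ((-1) ^+ (~~ s && odd p) *: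
        coinv (cyc n (~~ s (+) ~~ odd p) (f0 * (u * (letter r.1 * act r.2 g))))
        + (-1) ^+ (~~ s) *: coinv (ins n (~~ s) (f0 * (u * letter r.1 * letter r.2))))).
  rewrite !linear_sum; apply: eq_bigr => r _ /=.
  rewrite -!mulrA (insM _ _ _ (homogSM _ hfu)) -!mulrA.
  have hfug := homogM hfu (hg' r.1); rewrite -mulrA in hfug.
  have hful := homogM hfu (homog_letter r.1); rewrite -mulrA in hful.
  rewrite (cycM _ _ _ hfug) (insM _ _ _ hful) -!mulrA.
  by case: (s); case: (odd p); by_signs; abel.
rewrite !big_split -!scaler_sumr !big_split -!scaler_sumr.
rewrite (coinv_coface_last chi_invol x hfu hg) -(coinvE _ _ hfu).
pose P1 := \sum_(r <- sw x)
  coinv (cyc n (~~ s (+) ~~ odd p) (f0 * (u * (letter r.1 * act r.2 g)))).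
pose P2 := \sum_(r <- sw x)
  coinv (cyc n (~~ s (+) ~~ odd p) (f0 * (u * (act r.1 g * letter r.2)))).
pose Q := \sum_(r <- sw x) coinv (ins n (~~ s) (f0 * (u * letter r.1 * letter r.2))).
rewrite -/P1 -/P2 -/Q.
have P1E : coinv (cyc n (~~ s (+) ~~ odd p)
  (f0 * (u * \sum_(r <- sw x) letter r.1 * act r.2 g))) = P1.
  by rewrite !mulr_sumr !linear_sum.
have P2E : coinv (cyc n (~~ s (+) ~~ odd p)
  (f0 * (u * \sum_(r <- sw x) act r.1 g * letter r.2))) = P2.
  by rewrite !mulr_sumr !linear_sum.
have QE : coinv (ins n (~~ s)
  (f0 * \sum_(r <- sw x) u * letter r.1 * letter r.2)) = Q.
  by rewrite !mulr_sumr !linear_sum.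
clearbody P1 P2 Q.
have hbfu := homogM (homog_bar hf0) hu; have hfbu := homogM hf0 (homog_bar hu).
rewrite -[letter x * bar f0 * u]mulrA -[letter x * f0 * bar u]mulrA.
rewrite (insM _ _ _ hbfu) (insM _ _ _ hfbu).
rewrite -[(-1) ^+ p]signr_odd -[(-1) ^+ q]signr_odd.
rewrite -!(mulrA (bar f0)) -!(mulrA f0).
move: P1E P2E QE; rewrite hs !oddD /=.
case: (odd n); case: (odd q); case: (odd p) => /= P1E P2E QE; by_signs; rewrite ?P1E ?P2E ?QE; abel.
Qed.

End Insertion.
End Homotopy.

#[global] Opaque graft.

(** * Half cyclic sums and the Connes coboundary of a product *)

Section Relations.
Variables (k : comNzRingType) (H : hopfAlgType k) (chi : {lrmorphism H -> k^o}).
Hypothesis chi_invol : modular_pair_in_involution chi.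
Local Notation T := (talg H).
Local Notation e := (letter (1 : H)).
Implicit Types (a b c f u w : T) (x : H).
Local Notation coinv := (coinv chi).
Local Notation rotate := (rotate H).
Local Notation cyc := (cyc H).
Local Notation bar := (bar H).
Local Notation cdiff := (cdiff H).
Local Notation conB := (conB chi).

Lemma coinv_e n c : homog n c -> coinv (e * c) = c.
Proof. by move=> hc; rewrite (coinvE _ _ hc) twisted1 (act_1 hc). Qed.

Lemma cyc_rcons n q s x f v : homog n f -> homog q v ->
  cyc n.+1 s (f * (letter x * v)) =
    cyc n s (f * (letter x * v)) + (-1) ^+ (s && odd n) *: (letter x * v * f).
Proof.
elim: n q s f v => [|n IHn] q s f v.
  move=> /homog0P[a ->] hv; rewrite andbF expr0 scale1r cyc0 add0r.
  by rewrite -scalerAl -scalerAr mul1r mulr1 linearZ_LR (cycM _ _ _ hv) cyc0 scaler0 addr0.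
elim/homog_ind => [|a b ea eb|y f0 hf0] hv.
- by rewrite !(mul0r, mulr0, linear0) addr0.
- by rewrite !(mulrDl, mulrDr, linearD) ea // eb //; abel.
have hfxv := homogM hf0 (homogSM x hv).
rewrite -mulrA !(cycM _ _ _ hfxv) -!mulrA.
rewrite (IHn _ _ _ _ hf0 (homogM hv (homog_letter y))) !mulrA.
by case: (s); rewrite /=; case: (odd n); by_signs; abel.
Qed.

Lemma bar_cdiff n f : homog n f -> bar f = e * f - (-1) ^+ odd n *: (f * e) - cdiff f.
Proof.
by move=> hf; rewrite (cdiffE hf) signr_odd subKr.
Qed.

(** The summands of [B (f * u)] in which the letter removed by [coinv] belongs to
    [f], a word with [n] letters. *)
Definition zcyc n q f u := coinv (cyc n (~~ odd (n + q)) (f * u)).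

(** Replacing [bar] by the differential and the outer cofaces in [cdiff_coinv_cyc],
    the latter insert a unit at the ends of [f] and of [u].  Their contributions
    telescope to the two extreme words [f * u] and [u * f]. *)
Lemma cdiff_zcyc n q f u : homog n f -> homog q u ->
  cdiff (zcyc n q f u) =
    f * u - (-1) ^+ (odd n && odd q) *: (u * f)
    - coinv (cyc n.+1 (odd (n + q)) (cdiff f * u))
    - (-1) ^+ odd n *: coinv (cyc n (odd (n + q)) (f * cdiff u)).
Proof.
move=> hf hu; rewrite /zcyc (cdiff_coinv_cyc chi_invol hf hu) // negbK.
rewrite (bar_cdiff hf) (bar_cdiff hu).
have E1 : coinv (cyc n.+1 (odd (n + q)) (e * f * u)) = f * u
    + (-1) ^+ odd (n + q) *: coinv (cyc n (odd (n + q)) (f * (u * e))).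
  have hfu := homogM hf hu; rewrite -mulrA (cycM _ _ _ hfu) linearD (coinv_e hfu).
  by rewrite linearZ_LR mulrA.
have E2 : coinv (cyc n.+1 (odd (n + q)) (f * e * u)) =
    coinv (cyc n (odd (n + q)) (f * (e * u)))
    + (-1) ^+ (odd (n + q) && odd n) *: (u * f).
  rewrite -mulrA (cyc_rcons _ _ hf hu) linearD linearZ_LR -mulrA.
  by rewrite (coinv_e (homogM hu hf)).
move: E1 E2; rewrite !oddD.
case: (odd n); case: (odd q) => /= E1 E2; by_signs; rewrite E1 E2; by_signs; abel.
Qed.

Lemma conB_zcyc n c : homog n c -> conB c = zcyc n 0 c 1.
Proof.
case: n => [|n] hc; first by rewrite (conB0 _ hc) /zcyc cyc0 linear0.
by rewrite (conBE chi_invol hc) /zcyc mulr1 addn0 /= negbK.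
Qed.

(** The case [u = 1] of [cdiff_zcyc], where the two extreme words agree. *)
Lemma cdiff_conB n c : homog n c -> cdiff (conB c) = - conB (cdiff c).
Proof.
move=> hc; rewrite (conB_zcyc hc) (cdiff_zcyc hc (homog1 H)) cdiff1 mulr0 !linear0.
rewrite andbF scale1r mulr1 mul1r subrr sub0r ?(subr0, addr0) mulr1 addn0.
by rewrite (conBE chi_invol (homog_cdiff hc)).
Qed.

Lemma iter_rot m n f g : homog m f -> homog n g -> iter m rotate (f * g) = g * f.
Proof.
elim: m n f g => [|m IHm] n f g.
  by move=> /homog0P[x ->] _; rewrite /= -scalerAl -scalerAr mul1r mulr1.
have lin j : linear (iter j rotate).
  by elim: j => // j IHj x y z; rewrite !iterS IHj linearP.
pose it j : {linear T -> T} := mk_linear (lin j).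
elim/homog_ind => [|a b ea eb|x f0 hf0] hg.
- by rewrite mul0r mulr0 -[LHS]/(it m.+1 0) linear0.
- by rewrite mulrDl mulrDr -[LHS]/(it m.+1 _) linearD -ea // -eb.
rewrite iterSr -mulrA (rotE _ (homogM hf0 hg)) -mulrA.
by rewrite (IHm _ _ _ hf0 (homogM hg (homog_letter x))) mulrA.
Qed.

Lemma cyc_add m n s c : cyc (m + n) s c =
  cyc m s c + (-1) ^+ (s && odd m) *: cyc n s (iter m rotate c).
Proof.
elim: m c => [|m IHm] c; first by rewrite cyc0 andbF expr0 scale1r add0r.
rewrite addSn !cycS IHm iterSr.
by case: (s); rewrite /=; case: (odd m); by_signs; abel.
Qed.

Lemma conB_mul m n f g : homog m f -> homog n g ->
  conB (f * g) = zcyc m n f g + (-1) ^+ (odd m && odd n) *: zcyc n m g f.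
Proof.
move=> hf hg; rewrite (conB_zcyc (homogM hf hg)) /zcyc mulr1 addn0.
rewrite cyc_add (iter_rot hf hg) linearD linearZ_LR [(n + m)%N]addnC; congr (_ + _ *: _).
by rewrite oddD; case: (odd m); case: (odd n).
Qed.

End Relations.

(** * The derivation given by insertion of a cochain *)

Section Derivation.
Variables (k : comNzRingType) (H : hopfAlgType k).
Local Notation T := (talg H).
Implicit Types (a b c f u w : T) (x : H).
Variables (p : nat) (g : T).
Hypothesis hg : homog p g.

Lemma bilin_der n (L : {linear tpow H n -> T}) :
  bilin (fun x (f : tpow H n) =>
    act x g * tin H n f + (-1) ^+ (~~ odd p) *: (letter x * L f)).
Proof.
split=> [a x x' f|a x f f'].
  by rewrite linearPl linearP !mulrDl -!scalerAl !scalerDr !scalerA [a * _]mulrC addrACA.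
by rewrite !linearP !mulrDr -!scalerAr !scalerDr !scalerA [a * _]mulrC addrACA.
Qed.

(** Recursion on the tensor power instead of [uncons], as the value on
    [letter x * f] involves the operator itself. *)
Fixpoint dern n : {linear tpow H n -> T} :=
  match n with 0 => \0 | n'.+1 => tlin (bilin_der (dern n')) end.

Lemma dernS n x (f : tpow H n) : dern n.+1 (x ⊗t f) =
  act x g * tin H n f + (-1) ^+ (~~ odd p) *: (letter x * dern n f).
Proof. exact: tlinE. Qed.

Lemma homog_dern n (f : tpow H n) : homog (n.-1 + p) (dern n f).
Proof.
elim: n f => [|n IHn] f; first exact: homog0.
elim/tens_ind: f => [|f f' hf hf'|x f]; first by rewrite linear0; apply: homog0.
  by rewrite linearD; apply: homogD.
rewrite dernS /=; apply: homogD.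
  by rewrite addnC; apply: homogM; [apply: homog_act | apply: homog_in].
apply: homogZ; case: n IHn f => [|n] IHn f; first by rewrite mulr0; apply: homog0.
exact: homogSM.
Qed.

(** The derivation of degree [p - 1] that sends [letter x] to [act x g]. *)
Definition der : {linear T -> T} := glue dern.

Lemma der_tin n (f : tpow H n) : der (tin H n f) = dern n f.
Proof.
apply: (glue_in (homog_dern f)); rewrite -addSn.
by apply: leq_trans (leq_addr _ _); case: n f.
Qed.

Lemma homog_der n f : homog n f -> homog (n.-1 + p) (der f).
Proof. by move=> ->; rewrite der_tin; apply: homog_dern. Qed.

Lemma der1 : der 1 = 0.
Proof. by rewrite [1]/(tin H 0 (1 : k^o)) der_tin. Qed.

Lemma der_letter n x f : homog n f ->
  der (letter x * f) = act x g * f + (-1) ^+ (~~ odd p) *: (letter x * der f).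
Proof. by move=> ->; rewrite -tin_tens !der_tin dernS. Qed.

Opaque der.

Lemma der_mul m n f f' : homog m f -> homog n f' ->
  der (f * f') = der f * f' + (-1) ^+ (~~ odd p && odd m) *: (f * der f').
Proof.
elim: m f => [|m IHm] f.
  move=> /homog0P[a ->] _; rewrite -!scalerAl !mul1r !(linearZ_LR der) der1.
  by rewrite scaler0 mul0r add0r andbF expr0 scale1r.
elim/homog_ind => [|a b ea eb|x f0 hf0] hf'.
- by rewrite !(mul0r, linear0) addr0.
- by rewrite !(mulrDl, linearD) /= ea // eb // ?scalerDr; abel.
rewrite -mulrA (der_letter _ (homogM hf0 hf')) (der_letter _ hf0) IHm //.
rewrite !mulrDl !mulrDr -!scalerAl -!scalerAr !mulrA.
by rewrite /=; case: (odd p); case: (odd m); by_signs; abel.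
Qed.

Local Notation ins := (ins p g).

(** Allowing one more letter [x] to be passed adds one rotation for each position of
    [g], the one that starts with [letter x * u]. *)
Lemma ins_rcons n q s x f u : homog n f -> homog q u ->
  ins n.+1 s (f * (letter x * u)) = ins n s (f * (letter x * u))
    + (-1) ^+ ((s && odd p) (+) ((s (+) ~~ odd p) && ~~ odd n)) *: (letter x * u * der f).
Proof.
elim: n q s f u => [|n IHn] q s f u.
  move=> /homog0P[a ->] hu; rewrite (linearZ_LR der) der1 scaler0 mulr0 scaler0 addr0.
  rewrite -scalerAl mul1r !(linearZ_LR (ins _ _)) (insM hg _ _ _ hu) !ins0 cyc0.
  by rewrite !scaler0 addr0 ?scaler0.
elim/homog_ind => [|a b ea eb|y f0 hf0] hu.
- by rewrite !(mul0r, mulr0, linear0) addr0.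
- by rewrite !(mulrDl, mulrDr, linearD) /= ea // eb // ?(mulrDr, scalerDr); abel.
have hfu := homogM hf0 (homogSM x hu).
rewrite -mulrA !(insM hg _ _ _ hfu) -!mulrA.
rewrite (IHn _ _ _ _ hf0 (homogM hu (homog_letter y))).
rewrite (cyc_rcons _ _ hf0 (homogM hu (homog_act y hg))) (der_letter _ hf0).
rewrite !mulrDr -!scalerAr !mulrA /=.
by case: (s); case: (odd p); case: (odd n); by_signs; abel.
Qed.

Lemma homog_graft n c : homog n.+1 c -> homog (n + p) (graft g c).
Proof.
apply: homog_lin1 => x f hf; rewrite (graftE hg _ hf).
exact: homogM hf (homog_act _ hg).
Qed.

Lemma homog_coinv_ins (chi : {lrmorphism H -> k^o}) m n s c :
  homog m c -> (n <= m)%N -> homog (m + p).-2 (coinv chi (ins n s c)).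
Proof.
move=> hc nm; case: n nm => [|n] nm; first by rewrite ins0 linear0; apply: homog0.
case: m hc nm => // m hc nm.
have [/eqP|mp] := posnP (m + p).
  rewrite addn_eq0 => /andP[/eqP m0 _]; move: nm; rewrite m0 ltnS leqn0 => /eqP ->.
  by rewrite insS cyc0 ins0 !scaler0 addr0 linear0; apply: homog0.
have hins : homog (m + p) (ins n.+1 s c).
  elim: n c hc nm => [|n IHn] c hc nm; rewrite insS.
    by rewrite cyc0 ins0 !scaler0 addr0; apply: homog0.
  apply: homogD; apply: homogZ; last by apply: IHn (ltnW nm); apply: homog_rot.
  by rewrite -(prednK mp); apply: homog_cyc; rewrite (prednK mp); apply: homog_graft.
by rewrite addSn /= -(prednK mp) /=; apply: homog_coinv; rewrite (prednK mp).
Qed.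

End Derivation.

#[global] Opaque der.

(** * Relations up to boundaries *)

Section Boundaries.
Variables (k : comNzRingType) (H : hopfAlgType k) (chi : {lrmorphism H -> k^o}).
Hypothesis chi_invol : modular_pair_in_involution chi.
Local Notation T := (talg H).
Local Notation e := (letter (1 : H)).
Implicit Types (a b c f u w : T) (x : H).
Local Notation coinv := (coinv chi).
Local Notation cyc := (cyc H).
Local Notation cdiff := (cdiff H).
Local Notation conB := (conB chi).
Local Notation zcyc := (zcyc chi).

(** Sums of boundaries of possibly different degrees, in order to reason without
    tracking degrees; [bnd_comp] recovers the boundaries in each degree. *)
Inductive bnd : T -> Prop :=
| bnd0 : bnd 0
| bndD a b : bnd a -> bnd b -> bnd (a + b)
| bnd_cdiff n c : homog n c -> bnd (cdiff c).

Lemma bndZ (t : k) c : bnd c -> bnd (t *: c).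
Proof.
elim=> [|a b _ ha _ hb|n d hd]; first by rewrite scaler0; apply: bnd0.
  by rewrite scalerDr; apply: bndD.
by rewrite -linearZ; apply/(@bnd_cdiff n)/homogZ.
Qed.

Lemma bndN c : bnd c -> bnd (- c).
Proof. by move=> hc; rewrite -scaleN1r; apply: bndZ. Qed.

Lemma bndB a b : bnd a -> bnd b -> bnd (a - b).
Proof. by move=> ha hb; apply: bndD => //; apply: bndN. Qed.

Lemma bnd_mulr n f c : homog n f -> cdiff f = 0 -> bnd c -> bnd (c * f).
Proof.
move=> hf df; elim=> [|a b _ ha _ hb|m d hd]; first by rewrite mul0r; apply: bnd0.
  by rewrite mulrDl; apply: bndD.
have := cdiff_mul hd hf; rewrite df mulr0 scaler0 addr0 => <-.
exact: bnd_cdiff (homogM hd hf).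
Qed.

Lemma bnd_mull n f c : homog n f -> cdiff f = 0 -> bnd c -> bnd (f * c).
Proof.
move=> hf df; elim=> [|a b _ ha _ hb|m d hd]; first by rewrite mulr0; apply: bnd0.
  by rewrite mulrDr; apply: bndD.
have := cdiff_mul hf hd; rewrite df mul0r add0r => /(congr1 ( *:%R ((-1) ^+ n))).
rewrite scalerA -expr2 sqrr_sign scale1r => <-.
exact/bndZ/(bnd_cdiff (homogM hf hd)).
Qed.

Lemma bnd_conB c : bnd c -> bnd (conB c).
Proof.
elim=> [|a b _ ha _ hb|m d hd]; first by rewrite linear0; apply: bnd0.
  by rewrite linearD; apply: bndD.
rewrite -[X in bnd X]opprK -(cdiff_conB chi_invol hd).
exact/bndN/(bnd_cdiff (homog_conB chi hd)).
Qed.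

Lemma bnd_comm m n f g : homog m f -> homog n g -> cdiff f = 0 -> cdiff g = 0 ->
  bnd (f * g - (-1) ^+ (odd m && odd n) *: (g * f)).
Proof.
move=> hf hg df dg; have := cdiff_zcyc chi_invol hf hg.
rewrite df dg mul0r mulr0 !linear0 !addr0 => <-.
apply: (@bnd_cdiff (m + n).-1).
case: m hf => [|m] hf; first by rewrite /zcyc cyc0 linear0; apply: homog0.
exact/homog_coinv/homog_cyc/(homogM hf hg).
Qed.

(** [cdiff_coinv_ins] for cocycles: [bar] reduces to the outer cofaces, whose units
    telescope as in [cdiff_zcyc]; here the extreme words are
    [f * (u * g)] and [u * der p g f]. *)
Lemma bnd_ins n q p f u g (hg : homog p g) :
    homog n f -> homog q u -> cdiff f = 0 -> cdiff u = 0 -> cdiff g = 0 ->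
  bnd (zcyc n (q + p) f (u * g) - zcyc n q f u * g
   - (-1) ^+ (odd n (+) (~~ odd n && (odd q (+) ~~ odd p))) *: (u * der p g f)).
Proof.
move=> hf hu df du dg.
have := cdiff_coinv_ins chi_invol hg dg hf hu erefl.
rewrite (bar_cdiff hf) (bar_cdiff hu) df du !subr0 negbK /zcyc.
have hug := homogM hu hg; have hfu := homogM hf hu.
set s := odd (n + q).
have E1 : coinv (ins p g n.+1 s (e * f * u)) =
    (-1) ^+ (s && odd p) *: coinv (cyc n (s (+) ~~ odd p) (f * (u * g)))
    + (-1) ^+ s *: coinv (ins p g n s (f * (u * e))).
  by rewrite -mulrA (insM hg _ _ _ hfu) linearD !linearZ_LR (act_1 hg) -!mulrA.
have E2 : coinv (ins p g n.+1 s (f * e * u)) = coinv (ins p g n s (f * (e * u)))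
    + (-1) ^+ ((s && odd p) (+) ((s (+) ~~ odd p) && ~~ odd n)) *: (u * der p g f).
  rewrite -mulrA (ins_rcons hg _ _ hf hu) linearD linearZ_LR -mulrA.
  by rewrite (coinv_e chi (homogM hu (homog_der hg hf))).
have hD : bnd (cdiff (coinv (ins p g n (~~ s) (f * u)))).
  exact: bnd_cdiff (homog_coinv_ins hg chi _ hfu (leq_addr q n)).
move: (cdiff _) hD => D hD DE.
suff -> : coinv (cyc n (~~ odd (n + (q + p))) (f * (u * g)))
  - coinv (cyc n (~~ s) (f * u)) * g
  - (-1) ^+ (odd n (+) (~~ odd n && (odd q (+) ~~ odd p))) *: (u * der p g f)
  = - ((-1) ^+ (~~ s && odd p) *: D) by apply/bndN/bndZ.
rewrite {}DE; move: E1 E2; rewrite /s !oddD.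
case: (odd n); case: (odd q); case: (odd p) => /= E1 E2; by_signs; rewrite ?E1 ?E2; by_signs; abel.
Qed.

End Boundaries.

#[global] Opaque zcyc.

(** * The Poisson and Jacobi identities up to boundaries *)

Definition bvdefect (k : comNzRingType) (A : algType k) (L : {linear A -> A})
    (s : bool) (x y : A) : A :=
  L (x * y) - L x * y - (-1) ^+ s *: (x * L y).

(** [D] measures the failure of [L] to be a derivation and [R] the failure of [D] to
    be one in its second argument.  The boolean [s] is the parity of [a], [t] that
    of [b]; every term containing [L] twice in a row vanishes by hypothesis. *)
Lemma bv_jacobi_identity (k : comNzRingType) (A : algType k) (L : {linear A -> A})
    (s t : bool) (a b c : A) :
  let D := bvdefect L in
  let R s t a b c := D s a (b * c) - D s a b * c - (-1) ^+ (~~ s && t) *: (b * D s a c) in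
  L (L a) = 0 -> L (L b) = 0 -> L (L c) = 0 ->
  L (L (a * b)) = 0 -> L (L (b * c)) = 0 -> L (L (a * c)) = 0 -> L (L (a * (b * c))) = 0 ->
  D s a (D t b c) + (-1) ^+ s *: D (~~ (s (+) t)) (D s a b) c
    - (-1) ^+ (~~ s && ~~ t) *: D t b (D s a c) =
  - ((-1) ^+ s *: L (R s t a b c)) - (-1) ^+ s *: R (~~ s) t (L a) b c
    - R s (~~ t) a (L b) c - (-1) ^+ t *: R s t a b (L c).
Proof.
move=> D R a0 b0 c0 ab0 bc0 ac0 abc0; rewrite /R /D /bvdefect.
case: s; case: t; rewrite /= ?(expr0, expr1, scale1r, scaleN1r, opprK).
all: rewrite ?(opprK, opprD, mulrDr, mulrDl, mulrN, mulNr, linearD L, linearN L) /=.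
all: rewrite ?(a0, b0, c0, ab0, bc0, ac0, abc0) ?(mul0r, mulr0, linear0 L) ?mulrA; abel.
Qed.

Section BatalinVilkovisky.
Variables (k : comNzRingType) (H : hopfAlgType k) (chi : {lrmorphism H -> k^o}).
Hypothesis chi_invol : modular_pair_in_involution chi.
Local Notation T := (talg H).
Implicit Types (a b c f g u w : T).
Local Notation cdiff := (cdiff H).
Local Notation conB := (conB chi).
Local Notation zcyc := (zcyc chi).

Definition cocyc n f := homog n f /\ cdiff f = 0.

Lemma cocycM m n f g : cocyc m f -> cocyc n g -> cocyc (m + n) (f * g).
Proof.
move=> [hf df] [hg dg]; split; first exact: homogM.
by rewrite (cdiff_mul hf hg) df dg mul0r mulr0 scaler0 addr0.
Qed.

Lemma cocyc1 : cocyc 0 (1 : T).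
Proof. by split; [apply: homog1 | apply: cdiff1]. Qed.

Lemma cocyc_conB n f : cocyc n f -> cocyc n.-1 (conB f).
Proof.
move=> [hf df]; split; first exact: homog_conB.
by rewrite (cdiff_conB chi_invol hf) df linear0 oppr0.
Qed.

(** The circle product of [f] with [g], with the sign for which [bnd_pbr2] holds. *)
Definition pbr n p f g : T := (-1) ^+ (odd n (+) (~~ odd n && ~~ odd p)) *: der p g f.

Lemma pbr_mul m n p f g h : homog p h -> homog m f -> homog n g ->
  pbr (m + n) p (f * g) h =
    (-1) ^+ (odd n && odd p) *: (pbr m p f h * g) + (-1) ^+ odd m *: (f * pbr n p g h).
Proof.
move=> hh hf hg; rewrite /pbr (der_mul hh hf hg) oddD.
by case: (odd m); case: (odd n); case: (odd p) => /=; by_signs; abel.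
Qed.

Lemma bnd_pbr2 n q p f u g : cocyc n f -> cocyc q u -> cocyc p g ->
  bnd (zcyc n (q + p) f (u * g) - zcyc n q f u * g
    - (-1) ^+ (~~ odd n && odd q) *: (u * pbr n p f g)).
Proof.
move=> [hf df] [hu du] [hg dg].
have := bnd_ins chi_invol hg hf hu df du dg; rewrite /pbr.
congr bnd; congr (_ - _).
by case: (odd n); case: (odd q); case: (odd p) => /=; by_signs; abel.
Qed.

Lemma bnd_pbr1 n p f g : cocyc n f -> cocyc p g ->
  bnd (zcyc n p f g - conB f * g - pbr n p f g).
Proof.
move=> cf cg; have := bnd_pbr2 cf cocyc1 cg.
by rewrite -(conB_zcyc chi_invol cf.1) andbF !mul1r scale1r.
Qed.

Definition bvdev m f g : T := bvdefect conB (odd m) f g.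

(** Half cyclic sums compute [B (f * g)], and [bnd_pbr1] evaluates both of them; the
    term [B g * f] is commuted to [f * B g]. *)
Lemma bnd_bvdev m n f g : cocyc m f -> cocyc n g ->
  bnd (bvdev m f g - pbr m n f g - (-1) ^+ (odd m && odd n) *: pbr n m g f).
Proof.
move=> cf cg.
have b1 := bnd_pbr1 cf cg.
have b2 := bndZ ((-1) ^+ (odd m && odd n)) (bnd_pbr1 cg cf).
have b3 : bnd (f * conB g - (-1) ^+ (odd m && ~~ odd n) *: (conB g * f)).
  case: n cg {b1 b2} => [|n] cg.
    by rewrite (conB0 chi cg.1) mulr0 mul0r scaler0 subr0; apply: bnd0.
  have [hB dB] := cocyc_conB cg; rewrite /= negbK.
  by have := bnd_comm chi_invol cf.1 hB cf.2 dB.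
have := bndD (bndD b1 b2) (bndZ (- (-1) ^+ odd m) b3).
congr bnd; rewrite /bvdev /bvdefect (conB_mul chi_invol cf.1 cg.1).
by case: (odd m); case: (odd n) => /=; rewrite ?(expr0, expr1, opprK); by_signs; abel.
Qed.

(** In the form [bnd_bvdev] the first summand satisfies the identity by the homotopy
    with general [u] in [bnd_pbr2], the second one because [der] is a derivation. *)
Lemma bnd_poisson m n l a b c : cocyc m a -> cocyc n b -> cocyc l c ->
  bnd (bvdev m a (b * c) - bvdev m a b * c
    - (-1) ^+ (~~ odd m && odd n) *: (b * bvdev m a c)).
Proof.
move=> ca cb cc; have cbc := cocycM cb cc.
have r1 := bnd_bvdev ca cbc.
have r2 := bnd_mulr cc.1 cc.2 (bnd_bvdev ca cb).
have r3 := bndZ ((-1) ^+ (~~ odd m && odd n)) (bnd_mull cb.1 cb.2 (bnd_bvdev ca cc)).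
have r4 := bnd_pbr1 ca cbc.
have r5 := bnd_pbr2 ca cb cc.
have r6 := bnd_mulr cc.1 cc.2 (bnd_pbr1 ca cb).
have := bndB (bndB r1 r2) (bndD r3 (bndB r4 (bndD r5 r6))).
congr bnd; rewrite (pbr_mul ca.1 cb.1 cc.1) oddD.
move: (bvdev m a (b * c)) (bvdev m a b) (bvdev m a c) => p1 p2 p3.
move: (pbr m _ _ _) (pbr m _ _ _) (pbr m _ _ _) (pbr n _ _ _) (pbr l _ _ _).
move=> q1 q2 q3 q4 q5.
move: (zcyc _ _ _ _) (zcyc _ _ _ _) => z1 z2.
by case: (odd m); case: (odd n); case: (odd l) => /=; by_signs; rewrite ?mulrA; abel.
Qed.

Lemma bnd_bvdevC m n f g : cocyc m f -> cocyc n g ->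
  bnd (bvdev m f g - (-1) ^+ (odd m && odd n) *: bvdev n g f).
Proof.
move=> cf cg.
have := bndB (bnd_bvdev cf cg) (bndZ ((-1) ^+ (odd m && odd n)) (bnd_bvdev cg cf)).
congr bnd; move: (bvdev _ _ _) (bvdev _ _ _) (pbr _ _ _ _) (pbr _ _ _ _).
by case: (odd m); case: (odd n) => /= *; by_signs; abel.
Qed.

Lemma cocyc_conB_odd n f : cocyc n f ->
  exists2 d, odd d = ~~ odd n & cocyc d (conB f).
Proof.
case: n => [|n] cf; last by exists n; [rewrite /= negbK | apply: cocyc_conB cf].
exists 1 => //; rewrite (conB0 chi cf.1); split; [exact: homog0 | exact: linear0].
Qed.

Lemma bnd_jacobi m n l a b c : cocyc m a -> cocyc n b -> cocyc l c ->
    conB (conB a) = 0 -> conB (conB b) = 0 -> conB (conB c) = 0 ->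
    conB (conB (a * b)) = 0 -> conB (conB (b * c)) = 0 -> conB (conB (a * c)) = 0 ->
    conB (conB (a * (b * c))) = 0 ->
  bnd (bvdev m a (bvdev n b c)
    + (-1) ^+ odd m *: bvdev (m + n).+1 (bvdev m a b) c
    - (-1) ^+ (~~ odd m && ~~ odd n) *: bvdev n b (bvdev m a c)).
Proof.
move=> ca cb cc a0 b0 c0 ab0 bc0 ac0 abc0.
have [m' om' cBa] := cocyc_conB_odd ca; have [n' on' cBb] := cocyc_conB_odd cb.
have [l' _ cBc] := cocyc_conB_odd cc.
rewrite /bvdev oddS oddD bv_jacobi_identity //.
apply: bndB; [apply: bndB; [apply: bndB; [apply: bndN |] |] |].
- exact/bndZ/(bnd_conB chi_invol)/(bnd_poisson ca cb cc).
- by rewrite -om'; apply/bndZ/(bnd_poisson cBa cb cc).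
- by rewrite -on'; apply/(bnd_poisson ca cBb cc).
- exact/bndZ/(bnd_poisson ca cb cBc).
Qed.

End BatalinVilkovisky.

(** * Normalized cochains *)

Section Normalization.
Variables (k : comNzRingType) (H : hopfAlgType k).
Local Notation T := (talg H).
Local Notation eps := (counit H).
Local Notation e := (letter (1 : H)).
Local Notation cdiff := (cdiff H).
Implicit Types (a b c f u w : T) (x : H).

Lemma augproj_linear : linear (fun x : H => x - (eps x : k) *: (1 : H)).
Proof.
move=> a x y; rewrite linearP scalerDl [a *: eps x]/(a * eps x) -scalerA.
by rewrite scalerBr; abel.
Qed.
Definition augproj : {linear H -> H} := mk_linear augproj_linear.

Lemma augprojE x : augproj x = x - (eps x : k) *: 1. Proof. by []. Qed.
Opaque augproj.

Lemma counit_augproj x : eps (augproj x) = 0.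
Proof. by rewrite augprojE linearB linearZ rmorph1 /= [_ *: 1]mulr1 subrr. Qed.

Lemma augproj1 : augproj 1 = 0.
Proof. by rewrite augprojE rmorph1 scale1r subrr. Qed.

Lemma letter_augproj x : letter (augproj x) = letter x - (eps x : k) *: e.
Proof. by rewrite augprojE linearB linearZ. Qed.

(** The tensor power of the projection of [H] onto the kernel of the counit. *)
Fixpoint nprojn n : {linear tpow H n -> tpow H n} :=
  match n with 0 => idfun | n'.+1 => tmap augproj (nprojn n') end.

Definition nproj : {linear T -> T} := degreewise nprojn.

Lemma nproj_tin n (f : tpow H n) : nproj (tin H n f) = tin H n (nprojn n f).
Proof. by apply: degreewiseE. Qed.

Lemma homog_nproj n c : homog n c -> homog n (nproj c).
Proof. by apply: homog_degreewise. Qed.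

Lemma nproj_letter n x c : homog n c ->
  nproj (letter x * c) = letter (augproj x) * nproj c.
Proof.
move=> ->; rewrite -tin_tens !nproj_tin -tin_tens; congr (tin H _ _).
exact: tmapE.
Qed.

Lemma nproj1 : nproj 1 = 1.
Proof. by rewrite [1]/(tin H 0 (1 : k^o)) nproj_tin. Qed.

Opaque nproj.

Lemma nproj_homog0 c : homog 0 c -> nproj c = c.
Proof. by move=> /homog0P[a ->]; rewrite linearZ_LR nproj1. Qed.

Lemma nproj_mul m n f g : homog m f -> homog n g ->
  nproj (f * g) = nproj f * nproj g.
Proof.
elim: m f => [|m IHm] f.
  by move=> /homog0P[a ->] _; rewrite -scalerAl mul1r !(linearZ_LR nproj) nproj1 -scalerAl mul1r.
elim/homog_ind => [|a b ea eb|x f0 hf0] hg.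
- by rewrite mul0r !linear0 mul0r.
- by rewrite mulrDl !linearD mulrDl ea // eb.
by rewrite -mulrA (nproj_letter _ (homogM hf0 hg)) (nproj_letter _ hf0) IHm ?mulrA.
Qed.

Lemma nprojK n c : homog n c -> nproj (nproj c) = nproj c.
Proof.
elim: n c => [|n IHn] c; first by move=> hc; rewrite !(nproj_homog0 hc).
elim/homog_ind => [|a b ea eb|x f hf]; first by rewrite !linear0.
  by rewrite !linearD ea eb.
rewrite (nproj_letter _ hf) (nproj_letter _ (homog_nproj hf)) IHn //.
by congr (letter _ * _); rewrite [LHS]augprojE counit_augproj scale0r subr0.
Qed.

Lemma cdiff_letter x : cdiff (letter x) =
  e * letter x + letter x * e - \sum_(p <- sw x) letter p.1 * letter p.2.
Proof.
rewrite (cdiffE (homog_letter x)) expr1 scaleN1r opprK; congr (_ - _).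
rewrite -[letter x]mulr1 (bar_letter _ (homog1 H)) bar1 mulr0 subr0.
by apply: eq_bigr => p _; rewrite mulr1.
Qed.

Lemma sw_augproj x : \sum_(p <- sw x) letter (augproj p.1) * letter (augproj p.2) =
  \sum_(p <- sw x) letter p.1 * letter p.2 - e * letter x - letter x * e
  + (eps x : k) *: (e * e).
Proof.
rewrite -[in e * letter x](sw_counitl (L := fun y => y) _ x) //.
rewrite -[in letter x * e](sw_counitr (L := fun y => y) _ x) //.
rewrite -[eps x](sw_counitl (L := fun y => eps y) _ x); last exact: linearP.
rewrite !linear_sum mulr_sumr mulr_suml scaler_suml -!sumrB -big_split.
apply: eq_bigr => p _ /=; rewrite !letter_augproj !(linearZ_LR letter).
rewrite [eps p.1 *: eps p.2]/(eps p.1 * eps p.2).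
rewrite mulrBl !mulrBr -!scalerAl -!scalerAr !scalerA.
abel.
Qed.

Lemma cdiff_augproj x : cdiff (letter (augproj x)) =
  - \sum_(p <- sw x) letter (augproj p.1) * letter (augproj p.2).
Proof.
rewrite sw_augproj letter_augproj linearB linearZ_LR !cdiff_letter.
rewrite (sw1 (F := fun x y => letter x * letter y)); last by lin.
by rewrite addrK !opprD !opprK; abel.
Qed.

Lemma cdiff_lettermul n x c : homog n c ->
  cdiff (letter x * c) = cdiff (letter x) * c - letter x * cdiff c.
Proof.
by move=> hc; rewrite (cdiff_mul (homog_letter x) hc) expr1 scaleN1r.
Qed.

Lemma cdiff_nproj n c : homog n c -> cdiff (nproj c) = nproj (cdiff c).
Proof.
elim: n c => [|n IHn] c.
  move=> /homog0P[a ->]; rewrite (nproj_homog0 (homogZ a (homog1 H))).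
  by rewrite linearZ_LR cdiff1 scaler0 linear0.
elim/homog_ind => [|a b ea eb|x f hf]; first by rewrite !linear0.
  by rewrite !linearD ea eb.
rewrite (nproj_letter _ hf) (cdiff_lettermul _ (homog_nproj hf)) IHn //.
rewrite (cdiff_lettermul _ hf) (linearB nproj) (nproj_letter _ (homog_cdiff hf)).
congr (_ - _); rewrite (nproj_mul (homog_cdiff (homog_letter x)) hf); congr (_ * _).
have nl y : nproj (letter y) = letter (augproj y).
  by rewrite -[letter y]mulr1 (nproj_letter _ (homog1 H)) nproj1 mulr1.
have nll y z : nproj (letter y * letter z) = letter (augproj y) * letter (augproj z).
  by rewrite (nproj_letter _ (homog_letter z)) nl.
rewrite (cdiff_letter x) (linearB nproj) (linearD nproj) !nll.
rewrite augproj1 linear0 mul0r mulr0 add0r sub0r.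
by rewrite linear_sum cdiff_augproj; congr (- _); apply: eq_bigr => p _; rewrite nll.
Qed.

(** Homotopy [h] from the identity to [nproj]:
    [h (letter x * c) = eps x * c - letter (x - eps x) * h c]. *)
Lemma bilin_nhtp n (L : {linear tpow H n -> T}) :
  bilin (fun x (f : tpow H n) => (eps x : k) *: tin H n f - letter (augproj x) * L f).
Proof.
split=> [a x x' f|a x f f'].
  rewrite (linearP eps) (linearP augproj) (linearP letter).
  rewrite scalerDl [a *: eps x]/(a * eps x) -scalerA mulrDl -scalerAl.
  by rewrite scalerBr; abel.
by rewrite (linearP (tin H n)) (linearP L) mulrDr -scalerAr scalerDr scalerBr !scalerA mulrC; abel.
Qed.

Fixpoint nhtpn n : {linear tpow H n -> T} :=
  match n with 0 => \0 | n'.+1 => tlin (bilin_nhtp (nhtpn n')) end.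

Lemma nhtpnS n x (f : tpow H n) : nhtpn n.+1 (x ⊗t f) =
  (eps x : k) *: tin H n f - letter (augproj x) * nhtpn n f.
Proof. exact: tlinE. Qed.

Lemma homog_nhtpn n (f : tpow H n) : homog n.-1 (nhtpn n f).
Proof.
elim: n f => [|n IHn] f; first exact: homog0.
elim/tens_ind: f => [|f f' hf hf'|x f]; first by rewrite linear0; apply: homog0.
  by rewrite linearD; apply: homogD.
rewrite nhtpnS; apply: homogD; first exact/homogZ/homog_in.
apply: homogN; case: n IHn f => [|n] IHn f; first by rewrite mulr0; apply: homog0.
exact: homogSM.
Qed.

Definition nhtp : {linear T -> T} := glue nhtpn.

Lemma nhtp_tin n (f : tpow H n) : nhtp (tin H n f) = nhtpn n f.
Proof. by apply: (glue_in (homog_nhtpn f)); case: n f. Qed.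

Lemma homog_nhtp n c : homog n c -> homog n.-1 (nhtp c).
Proof. by move=> ->; rewrite nhtp_tin; apply: homog_nhtpn. Qed.

Lemma nhtp_letter n x c : homog n c ->
  nhtp (letter x * c) = (eps x : k) *: c - letter (augproj x) * nhtp c.
Proof. by move=> ->; rewrite -tin_tens !nhtp_tin nhtpnS. Qed.

Lemma nhtp_homog0 c : homog 0 c -> nhtp c = 0.
Proof. by move=> ->; rewrite nhtp_tin. Qed.

Opaque nhtp.

Lemma nhtp_homotopy n c : homog n c -> cdiff (nhtp c) + nhtp (cdiff c) = c - nproj c.
Proof.
elim: n c => [|n IHn] c.
  move=> hc; rewrite (nhtp_homog0 hc) (nproj_homog0 hc) subrr linear0 add0r.
  by have [a ->] := homog0P hc; rewrite linearZ_LR cdiff1 scaler0 linear0.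
elim/homog_ind => [|a b ea eb|x c0 hc]; first by rewrite !linear0 ?(subrr, addr0).
  by rewrite !linearD /= addrACA ea eb ?opprD addrACA.
have hh := homog_nhtp hc.
rewrite (nhtp_letter _ hc) (linearB cdiff) (linearZ_LR cdiff) (cdiff_mul (homog_letter _) hh).
rewrite expr1 scaleN1r (cdiff_lettermul _ hc) (linearB nhtp) (nhtp_letter _ (homog_cdiff hc)).
rewrite (nproj_letter _ hc).
have E1 : nhtp (cdiff (letter x) * c0) = (eps x : k) *: (e * c0)
    - \sum_(p <- sw x) letter (augproj p.1) * letter (augproj p.2) * nhtp c0.
  rewrite cdiff_letter mulrBl mulrDl (linearB nhtp) (linearD nhtp) -!mulrA.
  rewrite mulr_suml (linear_sum nhtp).
  rewrite (nhtp_letter _ (homogSM _ hc)) (nhtp_letter _ (homogSM _ hc)) (nhtp_letter _ hc).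
  rewrite rmorph1 augproj1 !linear0 !mul0r !subr0 !scale1r.
  have -> : \sum_(p <- sw x) nhtp (letter p.1 * letter p.2 * c0) =
     letter x * c0 - letter (augproj x) * c0
     + \sum_(p <- sw x) letter (augproj p.1) * letter (augproj p.2) * nhtp c0.
    rewrite -[in letter x * c0](sw_counitl (L := fun y => y) _ x) //.
    rewrite -[in letter (augproj x) * c0](sw_counitr (L := fun y => y) _ x) //.
    rewrite !linear_sum !mulr_suml -sumrB -big_split; apply: eq_bigr => p _ /=.
    rewrite -mulrA (nhtp_letter _ (homogSM _ hc)) (nhtp_letter _ hc) !linearZ_LR.
    by rewrite mulrBr -!scalerAl -!scalerAr !mulrA; abel.
  rewrite (nhtp_letter 1 hc) rmorph1 scale1r augproj1 linear0 mul0r subr0; abel.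
rewrite E1 cdiff_augproj mulNr mulr_suml.
have := congr1 ( *%R (letter (augproj x))) (IHn _ hc); rewrite mulrDr mulrBr => E2.
rewrite [letter x](_ : _ = letter (augproj x) + (eps x : k) *: e); last first.
  by rewrite letter_augproj subrK.
rewrite mulrDl -scalerAl; apply/eqP; rewrite -subr_eq0; apply/eqP.
transitivity (letter (augproj x) * cdiff (nhtp c0) + letter (augproj x) * nhtp (cdiff c0)
  - (letter (augproj x) * c0 - letter (augproj x) * nproj c0)); first by abel.
by rewrite E2 subrr.
Qed.

End Normalization.

#[global] Opaque augproj nproj nhtp.

(** * The Connes coboundary on normalized cochains *)

Section NormalizedConnes.
Variables (k : comNzRingType) (H : hopfAlgType k) (chi : {lrmorphism H -> k^o}).
Hypothesis chi_invol : modular_pair_in_involution chi.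
Local Notation T := (talg H).
Local Notation e := (letter (1 : H)).
Local Notation cod := (cod H).
Local Notation nproj := (nproj H).
Local Notation rotate := (rotate H).
Local Notation cyc := (cyc H).
Local Notation coinv := (coinv chi).
Local Notation tau := (tau chi).
Local Notation conB := (conB chi).
Implicit Types (a b c f u w : T) (x : H).

Lemma nproj_rot n c : homog n.+1 c -> nproj (rotate c) = rotate (nproj c).
Proof.
elim/homog_ind => [|a b ea eb|x f hf]; first by rewrite !linear0.
  by rewrite !linearD ea eb.
rewrite (rotE _ hf) (nproj_letter _ hf) (rotE _ (homog_nproj hf)).
rewrite (nproj_mul hf (homog_letter x)); congr (_ * _).
by rewrite -[letter x]mulr1 (nproj_letter _ (homog1 H)) nproj1 mulr1.
Qed.

Lemma nproj_cyc m n s c : homog m.+1 c -> nproj (cyc n s c) = cyc n s (nproj c).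
Proof.
elim: n c => [|n IHn] c hc; first by rewrite !cyc0 linear0.
by rewrite !cycS linearD linearZ_LR /= IHn ?(nproj_rot hc) //; apply: homog_rot.
Qed.

Lemma cod_nproj j n c : homog n c -> cod j (nproj c) = 0.
Proof.
elim: n c j => [|n IHn] c j.
  move=> hc; rewrite (nproj_homog0 hc); have [a ->] := homog0P hc.
  by rewrite linearZ_LR cod1 scaler0.
elim/homog_ind => [|a b ea eb|x f hf]; first by rewrite !linear0.
  by rewrite !linearD /= ea eb addr0.
rewrite (nproj_letter _ hf); case: j => [|j].
  by rewrite (cod0_letter _ (homog_nproj hf)) counit_augproj scale0r.
by rewrite (codS_letter _ _ (homog_nproj hf)) IHn // mulr0.
Qed.

Lemma bilin_mull (A : {linear T -> T}) : bilin (fun x c => letter x * A c).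
Proof. by split=> *; rewrite linearP ?mulrDl ?mulrDr -?scalerAl -?scalerAr. Qed.

(** Expanding the product of the factors [id - unit o counit]: every term but the
    first contains a codegeneracy, so [nproj] fixes normalized cochains. *)
Lemma nproj_cod n : exists A : nat -> {linear T -> T},
  (forall m j d, homog m d -> homog m.+1 (A j d)) /\
  forall c, homog n c -> nproj c = c - \sum_(j < n) A j (cod j c).
Proof.
elim: n => [|n [A [hA EA]]].
  exists (fun _ => \0); split=> [m j d hd|c hc]; first exact: homog0.
  by rewrite (nproj_homog0 hc) big_ord0 subr0.
have en_linear : linear (fun d => e * nproj d).
  by move=> t a b; rewrite linearP mulrDr -scalerAr.
exists (fun j => if j is j'.+1 then uncons (bilin_mull (A j')) else mk_linear en_linear).
have hF j m x c : homog m c -> homog (m + 2) (letter x * A j c).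
  by move=> hc; rewrite addn2; apply/homogSM/hA.
split=> [m [|j] d hd|c]; first exact/homogSM/homog_nproj.
  case: m d hd => [|m] d hd; first by rewrite uncons0 //; apply: homog0.
  move: d hd; apply: homog_lin1 => x f hf.
  by rewrite (@unconsE _ _ _ (bilin_mull (A j)) 2 m x f (hF j) hf) -addn2; apply: hF.
elim/homog_ind => [|a b ea eb|x f hf].
- by rewrite !linear0 big1 ?subr0 // => j _; rewrite !linear0.
- rewrite linearD ea eb addrACA -opprD -big_split; congr (_ - _).
  by apply: eq_bigr => j _; rewrite !linearD.
rewrite (nproj_letter _ hf) letter_augproj mulrBl big_ord_recl /= opprD addrA addrAC.
rewrite {1}(EA _ hf) mulrBr mulr_sumr; congr (_ - _ - _); last first.
  by rewrite (cod0_letter _ hf) linearZ_LR -scalerAl -scalerAr.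
apply: eq_bigr => j _; rewrite (codS_letter _ _ hf).
case: n j hf {EA hF} => [[]|n] // j hf.
rewrite (@unconsE _ _ _ (bilin_mull (A j)) 2 n) //; last exact: homog_cod.
by move=> m y d hd; rewrite addn2; apply/homogSM/hA.
Qed.

Lemma nproj_id n c : homog n c -> (forall j, (j < n)%N -> cod j c = 0) -> nproj c = c.
Proof.
move=> hc cod0; have [A [_ ->]] := nproj_cod n => //.
by rewrite big1 ?subr0 // => j _; rewrite cod0 // linear0.
Qed.

Lemma nproj_conB n c : homog n c -> nproj c = c -> nproj (conB c) = conB c.
Proof.
case: n => [|n] hc nc; first by rewrite (conB0 chi hc) linear0.
apply: nproj_id (homog_conB chi hc) _ => j _.
rewrite (conBE chi_invol hc) (cod_coinv _ _ (homog_cyc _ _ hc)).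
rewrite -[in cyc _ _ c]nc -(nproj_cyc _ _ hc).
by rewrite (cod_nproj _ (homog_cyc _ _ hc)) linear0.
Qed.

(** By [tau_coinv], [conB c] is determined by [coinv c]. *)
Lemma conB_coinv0 n c : homog n.+1 c -> coinv c = 0 -> conB c = 0.
Proof.
move=> hc c0; rewrite (conBE chi_invol hc) cyc_sum linear_sum big1 // => i _.
rewrite linearZ_LR; case: n hc i => [|n] hc i.
  by case: i => [[]] //= _; rewrite c0 scaler0.
have it0 m : iter m tau 0 = 0 by elim: m => //= m ->; rewrite linear0.
by rewrite -(iter_tau_coinv chi_invol i hc) c0 it0 scaler0.
Qed.

(** By [conB_coinv0] it suffices that [coinv (conB c)] vanishes, and by [coinv_coinv]
    this contains a codegeneracy of a rotated normalized cochain. *)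
Lemma conB_conB n c : homog n c -> nproj c = c -> conB (conB c) = 0.
Proof.
case: n => [|[|n]] hc nc; first by rewrite (conB0 chi hc) linear0.
  by apply/conB0/(homog_conB chi hc).
apply: (@conB_coinv0 n); first exact: (homog_conB chi hc).
rewrite (conBE chi_invol hc) (coinv_coinv chi (homog_cyc _ _ hc)).
rewrite -[in cyc _ _ c]nc -(nproj_cyc _ _ hc).
by rewrite (cod_nproj _ (homog_cyc _ _ hc)) linear0.
Qed.

End NormalizedConnes.

(** * Maps induced on subquotients *)

Local Open Scope quotient_scope.

Section Subquotients.
Variables (k : comNzRingType) (M : lmodType k) (Z B : submodule M).
Implicit Types (x y : subquot Z B) (a b : M).

Lemma is_class_in x a : is_class x a -> Z a.
Proof. by case=> z <- _; exact/asboolP/(valP z). Qed.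

Lemma is_class_ex x : exists a, is_class x a.
Proof. by elim/quotW: x => z; exists (val z), z. Qed.

Lemma is_class_exists a : Z a -> exists x, is_class x a.
Proof.
move=> Za; have aZ : a \in smem Z by apply/asboolP.
by exists (\pi_(quotmod (submod_pull Z B)) (exist _ a aZ)), (exist _ a aZ).
Qed.

Lemma is_classP (t : k) x y a b :
  is_class x a -> is_class y b -> is_class (t *: x + y) (t *: a + b).
Proof.
move=> [z <- ->] [w <- ->]; exists (t *: z + w) => //.
rewrite -quotmod_piD; congr (_ + _); exact: quotmod_scaleE.
Qed.

Lemma is_class_eq x y a b : is_class x a -> is_class y b -> B (a - b) -> x = y.
Proof.
move=> [z <- ->] [w <- ->] Bzw; apply/eqP; rewrite -Quotient.idealrBE.
by apply/asboolP; rewrite /= /submod_pull.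
Qed.

Lemma is_class_diff x a b : is_class x a -> is_class x b -> B (a - b).
Proof.
move=> [z <- xz] [w <- xw]; move: (etrans (esym xz) xw) => /eqP.
by rewrite -Quotient.idealrBE => /asboolP.
Qed.

End Subquotients.

Section InducedMaps.
Variable k : comNzRingType.

Section Unary.
Variables (M N : lmodType k) (Z B : submodule M) (Z' B' : submodule N).
Variable f : {linear M -> N}.
Hypotheses (fZ : forall a, Z a -> Z' (f a)) (fB : forall a, Z a -> B a -> B' (f a)).

Lemma qmap_ex (x : subquot Z B) :
  exists y : subquot Z' B', forall a, is_class x a -> is_class y (f a).
Proof.
have [a xa] := is_class_ex x.
have [y ya] := is_class_exists B' (fZ (is_class_in xa)).
exists y => b xb; have [y' yb] := is_class_exists B' (fZ (is_class_in xb)).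
suff -> : y = y' by [].
apply: (is_class_eq ya yb); rewrite -linearB; apply: fB (is_class_diff xa xb).
have := in_submodP (-1) (is_class_in xb) (is_class_in xa).
by rewrite scaleN1r addrC.
Qed.

(** By choice of the class, which [qmap_ex] shows to be the same for all
    representatives. *)
Definition qmap_fun x := sval (cid (qmap_ex x)).

Lemma qmap_funE x a : is_class x a -> is_class (qmap_fun x) (f a).
Proof. exact: (svalP (cid (qmap_ex x))). Qed.

Lemma qmap_linear : linear qmap_fun.
Proof.
move=> t x y; have [a xa] := is_class_ex x; have [b yb] := is_class_ex y.
apply: (is_class_eq (qmap_funE (is_classP t xa yb))
  (is_classP t (qmap_funE xa) (qmap_funE yb))).
by rewrite linearP subrr; apply: in_submod0.
Qed.

Definition qmap : {linear subquot Z B -> subquot Z' B'} := mk_linear qmap_linear.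

Lemma qmapE x a : is_class x a -> is_class (qmap x) (f a).
Proof. exact: qmap_funE. Qed.

End Unary.

Section Binary.
Variables (M N P : lmodType k) (Z B : submodule M) (Z' B' : submodule N).
Variables (Z'' B'' : submodule P) (f : M -> N -> P).
Hypotheses (bf : bilin f) (fZ : forall a b, Z a -> Z' b -> Z'' (f a b)).
Hypothesis fBl : forall a b, Z a -> B a -> Z' b -> B'' (f a b).
Hypothesis fBr : forall a b, Z a -> Z' b -> B' b -> B'' (f a b).

Lemma in_submodB (V : lmodType k) (W : submodule V) a b : W a -> W b -> W (a - b).
Proof. by move=> Wa Wb; have := in_submodP (-1) Wb Wa; rewrite scaleN1r addrC. Qed.

Lemma qmap2_ex (x : subquot Z B) (y : subquot Z' B') :
  exists z : subquot Z'' B'', forall a b, is_class x a -> is_class y b -> is_class z (f a b).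
Proof.
have [a xa] := is_class_ex x; have [b yb] := is_class_ex y.
have [z za] := is_class_exists B'' (fZ (is_class_in xa) (is_class_in yb)).
exists z => a' b' xa' yb'.
have [z' za'] := is_class_exists B'' (fZ (is_class_in xa') (is_class_in yb')).
suff -> : z = z' by [].
apply: (is_class_eq za za').
have [Za Zb] := (is_class_in xa, is_class_in yb).
have [Za' Zb'] := (is_class_in xa', is_class_in yb').
have -> : f a b - f a' b' = 1 *: f (a - a') b + f a' (b - b').
  rewrite scale1r (bilinDl bf) (bilinDr bf) -[- a']scaleN1r -[- b']scaleN1r.
  by rewrite (bilinZl bf) (bilinZr bf) !scaleN1r; abel.
apply: in_submodP.
  by apply: fBl Zb; [apply: in_submodB | apply: is_class_diff xa xa'].
by apply: (fBr Za'); [apply: in_submodB | apply: is_class_diff yb yb'].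
Qed.

Definition qmap2_fun x y := sval (cid (qmap2_ex x y)).

Lemma qmap2_funE x y a b :
  is_class x a -> is_class y b -> is_class (qmap2_fun x y) (f a b).
Proof. exact: (svalP (cid (qmap2_ex x y))). Qed.

Lemma qmap2_bilinear : bilinear_for *:%R *:%R qmap2_fun.
Proof.
split=> [y t x x'|x t y y'].
  have [a xa] := is_class_ex x; have [a' xa'] := is_class_ex x'.
  have [b yb] := is_class_ex y.
  apply: (is_class_eq (qmap2_funE (is_classP t xa xa') yb)
    (is_classP t (qmap2_funE xa yb) (qmap2_funE xa' yb))).
  by rewrite bf.1 subrr; apply: in_submod0.
have [a xa] := is_class_ex x; have [b yb] := is_class_ex y.
have [b' yb'] := is_class_ex y'.
apply: (is_class_eq (qmap2_funE xa (is_classP t yb yb'))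
  (is_classP t (qmap2_funE xa yb) (qmap2_funE xa yb'))).
by rewrite bf.2 subrr; apply: in_submod0.
Qed.

Definition qmap2 : {bilinear subquot Z B -> subquot Z' B' -> subquot Z'' B''} :=
  mk_bilinear qmap2_bilinear.

Lemma qmap2E x y a b : is_class x a -> is_class y b -> is_class (qmap2 x y) (f a b).
Proof. exact: qmap2_funE. Qed.

End Binary.
End InducedMaps.

#[global] Opaque qmap qmap2.

(** * The cobar complex inside the algebra of cochains *)

Section Embedding.
Variables (k : comNzRingType) (H : hopfAlgType k) (chi : {lrmorphism H -> k^o}).
Local Notation T := (talg H).
Local Notation cdiff := (cdiff H).
Local Notation nproj := (nproj H).
Local Notation conB := (conB chi).

Lemma tin_tcat m n (f : tpow H m) (g : tpow H n) :
  tin H (m + n) (tcat f g) = tin H m f * tin H n g.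
Proof.
elim: m f => [|m IHm] f.
  rewrite [tcat f g](_ : _ = (f : k) *: g); last exact: tunitlE.
  by rewrite linearZ [tin H 0 f](tin0 H (f : k)) -scalerAl mul1r.
have tcatE (h : tpow H m.+1) :
    tcat h g = tmap idfun (tcat_map H m n) (tassoc (h ⊗t g)) by [].
elim/tens_ind: f => [|a b ea eb|x f].
- by rewrite tcatE linear0l !linear0 mul0r.
- by rewrite tcatE linearDl !linearD mulrDl -ea -eb !tcatE.
by rewrite tcatE tassocE tmapE !tin_tens -/(tcat f g) IHm mulrA.
Qed.

(** The embedding of the cobar complex, in integral degrees, that removes all casts
    between degrees. *)
Definition cin_fun (i : int) : cobar H i -> T :=
  match i with Posz n => tin H n | Negz _ => fun=> 0 end.
Lemma cin_linear i : linear (@cin_fun i).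
Proof. by case: i => n a x y /=; [apply: linearP | rewrite scaler0 addr0]. Qed.
Definition cin i : {linear cobar H i -> T} := mk_linear (@cin_linear i).

Lemma cinP n (x : cobar H (Posz n)) : cin (Posz n) x = tin H n x. Proof. by []. Qed.
Lemma cinN n (x : cobar H (Negz n)) : cin (Negz n) x = 0. Proof. by []. Qed.

Lemma cin_inj i : injective (cin i).
Proof.
case: i => n x y; first exact: tin_inj.
by move=> _; rewrite [x]thinmx0 [y]thinmx0.
Qed.

Lemma cin_gcast i j (e : i = j) x : cin j (gcast e x) = cin i x.
Proof. by case: j / e. Qed.

Lemma cin_d i x : cin (i + 1) (cobar_d x) = cdiff (cin i x).
Proof.
case: i x => n x; last by rewrite cinN !linear0.
rewrite (_ : cobar_d x = gcast (G := cobar H) (posz_succ n) (cobar_diff x)) //.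
by rewrite cin_gcast !cinP cdiff_tin.
Qed.

Lemma cin_B i x : cin (i - 1) (cobarB chi x) = conB (cin i x).
Proof.
case: i x => [[|n]|n] x; last by rewrite cinN !linear0.
  by rewrite (conB0 chi (homog_in x)) linear0.
rewrite (_ : cobarB chi x = gcast (G := cobar H) (posz_pred n) (connesB chi x)) //.
by rewrite cin_gcast !cinP conB_tin.
Qed.

Lemma cin_cup i j x y : cin (i + j) (cobar_cup x y) = cin i x * cin j y.
Proof.
case: i x => m x; case: j y => n y; rewrite ?cinN ?mul0r ?mulr0.
- exact: tin_tcat.
- exact: (linear0 (cin _)).
- exact: (linear0 (cin _)).
- by rewrite ?(linear0 (cin _)).
Qed.

Lemma cin_one : cin 0 (cobar_one H) = 1. Proof. by []. Qed.

Lemma homog_cin i x : homog `|i|%N (cin i x).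
Proof. by case: i x => n x; [apply: homog_in | apply: homog0]. Qed.

Lemma bnd_comp (t : T) : bnd t -> tcomp H 0 t = 0 /\
  forall n, exists y, tcomp H n.+1 t = cobar_diff y.
Proof.
elim=> [|a b _ [a0 aS] _ [b0 bS]|n c hc].
- by split=> [|n]; [rewrite linear0 | exists 0; rewrite !linear0].
- split=> [|n]; first by rewrite linearD a0 b0 addr0.
  by have [y ey] := aS n; have [z ez] := bS n; exists (y + z); rewrite !linearD ey ez.
split=> [|m]; first by rewrite (homogE (homog_cdiff hc)).
have [e|nm] := eqVneq n m; last first.
  by exists 0; rewrite linear0 (homogE (homog_cdiff hc)).
by exists (tcomp H m c); rewrite hc -e cdiff_tin !tcomp_in.
Qed.

Lemma bnd_coboundary i (x : cobar H i) : bnd (cin i x) -> is_coboundary x.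
Proof.
move=> /bnd_comp [x0 xS]; case: i x x0 xS => [[|n]|n] x x0 xS.
- exists 0; apply: cin_inj; rewrite cin_gcast !linear0.
  by rewrite cinP tcomp_in in x0; rewrite x0 linear0.
- have [y ey] := xS n; exists (gcast (G := cobar H) (posz_pred n) y).
  apply: cin_inj; rewrite cin_gcast cin_d cin_gcast cinP cdiff_tin.
  by congr (tin H n.+1 _); move: ey; rewrite cinP tcomp_in.
- by exists 0; apply: cin_inj; rewrite !cinN.
Qed.

Lemma coboundary_bnd i (x : cobar H i) : is_coboundary x -> bnd (cin i x).
Proof.
by move=> [y ->]; rewrite cin_gcast cin_d; apply: bnd_cdiff (homog_cin y).
Qed.

Lemma cobar_d0P i (x : cobar H i) : cobar_d x = 0 <-> cocyc `|i|%N (cin i x).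
Proof.
split=> [dx|[_ dx]]; first by split; [apply: homog_cin | rewrite -cin_d dx linear0].
by apply: cin_inj; rewrite cin_d dx linear0.
Qed.

Definition cproj_fun (i : int) : cobar H i -> cobar H i :=
  match i with Posz n => nprojn H n | Negz _ => id end.
Lemma cproj_linear i : linear (@cproj_fun i).
Proof. by case: i => n a x y //; apply: (linearP (nprojn H n)). Qed.
Definition cproj i : {linear cobar H i -> cobar H i} := mk_linear (@cproj_linear i).

Lemma cin_cproj i x : cin i (cproj i x) = nproj (cin i x).
Proof.
case: i x => n x; last by rewrite !cinN linear0.
by rewrite [cproj _ x]/(nprojn H n x) !cinP nproj_tin.
Qed.

Lemma normalizedP i (x : cobar H i) : cobar_normalized x <-> nproj (cin i x) = cin i x.
Proof.
case: i x => [[|n]|n] x.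
- by split=> // _; rewrite (nproj_homog0 (homog_in x)).
- split=> [nx|nx].
    apply: nproj_id (homog_in x) _ => j; rewrite ltnS => jn.
    by rewrite cod_tin (nx j jn) linear0.
  move=> j _; apply: (@tin_inj _ H n); rewrite -cod_tin linear0.
  by rewrite -[tin H n.+1 x]/(cin (Posz n.+1) x) -nx (cod_nproj _ (homog_in x)).
- by split=> // _; rewrite cinN linear0.
Qed.

Lemma normalized_cproj i (x : cobar H i) : cobar_normalized (cproj i x).
Proof. by apply/normalizedP; rewrite !cin_cproj (nprojK (homog_cin x)). Qed.

End Embedding.

#[global] Opaque cin cproj.

(** * The Batalin-Vilkovisky algebra of Cotor *)

Lemma odd_abszB1 (i : int) : odd (absz (i - 1)) = ~~ odd (absz i).
Proof. by lia. Qed.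
Lemma odd_abszD (i j : int) : odd (absz (i + j)) = odd (absz i) (+) odd (absz j).
Proof. by lia. Qed.
Lemma odd_abszM (i j : int) : odd (absz (i * j)) = odd (absz i) && odd (absz j).
Proof. by rewrite abszM oddM. Qed.

Section CotorAlgebra.
Variables (k : comNzRingType) (H : hopfAlgType k) (chi : {lrmorphism H -> k^o}).
Hypothesis chi_invol : modular_pair_in_involution chi.
Local Notation T := (talg H).
Local Notation nproj := (nproj H).
Local Notation conB := (conB chi).
Local Notation cin := (cin H).
Local Notation cotor := (cotor H).
Implicit Types (t u v : T).

Lemma cobar_cup_bilin i j : bilin (@cobar_cup k H i j).
Proof.
by split=> *; apply: cin_inj; rewrite !cin_cup !linearP /= !cin_cup ?mulrDl ?mulrDr
  -?scalerAl -?scalerAr.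
Qed.

Lemma cobar_cup_cocycle i j (a : cobar H i) (b : cobar H j) :
  cobar_d a = 0 -> cobar_d b = 0 -> cobar_d (cobar_cup a b) = 0.
Proof.
move=> /cobar_d0P[ha da] /cobar_d0P[hb db]; apply: cin_inj.
by rewrite cin_d cin_cup (cdiff_mul ha hb) da db mul0r mulr0 scaler0 addr0 linear0.
Qed.

Lemma cobar_cup_coboundaryl i j (a : cobar H i) (b : cobar H j) :
  cobar_d a = 0 -> is_coboundary a -> cobar_d b = 0 -> is_coboundary (cobar_cup a b).
Proof.
move=> _ /coboundary_bnd Ba /cobar_d0P[hb db]; apply: bnd_coboundary.
by rewrite cin_cup; apply: bnd_mulr hb db Ba.
Qed.

Lemma cobar_cup_coboundaryr i j (a : cobar H i) (b : cobar H j) :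
  cobar_d a = 0 -> cobar_d b = 0 -> is_coboundary b -> is_coboundary (cobar_cup a b).
Proof.
move=> /cobar_d0P[ha da] _ /coboundary_bnd Bb; apply: bnd_coboundary.
by rewrite cin_cup; apply: bnd_mull ha da Bb.
Qed.

Definition cup i j : {bilinear cotor i -> cotor j -> cotor (i + j)%R} :=
  @qmap2 k _ _ _ (cocycles H i) (coboundaries H i) (cocycles H j) (coboundaries H j)
    (cocycles H (i + j)) (coboundaries H (i + j)) _ (@cobar_cup_bilin i j)
    (@cobar_cup_cocycle i j) (@cobar_cup_coboundaryl i j) (@cobar_cup_coboundaryr i j).

Lemma cobarB_cocycle i (a : cobar H i) : cobar_d a = 0 -> cobar_d (cobarB chi a) = 0.
Proof.
move=> /cobar_d0P[ha da]; apply: cin_inj.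
by rewrite cin_d cin_B (cdiff_conB chi_invol ha) da !linear0.
Qed.

Lemma cobarB_coboundary i (a : cobar H i) :
  cobar_d a = 0 -> is_coboundary a -> is_coboundary (cobarB chi a).
Proof.
move=> _ /coboundary_bnd Ba; apply: bnd_coboundary.
by rewrite cin_B; apply: bnd_conB.
Qed.

Definition cotorB i : {linear cotor i -> cotor (i - 1)} :=
  @qmap k _ _ (cocycles H i) (coboundaries H i) (cocycles H (i - 1)) (coboundaries H (i - 1))
    (@cobarB k H chi i) (@cobarB_cocycle i) (@cobarB_coboundary i).

(** [t] is a cocycle representing [x].  This turns an identity in Cotor into a
    relation up to boundaries between elements of one algebra, without casts
    between degrees ([crep_eq]). *)
Definition crep i (x : cotor i) t := exists2 c, cotor_class x c & cin i c = t.

Lemma crep_cocyc i (x : cotor i) t : crep x t -> cocyc `|i|%N t.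
Proof. by move=> [c /is_class_in xc <-]; apply/cobar_d0P. Qed.

Lemma crep_eq i (x y : cotor i) t u : crep x t -> crep y u -> bnd (t - u) -> x = y.
Proof.
move=> [c xc <-] [d yd <-] b; apply: (is_class_eq xc yd).
by apply: bnd_coboundary; rewrite linearB.
Qed.

Lemma crep_inj i (x : cotor i) (y : cotor i) t : crep x t -> crep y t -> x = y.
Proof. by move=> xt yt; apply: crep_eq xt yt _; rewrite subrr; apply: bnd0. Qed.

Lemma crepP (s : k) i (x y : cotor i) t u : crep x t -> crep y u -> crep (s *: x + y) (s *: t + u).
Proof.
move=> [c xc <-] [d yd <-]; exists (s *: c + d); first exact: is_classP.
exact: linearP.
Qed.

Lemma crep0 i : crep (0 : cotor i) 0.
Proof.
have [x x0] := is_class_exists (coboundaries H i) (in_submod0 (cocycles H i)).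
suff -> : (0 : cotor i) = x by exists 0; rewrite ?linear0.
have := is_classP (-1) x0 x0; rewrite scaleN1r addNr scaler0 addr0 => z0.
by apply: (is_class_eq z0 x0); rewrite subrr; apply: in_submod0.
Qed.

Lemma crepZ (s : k) i (x : cotor i) t : crep x t -> crep (s *: x) (s *: t).
Proof. by move=> xt; rewrite -[s *: x]addr0 -[s *: t]addr0; apply: crepP xt (crep0 i). Qed.
Lemma crepD i (x y : cotor i) t u : crep x t -> crep y u -> crep (x + y) (t + u).
Proof. by move=> xt yu; rewrite -[x]scale1r -[t]scale1r; apply: crepP. Qed.
Lemma crepN i (x : cotor i) t : crep x t -> crep (- x) (- t).
Proof. by move=> xt; rewrite -scaleN1r -[- t]scaleN1r; apply: crepZ. Qed.
Lemma crepB i (x y : cotor i) t u : crep x t -> crep y u -> crep (x - y) (t - u).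
Proof. by move=> xt yu; apply/crepD/crepN. Qed.
Lemma crep_gcast i j (e : i = j) (x : cotor i) t : crep x t -> crep (gcast e x) t.
Proof. by case: j / e. Qed.
Lemma cup_class i j (x : cotor i) (y : cotor j) a b :
  cotor_class x a -> cotor_class y b -> cotor_class (cup i j x y) (cobar_cup a b).
Proof. exact: qmap2E. Qed.
Lemma crep_cup i j (x : cotor i) (y : cotor j) t u :
  crep x t -> crep y u -> crep (cup i j x y) (t * u).
Proof.
move=> [c xc <-] [d yd <-]; exists (cobar_cup c d); last exact: cin_cup.
exact: cup_class.
Qed.
Lemma cotorB_class i (x : cotor i) c :
  cotor_class x c -> cotor_class (cotorB i x) (cobarB chi c).
Proof. exact: qmapE. Qed.
Lemma crep_B i (x : cotor i) t : crep x t -> crep (cotorB i x) (conB t).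
Proof.
move=> [c xc <-]; exists (cobarB chi c); last exact: cin_B.
exact: cotorB_class.
Qed.

Lemma cproj_cohomologous i (c : cobar H i) : cobar_d c = 0 -> is_coboundary (c - cproj H i c).
Proof.
move=> /cobar_d0P[hc dc]; apply: bnd_coboundary; rewrite linearB /= cin_cproj.
rewrite -(nhtp_homotopy hc) dc linear0 addr0; exact: bnd_cdiff (homog_nhtp hc).
Qed.

Lemma crep_normal i (x : cotor i) : exists2 t, crep x t & nproj t = t.
Proof.
have [c xc] := is_class_ex x; exists (cin i (cproj H i c)); last first.
  by rewrite !cin_cproj (nprojK (homog_cin c)).
exists (cproj H i c) => //; have dc := is_class_in xc.
have dp : cobar_d (cproj H i c) = 0.
  apply: cin_inj; rewrite cin_d cin_cproj (cdiff_nproj (homog_cin c)) -cin_d dc.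
  by rewrite !linear0.
have [y yp] := is_class_exists (Z := cocycles H i) (coboundaries H i) dp.
by rewrite (is_class_eq xc yp) //; apply: cproj_cohomologous.
Qed.

Lemma pred_addl (i j : int) : (i - 1) + j = i + j - 1. Proof. by rewrite addrAC. Qed.
Lemma pred_addr (i j : int) : i + (j - 1) = i + j - 1. Proof. by rewrite addrA. Qed.

(** The bracket is forced by the product and [B]. *)
Definition bracket_fun i j (x : cotor i) (y : cotor j) : cotor (i + j - 1) :=
  gsign k i *: (cotorB _ (cup i j x y) - gcast (pred_addl i j) (cup _ _ (cotorB i x) y)
    - gsign k i *: gcast (pred_addr i j) (cup _ _ x (cotorB j y))).

Lemma crep_bracket_fun i j (x : cotor i) (y : cotor j) t u : crep x t -> crep y u ->
  crep (bracket_fun x y) ((-1) ^+ odd `|i|%N *: bvdev chi `|i|%N t u).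
Proof.
move=> xt yu; rewrite /bvdev /bvdefect signr_odd; apply/crepZ/crepB.
  apply: crepB; first exact/crep_B/crep_cup.
  by apply: crep_gcast; apply: crep_cup => //; apply: crep_B.
by apply/crepZ/crep_gcast/crep_cup => //; apply: crep_B.
Qed.

Lemma crep_ex i (x : cotor i) : exists t, crep x t.
Proof. by have [t xt _] := crep_normal x; exists t. Qed.

Lemma bvdev_bilin m : bilin (bvdev chi m).
Proof.
split=> [s t t' u|s t u u']; rewrite /bvdev /bvdefect.
  rewrite (linearP conB) !mulrDl -!scalerAl (linearP conB).
  by rewrite !scalerDr !scalerN !scalerA mulrC; abel.
rewrite (linearP conB) !mulrDr -!scalerAr (linearP conB).
by rewrite !scalerDr !scalerN !scalerA mulrC; abel.
Qed.

Lemma bracket_bilinear i j : bilinear_for *:%R *:%R (@bracket_fun i j).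
Proof.
split=> [y s x x'|x s y y'].
  have [t xt] := crep_ex x; have [t' xt'] := crep_ex x'; have [u yu] := crep_ex y.
  apply: (crep_inj (crep_bracket_fun (crepP s xt xt') yu)).
  rewrite (bvdev_bilin _).1 scalerDr scalerA mulrC -scalerA.
  exact: (crepP s (crep_bracket_fun xt yu) (crep_bracket_fun xt' yu)).
have [t xt] := crep_ex x; have [u yu] := crep_ex y; have [u' yu'] := crep_ex y'.
apply: (crep_inj (crep_bracket_fun xt (crepP s yu yu'))).
rewrite (bvdev_bilin _).2 scalerDr scalerA mulrC -scalerA.
exact: (crepP s (crep_bracket_fun xt yu) (crep_bracket_fun xt yu')).
Qed.

Definition bracket i j : {bilinear cotor i -> cotor j -> cotor (i + j - 1)%R} :=
  mk_bilinear (@bracket_bilinear i j).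

Lemma crep_bracket i j (x : cotor i) (y : cotor j) t u : crep x t -> crep y u ->
  crep (bracket i j x y) ((-1) ^+ odd `|i|%N *: bvdev chi `|i|%N t u).
Proof. exact: crep_bracket_fun. Qed.

Opaque bracket.

Definition cotor_one : cotor 0 := sval (cid (is_class_exists (Z := cocycles H 0) (coboundaries H 0)
  (proj2 (cobar_d0P (cobar_one H)) (cocyc1 H)))).

Lemma cotor_one_class : cotor_class cotor_one (cobar_one H).
Proof. exact: (svalP (cid (is_class_exists _ _))). Qed.

Lemma crep_cotor_one : crep cotor_one 1.
Proof. by exists (cobar_one H); [apply: cotor_one_class | apply: cin_one]. Qed.

Lemma cupA i j l (a : cotor i) (b : cotor j) (c : cotor l) (e : i + (j + l) = i + j + l) :
  gcast e (cup _ _ a (cup _ _ b c)) = cup _ _ (cup _ _ a b) c.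
Proof.
have [t at_] := crep_ex a; have [u bu] := crep_ex b; have [v cv] := crep_ex c.
apply: (crep_inj (crep_gcast e (crep_cup at_ (crep_cup bu cv)))).
by rewrite mulrA; apply/crep_cup/cv/crep_cup.
Qed.

Lemma cup1l i (a : cotor i) (e : 0 + i = i) : gcast e (cup _ _ cotor_one a) = a.
Proof.
have [t at_] := crep_ex a; apply: (crep_inj (crep_gcast e (crep_cup crep_cotor_one at_))).
by rewrite mul1r.
Qed.

Lemma cup1r i (a : cotor i) (e : i + 0 = i) : gcast e (cup _ _ a cotor_one) = a.
Proof.
have [t at_] := crep_ex a; apply: (crep_inj (crep_gcast e (crep_cup at_ crep_cotor_one))).
by rewrite mulr1.
Qed.

Lemma gsign_odd i : gsign k i = (-1) ^+ odd `|i|%N.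
Proof. by rewrite signr_odd. Qed.

Lemma cupC i j (a : cotor i) (b : cotor j) (e : j + i = i + j) :
  cup _ _ a b = gsign k (i * j) *: gcast e (cup _ _ b a).
Proof.
have [t at_] := crep_ex a; have [u bu] := crep_ex b.
apply: (crep_eq (crep_cup at_ bu) (crepZ _ (crep_gcast e (crep_cup bu at_)))).
rewrite gsign_odd odd_abszM.
have [[ht dt] [hu du]] := (crep_cocyc at_, crep_cocyc bu).
exact: (bnd_comm chi_invol ht hu dt du).
Qed.

Lemma bracketC i j (a : cotor i) (b : cotor j) (e : j + i - 1 = i + j - 1) :
  bracket _ _ a b = - (gsign k ((i - 1) * (j - 1)) *: gcast e (bracket _ _ b a)).
Proof.
have [t at_] := crep_ex a; have [u bu] := crep_ex b.
apply: (crep_eq (crep_bracket at_ bu) (crepN (crepZ _ (crep_gcast e (crep_bracket bu at_))))).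
rewrite gsign_odd odd_abszM !odd_abszB1.
have := bndZ ((-1) ^+ odd `|i|%N) (bnd_bvdevC chi_invol (crep_cocyc at_) (crep_cocyc bu)).
congr bnd; move: (bvdev _ _ _ _) (bvdev _ _ _ _) => p q.
by case: (odd `|i|%N); case: (odd `|j|%N) => /=; by_signs; abel.
Qed.

Lemma bvdevZr m (s : k) t u : bvdev chi m t (s *: u) = s *: bvdev chi m t u.
Proof. exact: bilinZr (bvdev_bilin m) _ _ _. Qed.
Lemma bvdevZl m (s : k) t u : bvdev chi m (s *: t) u = s *: bvdev chi m t u.
Proof. exact: bilinZl (bvdev_bilin m) _ _ _. Qed.

Lemma bvdev_odd m n t u : odd m = odd n -> bvdev chi m t u = bvdev chi n t u.
Proof. by rewrite /bvdev => ->. Qed.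

Lemma nproj_prod m n t u : homog m t -> homog n u -> nproj t = t -> nproj u = u ->
  nproj (t * u) = t * u.
Proof. by move=> ht hu nt nu; rewrite (nproj_mul ht hu) nt nu. Qed.

Lemma bracket_jacobi i j l (a : cotor i) (b : cotor j) (c : cotor l)
    (e1 : (i + j - 1) + l - 1 = i + (j + l - 1) - 1)
    (e2 : j + (i + l - 1) - 1 = i + (j + l - 1) - 1) :
  bracket _ _ a (bracket _ _ b c) =
    gcast e1 (bracket _ _ (bracket _ _ a b) c)
    + gsign k ((i - 1) * (j - 1)) *: gcast e2 (bracket _ _ b (bracket _ _ a c)).
Proof.
(* For normalized representatives, whose products are normalized again, all squares
   of [conB] in [bnd_jacobi] vanish. *)
have [t at_ nt] := crep_normal a; have [u bu nu] := crep_normal b.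
have [v cv nv] := crep_normal c.
have [[ct cu] cw] := (crep_cocyc at_, crep_cocyc bu, crep_cocyc cv).
have [[ntu nuv] ntv] := (nproj_prod ct.1 cu.1 nt nu, nproj_prod cu.1 cw.1 nu nv,
  nproj_prod ct.1 cw.1 nt nv).
have ntuv := nproj_prod ct.1 (homogM cu.1 cw.1) nt nuv.
have sq := conB_conB chi_invol.
have := bnd_jacobi chi_invol ct cu cw (sq _ _ ct.1 nt) (sq _ _ cu.1 nu) (sq _ _ cw.1 nv)
  (sq _ _ (homogM ct.1 cu.1) ntu) (sq _ _ (homogM cu.1 cw.1) nuv)
  (sq _ _ (homogM ct.1 cw.1) ntv) (sq _ _ (homogM ct.1 (homogM cu.1 cw.1)) ntuv).
move=> /(bndZ ((-1) ^+ (odd `|i|%N (+) odd `|j|%N))) J.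
apply: (crep_eq (crep_bracket at_ (crep_bracket bu cv))
  (crepD (crep_gcast e1 (crep_bracket (crep_bracket at_ bu) cv))
  (crepZ _ (crep_gcast e2 (crep_bracket bu (crep_bracket at_ cv)))))).
move: J; congr bnd; rewrite gsign_odd odd_abszM !odd_abszB1 !bvdevZr !bvdevZl.
rewrite (@bvdev_odd (absz (i + j - 1)%R) (absz i + absz j).+1); last first.
  by rewrite odd_abszB1 odd_abszD /= oddD.
rewrite odd_abszD.
move: (bvdev chi `|i|%N t (bvdev _ _ _ _)) (bvdev chi _ (bvdev _ _ _ _) v)
  (bvdev chi _ u (bvdev _ _ _ _)) => x y z.
by case: (odd `|i|%N); case: (odd `|j|%N) => /=; by_signs; abel.
Qed.

Lemma bracket_poisson i j l (a : cotor i) (b : cotor j) (c : cotor l)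
    (e1 : (i + j - 1) + l = i + (j + l) - 1)
    (e2 : j + (i + l - 1) = i + (j + l) - 1) :
  bracket _ _ a (cup _ _ b c) =
    gcast e1 (cup _ _ (bracket _ _ a b) c)
    + gsign k (j * (i - 1)) *: gcast e2 (cup _ _ b (bracket _ _ a c)).
Proof.
have [t at_] := crep_ex a; have [u bu] := crep_ex b; have [v cv] := crep_ex c.
apply: (crep_eq (crep_bracket at_ (crep_cup bu cv))
  (crepD (crep_gcast e1 (crep_cup (crep_bracket at_ bu) cv))
  (crepZ _ (crep_gcast e2 (crep_cup bu (crep_bracket at_ cv)))))).
have := bndZ ((-1) ^+ odd `|i|%N)
  (bnd_poisson chi_invol (crep_cocyc at_) (crep_cocyc bu) (crep_cocyc cv)).
congr bnd; rewrite gsign_odd odd_abszM !odd_abszB1 -scalerAl -scalerAr.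
move: (bvdev _ _ t (u * v)) (bvdev _ _ t u * v) (u * bvdev _ _ t v) => x y z.
by case: (odd `|i|%N); case: (odd `|j|%N) => /=; by_signs; abel.
Qed.

Definition cotor_gerstenhaber : gerstenhaber cotor :=
  Gerstenhaber cupA cup1l cup1r cupC bracketC bracket_jacobi bracket_poisson.

Lemma cotorBB i (a : cotor i) : cotorB _ (cotorB _ a) = 0.
Proof.
have [t at_ nt] := crep_normal a; apply: (crep_inj (crep_B (crep_B at_))).
by rewrite (conB_conB chi_invol (crep_cocyc at_).1 nt); apply: crep0.
Qed.

Lemma bracket_bv i j (a : cotor i) (b : cotor j)
    (e1 : (i - 1) + j = i + j - 1) (e2 : i + (j - 1) = i + j - 1) :
  bracket i j a b = gsign k i *: (cotorB _ (cup i j a b) - gcast e1 (cup _ _ (cotorB _ a) b)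
    - gsign k i *: gcast e2 (cup _ _ a (cotorB _ b))).
Proof. by rewrite (eq_irrelevance e1 (pred_addl i j)) (eq_irrelevance e2 (pred_addr i j)). Qed.

Definition cotor_bv : batalin_vilkovisky cotor :=
  @BatalinVilkovisky _ _ cotor_gerstenhaber cotorB cotorBB bracket_bv.

End CotorAlgebra.

#[global] Opaque cup cotorB.

(** * The Lie bracket on cyclic cohomology *)

Section CyclicCohomology.
Variables (k : comNzRingType) (H : hopfAlgType k) (chi : {lrmorphism H -> k^o}).
Hypothesis chi_invol : modular_pair_in_involution chi.
Local Notation T := (talg H).
Local Notation cdiff := (cdiff H).
Local Notation nproj := (nproj H).
Local Notation conB := (conB chi).
Local Notation cin := (cin H).
Local Notation cotor := (cotor H).
Local Notation cyclic := (cyclic_coh chi).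
Local Notation cotorB := (cotorB chi_invol).
Local Notation cup := (cup H).
Implicit Types (t u v : T).

Lemma cotor_normal_rep n (x : cotor n) :
  exists2 c : cobar H n, cobar_normalized c & cotor_class x c.
Proof. by have [t [c xc <-] nt] := crep_normal x; exists c => //; apply/normalizedP. Qed.

Lemma cotorB_induced : induced_by_connesB chi cotorB.
Proof.
move=> n x y; split=> [->|[c [nc xc yc]]].
  by have [c nc xc] := cotor_normal_rep x; exists c; split=> //; apply: cotorB_class.
by apply: (is_class_eq yc (cotorB_class chi_invol xc)); rewrite subrr; apply: in_submod0.
Qed.

Lemma tot_ext n (c c' : tot_family H n) :
  (forall l, cin _ (c l) = cin _ (c' l)) -> c = c'.
Proof. by move=> cc'; apply: functional_extensionality_dep => l; apply/cin_inj/cc'. Qed.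

Lemma cin_tot_gcast m n (e : m = n) (c : tot_family H m) l :
  cin _ (gcast (G := tot_family H) e c l) = cin _ (c l).
Proof. by case: n / e. Qed.

Lemma cin_tot_D n (c : tot_family H n) l :
  cin _ (tot_D chi c l) = cdiff (cin _ (c l)) + conB (cin _ (c l.+1)).
Proof. by rewrite /tot_D linearD /= !cin_gcast cin_d cin_B. Qed.

(** The positions are compared by a reflected equality because [c] has to be
    transported along it. *)
Definition tot_at n (p : nat) i (e : i = n + p.*2%:Z) (c : cobar H i) : tot_family H n :=
  fun l => if p =P l is ReflectT pl then gcast (etrans e (congr1 (fun q => n + q.*2%:Z) pl)) c
           else 0.

Lemma cin_tot_at n p i (e : i = n + p.*2%:Z) c l :
  cin _ (tot_at e c l) = if p == l then cin i c else 0.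
Proof. by rewrite /tot_at; case: eqP => [pl|_]; [rewrite cin_gcast | rewrite linear0]. Qed.

Lemma is_tot_at n p i (e : i = n + p.*2%:Z) c :
  cobar_normalized c -> is_tot (tot_at e c).
Proof.
move=> /normalizedP nc; split=> [|l].
  exists p.+1 => l pl; apply: cin_inj; rewrite cin_tot_at linear0.
  by case: eqP pl => // ->; rewrite ltnn.
by apply/normalizedP; rewrite cin_tot_at; case: eqP => // _; rewrite linear0.
Qed.

Lemma tot_headE n (c : cobar H n) : tot_head c = tot_at (tot_deg0 n) c.
Proof.
apply: tot_ext => -[|l]; rewrite cin_tot_at /=; first exact: cin_gcast.
exact: linear0.
Qed.

Lemma cproj_id n (c : cobar H n) : cobar_normalized c -> cproj H n c = c.
Proof. by move=> /normalizedP nc; apply: cin_inj; rewrite cin_cproj. Qed.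

(** Defined on all cochains by first projecting to normalized ones, so that it
    induces a map on cohomology. *)
Definition normal_head n (c : cobar H n) : tot_family H n := tot_head (cproj H n c).

Lemma cin_head n (c : cobar H n) l :
  cin _ (normal_head c l) = if 0%N == l then nproj (cin n c) else 0.
Proof. by rewrite /normal_head tot_headE cin_tot_at cin_cproj. Qed.

Lemma head_linear n : linear (@normal_head n).
Proof.
move=> a c c'; apply: tot_ext => l.
rewrite [RHS](_ : _ = cin _ (a *: normal_head c l + normal_head c' l)) // linearP /= !cin_head.
by case: eqP => _; rewrite ?linearP //= scaler0 addr0.
Qed.

Lemma head_tot n (c : cobar H n) : is_tot (normal_head c).
Proof. by rewrite /normal_head tot_headE; apply/is_tot_at/normalized_cproj. Qed.

Lemma head_cocycle n (c : cobar H n) : cobar_d c = 0 -> is_tot_cocycle chi (normal_head c).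
Proof.
move=> /cobar_d0P[hc dc]; split; first exact: head_tot.
apply: tot_ext => l; rewrite cin_tot_D !cin_head linear0 addr0 [RHS]linear0.
by case: eqP => _; rewrite ?linear0 // (cdiff_nproj hc) dc linear0.
Qed.

Lemma head_coboundary n (c : cobar H n) :
  cobar_d c = 0 -> is_coboundary c -> is_tot_coboundary chi (normal_head c).
Proof.
move=> _ [y ->]; exists (normal_head y); first exact: head_tot.
apply: tot_ext => l; rewrite cin_tot_gcast cin_tot_D !cin_head linear0 addr0.
case: eqP => _; last by rewrite linear0.
by rewrite cin_gcast cin_d (cdiff_nproj (homog_cin y)).
Qed.

Definition cyclicI n : {linear cotor n -> cyclic n} :=
  @qmap k _ _ (cocycles H n) (coboundaries H n) (tot_cocycles chi n) (tot_coboundaries chi n)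
    (mk_linear (@head_linear n)) (@head_cocycle n) (@head_coboundary n).

Lemma cyclicIE n (x : cotor n) c : cobar_normalized c -> cotor_class x c ->
  cyclic_class (cyclicI n x) (tot_head c).
Proof. by move=> nc xc; rewrite -(cproj_id nc); apply: (qmapE _ _ xc). Qed.

Lemma cyclicI_tot_head : induced_by_tot_head cyclicI.
Proof.
move=> n x y; split=> [->|[c [nc xc yc]]].
  by have [c nc xc] := cotor_normal_rep x; exists c; split=> //; apply: cyclicIE.
apply: (is_class_eq yc (cyclicIE nc xc)); rewrite subrr; apply: in_submod0.
Qed.

Lemma tot_fst_linear n : linear (@tot_fst k H n).
Proof. by move=> a c c'; rewrite /tot_fst -linearP. Qed.

Lemma cin_tot_fst n (c : tot_family H n) : cin _ (tot_fst c) = cin _ (c 0%N).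
Proof. exact: cin_gcast. Qed.

Definition boundary_fun n : {linear tot_family H n -> cobar H (n - 1)} :=
  @cobarB k H chi n \o mk_linear (@tot_fst_linear n).

Lemma cin_boundary n (c : tot_family H n) : cin _ (boundary_fun n c) = conB (cin _ (c 0%N)).
Proof. by rewrite -[boundary_fun n c]/(cobarB chi (tot_fst c)) cin_B cin_tot_fst. Qed.

Lemma tot_cocycleE n (c : tot_family H n) l : is_tot_cocycle chi c ->
  cdiff (cin _ (c l)) = - conB (cin _ (c l.+1)).
Proof.
move=> [_ Dc]; apply/eqP; rewrite -subr_eq0 opprK -cin_tot_D Dc.
by rewrite [X in X == _]linear0.
Qed.

Lemma tot_nproj n (c : tot_family H n) l : is_tot c -> nproj (cin _ (c l)) = cin _ (c l).
Proof. by move=> [_ nc]; apply/normalizedP. Qed.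

Lemma tot_conBB n (c : tot_family H n) l : is_tot c -> conB (conB (cin _ (c l))) = 0.
Proof. by move=> tc; apply: (conB_conB chi_invol (homog_cin _) (tot_nproj l tc)). Qed.

(** [d c_0 = - B c_1] by the cocycle condition, so that [d B c_0 = B B c_1], which
    vanishes as [c_1] is normalized. *)
Lemma boundary_cocycle n (c : tot_family H n) :
  is_tot_cocycle chi c -> cobar_d (boundary_fun n c) = 0.
Proof.
move=> cc; apply: cin_inj; rewrite cin_d cin_boundary (cdiff_conB chi_invol (homog_cin _)).
by rewrite (tot_cocycleE 0 cc) (linearN conB) (tot_conBB 1 cc.1) !oppr0 linear0.
Qed.

Lemma boundary_coboundary n (c : tot_family H n) :
  is_tot_cocycle chi c -> is_tot_coboundary chi c -> is_coboundary (boundary_fun n c).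
Proof.
move=> _ [b tb ->]; apply: bnd_coboundary; rewrite cin_boundary cin_tot_gcast cin_tot_D.
rewrite (linearD conB) (tot_conBB 1 tb) addr0 -[conB _]opprK.
rewrite -(cdiff_conB chi_invol (homog_cin _)); apply: bndN; apply: bnd_cdiff.
exact: (homog_conB chi (homog_cin _)).
Qed.

Definition boundary n : {linear cyclic n -> cotor (n - 1)} :=
  @qmap k _ _ (tot_cocycles chi n) (tot_coboundaries chi n) (cocycles H (n - 1))
    (coboundaries H (n - 1)) (boundary_fun n) (@boundary_cocycle n) (@boundary_coboundary n).

Lemma boundary_induced : induced_by_boundary boundary.
Proof. by move=> n x c xc; apply: (qmapE _ _ xc). Qed.

Lemma crep_boundary n (x : cyclic n) c :
  cyclic_class x c -> crep (boundary n x) (conB (cin _ (c 0%N))).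
Proof.
by move=> xc; exists (boundary_fun n c); [apply: boundary_induced | apply: cin_boundary].
Qed.

Opaque cyclicI boundary.

Lemma boundary_cyclicI n (x : cotor n) : boundary n (cyclicI n x) = cotorB n x.
Proof.
have [c nc xc] := cotor_normal_rep x.
apply: (crep_inj (crep_boundary (cyclicIE nc xc))).
by rewrite tot_headE cin_tot_at; apply: crep_B; exists c.
Qed.

(** [B o bd = 0], already for the representatives. *)
Lemma boundary_rep n (x : cyclic n) : exists2 t, crep (boundary n x) t & conB t = 0.
Proof.
have [c xc] := is_class_ex x; exists (conB (cin _ (c 0%N))); first exact: crep_boundary.
exact: (tot_conBB 0 (is_class_in xc).1).
Qed.

Lemma tot_deg1 (n : int) : n = n - 1 - 1 + 1.*2%:Z.
Proof. by lia. Qed.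

(** [(B c, 0, ...)] is the coboundary of [(0, c, 0, ...)]. *)
Lemma cyclicI_cotorB n (x : cotor n) : cyclicI (n - 1) (cotorB n x) = 0.
Proof.
have [c nc xc] := cotor_normal_rep x; have dc := (crep_cocyc (ex_intro2 _ _ c xc erefl)).2.
have nB : cobar_normalized (cobarB chi c).
  apply/normalizedP; rewrite cin_B.
  by apply: (nproj_conB chi_invol (homog_cin c)); apply/normalizedP.
have yB := cotorB_class chi_invol xc.
have [z z0] := is_class_exists (tot_coboundaries chi (n - 1))
  (in_submod0 (tot_cocycles chi (n - 1))).
have z00 : z = 0.
  have := is_classP (-1) z0 z0; rewrite scaleN1r addNr scaler0 addr0 => w.
  by apply: (is_class_eq z0 w); rewrite subrr; apply: in_submod0.
rewrite -z00; apply: (is_class_eq (cyclicIE nB yB) z0); rewrite subr0.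
exists (tot_at (tot_deg1 n) c); first exact: is_tot_at.
apply: tot_ext => l; rewrite tot_headE cin_tot_gcast cin_tot_D !cin_tot_at cin_B.
by case: l => [|[|l]] /=; rewrite ?dc ?linear0 ?add0r ?addr0.
Qed.

(** All classes that occur in the Lie identities lie in the image of [I]; they are
    compared through representatives modulo boundaries and modulo the image of [B]
    ([irep_eq]). *)
Definition irep n (y : cyclic n) t := exists2 x, y = cyclicI n x & crep x t.

Lemma irepP (s : k) n (y y' : cyclic n) t t' :
  irep y t -> irep y' t' -> irep (s *: y + y') (s *: t + t').
Proof.
move=> [x -> xt] [x' -> xt']; exists (s *: x + x'); last exact: crepP.
by rewrite linearP.
Qed.
Lemma irep0 n : irep (0 : cyclic n) 0.
Proof. by exists 0; [rewrite linear0 | apply: crep0]. Qed.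
Lemma irepZ (s : k) n (y : cyclic n) t : irep y t -> irep (s *: y) (s *: t).
Proof. by move=> yt; rewrite -[s *: y]addr0 -[s *: t]addr0; apply/irepP/irep0. Qed.
Lemma irepD n (y y' : cyclic n) t t' : irep y t -> irep y' t' -> irep (y + y') (t + t').
Proof. by move=> yt yt'; rewrite -[y]scale1r -[t]scale1r; apply: irepP. Qed.
Lemma irepN n (y : cyclic n) t : irep y t -> irep (- y) (- t).
Proof. by move=> yt; rewrite -scaleN1r -[- t]scaleN1r; apply: irepZ. Qed.
Lemma irep_gcast m n (e : m = n) (y : cyclic m) t : irep y t -> irep (gcast e y) t.
Proof. by case: n / e. Qed.

Lemma irep_eq n j (w : cotor j) (e : j - 1 = n) (y y' : cyclic n) t t' u :
  irep y t -> irep y' t' -> crep w u -> bnd (t - t' - conB u) -> y = y'.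
Proof.
move=> [x -> xt] [x' -> xt'] wu b; apply/eqP; rewrite -subr_eq0 -linearB.
rewrite [x - x'](crep_eq (crepB xt xt') (crep_gcast e (crep_B chi_invol wu)) b).
by case: n / e {y y' x x' xt xt'}; rewrite cyclicI_cotorB.
Qed.

Lemma irep_bnd n (y y' : cyclic n) t t' :
  irep y t -> irep y' t' -> bnd (t - t') -> y = y'.
Proof. by move=> [x -> xt] [x' -> xt'] b; rewrite (crep_eq xt xt' b). Qed.

Lemma crep_boundary_irep n (y : cyclic n) t : irep y t -> crep (boundary n y) (conB t).
Proof. by move=> [x -> xt]; rewrite boundary_cyclicI; apply: crep_B. Qed.

Lemma lie_deg (m n : int) : m - 1 + (n - 1) = m + n - 2.
Proof. by lia. Qed.

Definition lie_bracket_fun m n (a : cyclic m) (b : cyclic n) : cyclic (m + n - 2) :=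
  gsign k m *: gcast (lie_deg m n) (cyclicI _ (cup _ _ (boundary m a) (boundary n b))).

Lemma irep_lie_bracket_fun m n (a : cyclic m) (b : cyclic n) t u :
  crep (boundary m a) t -> crep (boundary n b) u ->
  irep (lie_bracket_fun a b) ((-1) ^+ odd `|m|%N *: (t * u)).
Proof.
move=> at_ bu; rewrite signr_odd; apply/irepZ/irep_gcast.
by eexists; [reflexivity | apply: crep_cup].
Qed.

Lemma lie_bracket_bilinear m n : bilinear_for *:%R *:%R (@lie_bracket_fun m n).
Proof.
split=> [b s a a'|a s b b']; rewrite /lie_bracket_fun.
  by rewrite linearP linearPl !linearP /= !scalerA mulrC.
by rewrite linearP linearPr !linearP /= !scalerA mulrC.
Qed.

Definition lie_bracket m n : {bilinear cyclic m -> cyclic n -> cyclic (m + n - 2)%R} :=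
  mk_bilinear (@lie_bracket_bilinear m n).

Lemma irep_lie_bracket m n (a : cyclic m) (b : cyclic n) t u :
  crep (boundary m a) t -> crep (boundary n b) u ->
  irep (lie_bracket m n a b) ((-1) ^+ odd `|m|%N *: (t * u)).
Proof. exact: irep_lie_bracket_fun. Qed.

Lemma lie_bracketE m n (a : cyclic m) (b : cyclic n) (e : m - 1 + (n - 1) = m + n - 2) :
  lie_bracket m n a b = gsign k m *: gcast e (cyclicI _ (cup _ _ (boundary m a) (boundary n b))).
Proof. by rewrite (eq_irrelevance e (lie_deg m n)). Qed.

Opaque lie_bracket.

Lemma lie_bracketC m n (a : cyclic m) (b : cyclic n) (e : n + m - 2 = m + n - 2) :
  lie_bracket m n a b = - (gsign k (m * n) *: gcast e (lie_bracket n m b a)).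
Proof.
have [t at_ _] := boundary_rep a; have [u bu _] := boundary_rep b.
apply: (irep_bnd (irep_lie_bracket at_ bu)
  (irepN (irepZ _ (irep_gcast e (irep_lie_bracket bu at_))))).
have [[ht dt] [hu du]] := (crep_cocyc at_, crep_cocyc bu).
have := bndZ ((-1) ^+ odd `|m|%N) (bnd_comm chi_invol ht hu dt du).
congr bnd; rewrite gsign_odd odd_abszM !odd_abszB1.
by case: (odd `|m|%N); case: (odd `|n|%N) => /=; by_signs; abel.
Qed.

(** The Poisson identity for [t], [u], [v], on which [B] vanishes; the term
    [B (t * (u * v))] disappears in cyclic cohomology. *)
Lemma lie_bracket_jacobi i j l (a : cyclic i) (b : cyclic j) (c : cyclic l)
    (e1 : (i + j - 2) + l - 2 = i + (j + l - 2) - 2)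
    (e2 : j + (i + l - 2) - 2 = i + (j + l - 2) - 2) :
  lie_bracket _ _ a (lie_bracket _ _ b c) =
    gcast e1 (lie_bracket _ _ (lie_bracket _ _ a b) c)
    + gsign k (i * j) *: gcast e2 (lie_bracket _ _ b (lie_bracket _ _ a c)).
Proof.
have [t at_ Bt] := boundary_rep a; have [u bu Bu] := boundary_rep b.
have [v cv Bv] := boundary_rep c.
have bc := crep_boundary_irep (irep_lie_bracket bu cv).
have ac := crep_boundary_irep (irep_lie_bracket at_ cv).
have ab := crep_boundary_irep (irep_lie_bracket at_ bu).
have e : (i - 1) + ((j - 1) + (l - 1)) - 1 = i + (j + l - 2) - 2 by lia.
apply: (irep_eq e (irep_lie_bracket at_ bc) (irepD (irep_gcast e1 (irep_lie_bracket ab cv))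
  (irepZ _ (irep_gcast e2 (irep_lie_bracket bu ac))))
  (crepZ ((-1) ^+ odd `|j|%N) (crepN (crep_cup at_ (crep_cup bu cv))))).
have := bndZ ((-1) ^+ odd `|j|%N)
  (bnd_poisson chi_invol (crep_cocyc at_) (crep_cocyc bu) (crep_cocyc cv)).
rewrite /bvdev /bvdefect Bt Bu Bv !mul0r !mulr0 !scaler0 !subr0.
rewrite gsign_odd odd_abszM !odd_abszB1 !odd_abszD !(linearZ_LR conB) (linearN conB).
rewrite -!scalerAl -!scalerAr.
move: (t * conB _) (u * conB _) (conB _ * v) (conB (t * (u * v))) => p q r s; congr bnd.
by case: (odd `|i|%N); case: (odd `|j|%N) => /=; by_signs; abel.
Qed.

Definition cyclic_lie2 : lie2 cyclic := Lie2 lie_bracketC lie_bracket_jacobi.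

End CyclicCohomology.

Theorem theorem1p1 (k : comNzRingType) (H : hopfAlgType k)
    (chi : {lrmorphism H -> k^o}) (chi_invol : modular_pair_in_involution chi) :
  exists V : batalin_vilkovisky (cotor H),
    [/\ induced_by_cup (gcup V),
        cotor_class (gone V) (cobar_one H),
        induced_by_connesB chi (bvB V)
      & exists (I : forall n, {linear cotor H n -> cyclic_coh chi n})
               (bd : forall n, {linear cyclic_coh chi n -> cotor H (n - 1)})
               (L : lie2 (cyclic_coh chi)),
          [/\ induced_by_tot_head I,
              induced_by_boundary bd
            & forall (m n : int) (a : cyclic_coh chi m) (b : cyclic_coh chi n)
                     (e : m - 1 + (n - 1) = m + n - 2),
                lbr L m n a b =
                gsign k m *: gcast e (I _ (gcup V _ _ (bd m a) (bd n b)))]].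
Proof.
exists (cotor_bv chi_invol); split.
- by move=> i j x y a b xa yb; apply: cup_class.
- exact: cotor_one_class.
- exact: cotorB_induced.
exists (@cyclicI k H chi), (boundary chi_invol), (cyclic_lie2 chi_invol).
split; [exact: cyclicI_tot_head | exact: boundary_induced | exact: lie_bracketE].
Qed.
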